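(* Let $\Gamma$ be a finite nonempty simplicial graph and $\mathcal{G}_\Gamma$ a graph product with nontrivial vertex groups. Let $U\subseteq\mathcal{G}_\Gamma$ be any subset. Set $d=\dim(\Gamma)$, $k=\min\{|U|^2,|\Gamma^{(0)}|\}$ (where $|U|^2$ is interpreted as $\infty$ if $U$ is infinite), and $$N=\begin{cases}(6d+5)^k & \text{if no vertex group contains an element of order }2,\\ (2^{d+3}d)^k & \text{in general.}\end{cases}$$ Then: (1) If the subgroup $\langle U\rangle$ contains a regular element, then there exists an integer $1\le n\le N$ such that $U^n$ contains a regular element. (2) If $\langle U\rangle$ contains a strongly irreducible element, then there exists $1\le n\le N$ such that $U^n$ contains a strongly irreducible element. In particular $N$ can be bounded in terms of $|\Gamma^{(0)}|$ alone, or in terms of $\dim(\Gamma)$ and $|U|$ alone.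
   Context: Graph products: $\Gamma$ is a finite simplicial graph and for each vertex $v$ a nontrivial group $\mathcal{G}_v$ is given (no finite generation or countability is assumed). The graph product $\mathcal{G}_\Gamma$ is the quotient of the free product $\ast_{v\in\Gamma}\mathcal{G}_v$ by the normal subgroup generated by all commutators $[g,h]$ with $g\in\mathcal{G}_u$, $h\in\mathcal{G}_w$ and $u,w$ adjacent. Subsets $\Lambda\subseteq\Gamma^{(0)}$ are identified with the full subgraphs they span; $\mathcal{G}_\Lambda=\langle\mathcal{G}_v: v\in\Lambda\rangle$ is a standard parabolic subgroup (it is isomorphic to the graph product over $\Lambda$). $\dim(\Gamma)$ denotes the largest cardinality of a clique in $\Gamma$. Two disjoint nonempty vertex sets $\Lambda_1,\Lambda_2$ are said to be joined if every vertex of $\Lambda_1$ is adjacent to every vertex of $\Lambda_2$; then $\mathcal{G}_{\Lambda_1\cup\Lambda_2}\cong\mathcal{G}_{\Lambda_1}\times\mathcal{G}_{\Lambda_2}$. For a subset $U$ of a group and $n\ge1$, $U^n=\{u_1\cdots u_n: u_i\in U\}$. An element $g\in\mathcal{G}_\Gamma$ is strongly irreducible if $g$ is not conjugate into any vertex group $\mathcal{G}_v$, and not conjugate into any $\mathcal{G}_{\Lambda_1\cup\Lambda_2}$ with $\Lambda_1,\Lambda_2$ disjoint, nonempty and joined. An element $g$ is regular if for every $n\ge1$, $g^n$ is not conjugate into any vertex group, and not conjugate into any $\mathcal{G}_{\Lambda_1\cup\Lambda_2}$ with $\Lambda_1,\Lambda_2$ disjoint, nonempty, joined, and with both $\mathcal{G}_{\Lambda_1}$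 and $\mathcal{G}_{\Lambda_2}$ infinite. *)

(* Defs.v *)
From Stdlib Require List.
From mathcomp Require Import all_boot.
Set Implicit Arguments. Unset Strict Implicit. Unset Printing Implicit Defensive.

Record grp := Grp {
  gcar :> Type;
  gmul : gcar -> gcar -> gcar;
  gone : gcar;
  ginv : gcar -> gcar;
  gmulA : forall x y z, gmul x (gmul y z) = gmul (gmul x y) z;
  gmul1 : forall x, gmul gone x = x;
  gmulV : forall x, gmul (ginv x) x = gone
}.

Section GraphProduct.
Variables (V : finType) (e : rel V) (G : V -> grp).

Definition letter := {v : V & G v}.
Definition word := seq letter.

(* Defining relations of the graph product (as a monoid presentation of the
   quotient of the free product by commutators of adjacent vertex groups). *)
Inductive step : word -> word -> Prop :=
| st_one v : step [:: existT _ v (gone (G v))] [::]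
| st_mul v (a b : G v) :
    step [:: existT _ v a; existT _ v b] [:: existT _ v (gmul a b)]
| st_comm u w (a : G u) (b : G w) : e u w ->
    step [:: existT _ u a; existT _ w b] [:: existT _ w b; existT _ u a].

(* Two words represent the same element of the graph product. *)
Inductive weq : word -> word -> Prop :=
| weq_step p q s t : step s t -> weq (p ++ s ++ q) (p ++ t ++ q)
| weq_refl w : weq w w
| weq_sym w w' : weq w w' -> weq w' w
| weq_trans w1 w2 w3 : weq w1 w2 -> weq w2 w3 -> weq w1 w3.

Definition winv (w : word) : word :=
  rev (map (fun x : letter => existT (fun v => G v) (projT1 x) (ginv (projT2 x))) w).

Definition wpow (w : word) (n : nat) : word := flatten (nseq n w).

Definition supported (L : {set V}) (w : word) : bool :=
  all (fun x : letter => projT1 x \in L) w.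

Definition conj_into (L : {set V}) (g : word) : Prop :=
  exists h w, supported L w /\ weq (h ++ g ++ winv h) w.

Definition infinite_par (L : {set V}) : Prop :=
  forall s : seq word, exists w, supported L w /\ List.Forall (fun w' => ~ weq w w') s.

Definition joined (L1 L2 : {set V}) : bool :=
  [forall u in L1, forall w in L2, e u w].

Definition strongly_irreducible (g : word) : Prop :=
  ~ (exists v, conj_into [set v] g) /\
  ~ (exists L1 L2 : {set V}, L1 != set0 /\ L2 != set0 /\ [disjoint L1 & L2] /\
        joined L1 L2 /\ conj_into (L1 :|: L2) g).

Definition regular (g : word) : Prop :=
  forall n, 0 < n ->
  ~ (exists v, conj_into [set v] (wpow g n)) /\
  ~ (exists L1 L2 : {set V}, L1 != set0 /\ L2 != set0 /\ [disjoint L1 & L2] /\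
        joined L1 L2 /\ infinite_par L1 /\ infinite_par L2 /\
        conj_into (L1 :|: L2) (wpow g n)).

(* U (a set of words closed under weq) represents a subset of G_Gamma *)
Definition saturated (U : word -> Prop) : Prop :=
  forall w w', weq w w' -> U w -> U w'.

Definition card_eq (U : word -> Prop) (m : nat) : Prop :=
  exists s : seq word, size s = m /\ List.Forall U s /\
    (forall i j, i < m -> j < m -> i != j -> ~ weq (nth [::] s i) (nth [::] s j)) /\
    (forall w, U w -> List.Exists (weq w) s).

Definition is_k (U : word -> Prop) (k : nat) : Prop :=
  (exists m, card_eq U m /\ k = minn (m ^ 2) #|V|) \/
  ((~ exists m, card_eq U m) /\ k = #|V|).

Definition in_pow (U : word -> Prop) (n : nat) (g : word) : Prop :=
  exists s : seq word, size s = n /\ List.Forall U s /\ weq g (flatten s).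

Definition in_gen (U : word -> Prop) (g : word) : Prop :=
  exists s : seq (bool * word), List.Forall (fun p => U p.2) s /\
    weq g (flatten (map (fun p => if p.1 then winv p.2 else p.2) s)).

Definition has_order2 : Prop :=
  exists v (a : G v), a <> gone (G v) /\ gmul a a = gone (G v).

End GraphProduct.

Definition cliqueb (V : finType) (e : rel V) (A : {set V}) : bool :=
  [forall u in A, forall w in A, (u != w) ==> e u w].

Definition dimG (V : finType) (e : rel V) : nat :=
  \max_(A : {set V} | cliqueb e A) #|A|.

(* Main.v *)
(* Each vertex v gives a splitting of the graph product G as the amalgam of G_(V \ v)
   and G_(star v) over G_(link v), hence a Bass-Serre tree T_v; let lox x be the set of v
   for which x is loxodromic on T_v.  Whether x is strongly irreducible, or regular,
   is decided by lox x and is inherited by elements with a larger set.  If <U> contains an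
   element loxodromic on T_v, then by Serre's lemma so is a product of two elements of U;
   thus k pairs from U capture lox g for every g in <U>, and it remains to combine two
   elements g, h into some h^s g^n loxodromic on each tree on which g or h is.
   If h^s g^n is elliptic on T_v, then a power reverses a long segment of the axis of the
   other element, or the two axes share a long segment and h^s g^n fixes the whole axis
   of h.  An element fixing enough of an axis of h in T_v fixes the axis of h in T_u for
   all u in the component of v in the complement graph spanned by lox h.  Hence
   distinct obstructed values of n, or of the 2-adic valuations of n and s, come
   from vertices in different components, that is from pairwise adjacent vertices, and
   there are at most dim of them.  Without 2-torsion no long reversals occur. *)
From Stdlib Require Import ZArith Lia.
From HB Require Import structures.
From mathcomp Require Import all_boot zify.
From mathcomp Require Import boolp.
Require Import Defs.
Set Implicit Arguments. Unset Strict Implicit. Unset Printing Implicit Defensive.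

(** Valuations enter because odd powers of an element that exchanges the two ends of an axis
    exchange them again, while even powers keep them: all powers of one element that reverse a given
    axis have the same 2-adic valuation. With d the dimension, avoiding d valuations takes 2^d
    consecutive exponents, and avoiding d further values takes d + 1 such blocks; this gives the
    order of magnitude 2^d d in the general bound. Without 2-torsion only the d + 1 remains. The two
    exponents have different costs. In h^s g^n the element h is a new product of two generators, so
    s contributes 2 s, but n multiplies the length accumulated so far. Hence acylindricity, which
    needs the longer range, is always applied along the axis of h and charged to s. No normal form
    theorem is assumed. The action on T_v is defined letter by letter and checked on the defining
    relations; normal form information is then recovered from displacements, since a shortest word
    moves the base point of T_v by twice its number of letters at v. *)

(* A tree as the integral metric on its vertices: dist4 is the four-point condition
   (0-hyperbolicity), and dist_even, which says that the graph is bipartite, makes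
   medians vertices. *)
Record tree := Tree {
  vert :> Type;
  dist : vert -> vert -> Z;
  dist_ge0 : forall x y, (0 <= dist x y)%Z;
  dist_eq0 : forall x y, dist x y = 0%Z <-> x = y;
  distC : forall x y, dist x y = dist y x;
  dist4 : forall x y z w,
    (dist x y + dist z w <= dist x z + dist y w)%Z \/
    (dist x y + dist z w <= dist x w + dist y z)%Z;
  dist_even : forall x y z, Z.Even (dist x y + dist y z + dist x z);
  dist_geo : forall x y k, (0 <= k <= dist x y)%Z ->
    exists z, dist x z = k /\ dist z y = (dist x y - k)%Z
}.

Arguments dist_ge0 {t} x y.
Arguments dist4 {t} x y z w.

(** * Geodesics, medians and concatenation in a tree *)

Section TreeGeometry.
Open Scope Z_scope.
Variable P : tree.
Implicit Types x y z m : P.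
Local Notation d := (@dist P).

Definition between x m y := d x m + d m y = d x y.

Lemma dist_refl x : d x x = 0.
Proof. by apply/dist_eq0. Qed.

Lemma dist_tri x y z : d x y <= d x z + d z y.
Proof.
have := dist4 x y z z; have := distC y z; have := dist_refl z; lia.
Qed.

Arguments dist_tri : clear implicits.

Lemma between_sym x m y : between x m y -> between y m x.
Proof. by rewrite /between (distC y m) (distC m x) (distC y x); lia. Qed.

Lemma between_dist x y m m' : between x m y -> between x m' y ->
  d m m' = Z.abs (d x m - d x m').
Proof.
rewrite /between => h1 h2.
have := dist4 m m' x y; have := dist_tri x m' m; have := dist_tri x m m'.
have := distC m m'; have := distC x m; have := distC x m'.
by lia.
Qed.

Lemma between_uniq x y m m' : between x m y -> between x m' y ->
  d x m = d x m' -> m = m'.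
Proof. by move=> h1 h2 h; apply/dist_eq0; rewrite (between_dist h1 h2) h; lia. Qed.

Lemma between_trans x y m m' : between x m y -> between x m' m -> between x m' y.
Proof.
rewrite /between => h1 h2.
have := dist_tri m' y m; have := dist_tri x y m'; lia.
Qed.

Lemma between_mid x y m m' : between x m y -> between x m' m -> between m' m y.
Proof.
rewrite /between => h1 h2.
have := dist_tri m' y m; have := dist_tri x y m'; lia.
Qed.

Lemma median x y z : exists m, between x m y /\ between y m z /\ between x m z.
Proof.
have [c hc] := dist_even x y z.
have t1 := dist_tri x y z; have t2 := dist_tri x z y; have t3 := dist_tri y z x.
have c1 := distC z y; have c2 := distC y x.
(* [c - d y z] is the Gromov product of y and z at x, an integer because the perimeter is
   [2 * c]. *)
have [] := @dist_geo P x y (c - d y z); first by lia.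
move=> m [h1 h2]; exists m; rewrite /between.
have := dist4 m z x y; have c3 := distC m x; have c4 := distC z x.
have := dist_tri x z m; have := dist_tri y z m; have c5 := distC y m.
by lia.
Qed.

(** Local geodesics are geodesics: overlapping in a nontrivial segment [y, z] leaves no room for
    backtracking, by the four-point condition. *)
Lemma between_cat x y z w : between x y z -> between y z w -> y <> z ->
  between x y w /\ between x z w.
Proof.
rewrite /between => h1 h2 /dist_eq0 hn.
have := dist4 x z y w; have := dist4 x w y z; have := distC z y.
have := dist_tri x w y; have := dist_tri x w z; have := dist_ge0 y z.
have := distC w y; have := distC w z; have := distC x w.
by lia.
Qed.

End TreeGeometry.
Arguments dist_tri {P} x y z.

(** * Integer powers in a group *)

Section ZPower.
Local Open Scope group_scope.
Variable G : groupType.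
Implicit Types g h : G.

Definition zexp g (k : Z) : G :=
  match k with
  | Z0 => 1
  | Zpos p => g ^+ Pos.to_nat p
  | Zneg p => g ^- Pos.to_nat p
  end.

Lemma zexp_nat g n : zexp g (Z.of_nat n) = g ^+ n.
Proof. by case: n => [|n] //=; rewrite SuccNat2Pos.id_succ. Qed.

Lemma zexp_opp_nat g n : zexp g (- Z.of_nat n) = g ^- n.
Proof. by case: n => [|n] /=; rewrite ?invg1 // SuccNat2Pos.id_succ. Qed.

Lemma zexp0 g : zexp g 0 = 1. Proof. by []. Qed.
Lemma zexp1 g : zexp g 1 = g. Proof. by []. Qed.

Lemma zexpS g k : zexp g (k + 1) = g * zexp g k.
Proof.
case: (Z_le_gt_dec 0 k) => hk.
  rewrite -(Z2Nat.id k) //; set n := Z.to_nat k.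
  by rewrite (_ : Z.of_nat n + 1 = Z.of_nat n.+1)%Z ?zexp_nat ?expgS //; lia.
have -> : k = (- Z.of_nat (Z.to_nat (- k - 1)).+1)%Z by lia.
set n := Z.to_nat _.
have -> : (- Z.of_nat n.+1 + 1 = - Z.of_nat n)%Z by lia.
by rewrite !zexp_opp_nat expgSr invgM mulgA mulgV mul1g.
Qed.

Lemma zexpD g k l : zexp g (k + l) = zexp g k * zexp g l.
Proof.
move: k; apply: Z.bi_induction => [|k]; first by rewrite /= mul1g.
rewrite -Z.add_1_r (_ : k + 1 + l = (k + l) + 1)%Z; last by lia.
rewrite !zexpS -mulgA; split=> [->//|].
exact: mulgI.
Qed.

Lemma zexpC g k l : zexp g k * zexp g l = zexp g l * zexp g k.
Proof. by rewrite -!zexpD Z.add_comm. Qed.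

Lemma zexpMC g k : zexp g k * g = g * zexp g k.
Proof. by rewrite -{2 3}(zexp1 g) zexpC. Qed.

Lemma zexp_comm g h k : g * h = h * g -> g * zexp h k = zexp h k * g.
Proof.
move=> c; move: k; apply: Z.bi_induction => [|k]; first by rewrite mulg1 mul1g.
rewrite -Z.add_1_r zexpS mulgA c -!mulgA; split=> [->//|]; exact: mulgI.
Qed.

Lemma zexpM g h k : g * h = h * g -> zexp (g * h) k = zexp g k * zexp h k.
Proof.
move=> c; move: k; apply: Z.bi_induction => [|k]; first by rewrite mulg1.
have -> : zexp g (Z.succ k) * zexp h (Z.succ k) = g * h * (zexp g k * zexp h k).
  rewrite -Z.add_1_r !zexpS -!mulgA; congr (_ * _); rewrite !mulgA; congr (_ * _).
  by rewrite zexp_comm.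
rewrite -Z.add_1_r zexpS; split=> [->//|]; exact: mulgI.
Qed.

Lemma zexp_conj o g k : zexp (o * g * o^-1) k = o * zexp g k * o^-1.
Proof.
move: k; apply: Z.bi_induction => [|k]; first by rewrite mulg1 mulgV.
rewrite -Z.add_1_r !zexpS; have -> : o * (g * zexp g k) * o^-1 = o * g * o^-1 * (o * zexp g k * o^-1).
  by rewrite !mulgA mulgVK.
split=> [->//|]; exact: mulgI.
Qed.

End ZPower.

Record action (G : groupType) (P : tree) := Action {
  act : G -> P -> P;
  act1 : forall x, act 1%g x = x;
  actM : forall g h x, act (g * h)%g x = act g (act h x);
  act_dist : forall g x y, dist (act g x) (act g y) = dist x y
}.

(** * Isometries of trees *)

Section TreeAction.
Open Scope Z_scope.
Variables (G : groupType) (P : tree) (A : action G P).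
Implicit Types (x y z m : P) (g h r f : G).
Local Notation d := (@dist P).
Local Notation "g ∙ x" := (act A g x) (at level 39, right associativity).

Lemma actKV g x : g ∙ g^-1%g ∙ x = x.
Proof. by rewrite -actM mulgV act1. Qed.

Lemma actK g x : g^-1%g ∙ g ∙ x = x.
Proof. by rewrite -actM mulVg act1. Qed.

Lemma act_inj g x y : g ∙ x = g ∙ y -> x = y.
Proof. by move=> h; rewrite -(actK g x) h actK. Qed.

Lemma act_distV g x y : d (g ∙ x) y = d x (g^-1%g ∙ y).
Proof. by rewrite -(act_dist A g x) actKV. Qed.

Lemma act_distVr g x y : d x (g ∙ y) = d (g^-1%g ∙ x) y.
Proof. by rewrite distC act_distV distC. Qed.

Lemma act_between g x m y : between x m y -> between (g ∙ x) (g ∙ m) (g ∙ y).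
Proof. by rewrite /between !act_dist. Qed.

Lemma act_fixV g x : g ∙ x = x -> g^-1%g ∙ x = x.
Proof. by move=> h; apply: (@act_inj g); rewrite actKV. Qed.

Lemma fix_between g x m y : g ∙ x = x -> g ∙ y = y -> between x m y -> g ∙ m = m.
Proof.
move=> hx hy hb; have := act_between g hb; rewrite hx hy => hb'.
by apply: (between_uniq hb' hb); rewrite -{1}hx act_dist.
Qed.

Lemma act_expS g n x : (g ^+ n.+1)%g ∙ x = g ∙ (g ^+ n)%g ∙ x.
Proof. by rewrite expgS actM. Qed.

Lemma fix_exp g n x : g ∙ x = x -> (g ^+ n)%g ∙ x = x.
Proof. by move=> h; elim: n => [|n IH]; rewrite ?act1 // act_expS IH. Qed.

Definition elliptic g := exists x, g ∙ x = x.

Lemma elliptic_exp g n : elliptic g -> elliptic (g ^+ n)%g.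
Proof. by case=> x hx; exists x; apply: fix_exp. Qed.

Lemma elliptic_conj g h : elliptic (h * g * h^-1)%g -> elliptic g.
Proof.
case=> x; rewrite !actM => hx; exists (h^-1%g ∙ x).
by apply: (@act_inj h); rewrite actKV.
Qed.

(* The midpoint of [q, r q] is the projection of q to both fixed sets. *)
Lemma elliptic_prod r f q x y : r ∙ x = x -> f ∙ y = y -> (f * r)%g ∙ q = q ->
  exists m, r ∙ m = m /\ f ∙ m = m.
Proof.
move=> hx hy; rewrite actM => hq.
have hq' : r ∙ q = f^-1%g ∙ q by apply: (@act_inj f); rewrite actKV.
have key g z : g ∙ z = z -> g ∙ q = r ∙ q ->
  exists m, g ∙ m = m /\ between q m (r ∙ q) /\ d q m = d m (r ∙ q).
  move=> hz hgq; have [m [h1 [h2 h3]]] := median q z (r ∙ q).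
  have hm : d q m = d m (r ∙ q).
    have e : d z q = d z (r ∙ q) by rewrite -hgq -{2}hz act_dist.
    move: h1 h2 h3; rewrite /between; have := distC q z; have := distC m z; lia.
  exists m; split=> //.
  have := act_between g (between_sym h1); rewrite hz hgq => h4.
  apply: (between_uniq h4 h2); by rewrite -{1}hz act_dist.
have [m [m1 [m2 m3]]] := key r x hx erefl.
have [m' [m1' [m2' m3']]] := key _ y (act_fixV hy) (esym hq').
have e : m = m'.
  apply: (between_uniq m2 m2'); move: m2 m2'; rewrite /between; lia.
by exists m; split=> //; rewrite e -{1}m1' actKV.
Qed.

Definition is_axis g (al : Z -> P) (t : Z) :=
  0 < t /\ (forall a b, d (al a) (al b) = Z.abs (a - b)) /\
  forall a, g ∙ al a = al (a + t).

(** The segments [o, g o] and [g o, g^2 o] do not fold, and by equivariance neither does any later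
    pair, so the orbit is geodesic. The induction carries two consecutive powers for the four-point
    condition. *)
Lemma translation_powers g o t : 0 < t -> d o (g ∙ o) = t -> d o (g ∙ g ∙ o) = 2 * t ->
  forall n, d o ((g ^+ n)%g ∙ o) = Z.of_nat n * t.
Proof.
move=> t0 h1 h2 n.
suff [] : d o ((g ^+ n)%g ∙ o) = Z.of_nat n * t /\ d o ((g ^+ n.+1)%g ∙ o) = Z.of_nat n.+1 * t by [].
elim: n => [|n [IH1 IH2]].
  by rewrite act1 expg1 dist_refl h1; lia.
split=> //.
case: n IH1 IH2 => [|n] IH1 IH2; first by rewrite expgS actM expg1 h2; lia.
have e2 k : d (g ∙ o) ((g ^+ k.+1)%g ∙ o) = d o ((g ^+ k)%g ∙ o).
  by rewrite expgS actM act_dist.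
have e3 k : d ((g ^+ k)%g ∙ o) ((g ^+ k.+1)%g ∙ o) = t.
  by rewrite expgSr actM act_dist.
have := dist4 o ((g ^+ n.+3)%g ∙ o) (g ∙ o) ((g ^+ n.+2)%g ∙ o).
have := dist4 o ((g ^+ n.+2)%g ∙ o) (g ∙ o) ((g ^+ n.+3)%g ∙ o).
have c1 := distC ((g ^+ n.+3)%g ∙ o) (g ∙ o).
have c2 := distC ((g ^+ n.+2)%g ∙ o) (g ∙ o).
have c3 := distC ((g ^+ n.+3)%g ∙ o) ((g ^+ n.+2)%g ∙ o).
have := (e2 n.+1, e2 n.+2, e3 n.+2); case=> [[]].
by nia.
Qed.

End TreeAction.

Section Axes.
Open Scope Z_scope.
Variables (G : groupType) (P : tree) (A : action G P).
Implicit Types (x y z m : P) (g h r f : G) (al be : Z -> P).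
Local Notation d := (@dist P).
Local Notation "g ∙ x" := (act A g x) (at level 39, right associativity).

(** The axis is the union of the translates of one chosen geodesic from o to g o: [a / t] selects
    the translate and [a mod t] the point on it. The parametrization puts the orbit of o at the
    multiples of t. *)
Lemma axis_exists g o t : 0 < t -> d o (g ∙ o) = t -> d o (g ∙ g ∙ o) = 2 * t ->
  exists al, is_axis A g al t /\ forall k, al (k * t) = zexp g k ∙ o.
Proof.
move=> t0 h1 h2.
have hp := translation_powers t0 h1 h2.
have hz i j : i <= j -> d (zexp g i ∙ o) (zexp g j ∙ o) = (j - i) * t.
  move=> hij; have -> : j = i + Z.of_nat (Z.to_nat (j - i)) by lia.
  by rewrite zexpD actM act_dist zexp_nat hp; lia.
have hga k : exists z, 0 <= k <= t -> d o z = k /\ d z (g ∙ o) = t - k.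
  case: (Z_le_gt_dec 0 k) => hk1; last by exists o; lia.
  case: (Z_le_gt_dec k t) => hk2; last by exists o; lia.
  by have [|z hzz] := @dist_geo P o (g ∙ o) k; [lia|exists z; rewrite -h1].
have {hga} [ga hga] := choice hga.
pose al a := zexp g (a / t) ∙ ga (a mod t).
have hga0 : ga 0 = o by apply/dist_eq0; rewrite distC; apply hga; lia.
have hm a := Z.mod_pos_bound a t t0.
have hd a := Z.div_mod a t.
have bt i j a : i <= a / t -> a / t + 1 <= j ->
    between (zexp g i ∙ o) (al a) (zexp g j ∙ o) /\ d (zexp g i ∙ o) (al a) = a - i * t.
  move=> hi hj.
  have [e1 e2] : d (zexp g (a / t) ∙ o) (al a) = a mod t /\
      d (al a) (zexp g (a / t + 1) ∙ o) = t - a mod t.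
    rewrite zexpS -zexpMC actM !act_dist; have := hm a => hma.
    by apply: hga; lia.
  have := dist_tri (zexp g i ∙ o) (al a) (zexp g (a / t) ∙ o).
  have := dist_tri (al a) (zexp g j ∙ o) (zexp g (a / t + 1) ∙ o).
  have := dist_tri (zexp g i ∙ o) (zexp g j ∙ o) (al a).
  rewrite e1 e2 !hz; try lia.
  have := hd a; rewrite /between hz; nia.
exists al; split; last first.
  by move=> k; rewrite /al Z_div_mult ?Z_mod_mult ?hga0 //; lia.
split=> //; split.
  have hle a b : a <= b -> d (al a) (al b) = Z.abs (a - b).
    move=> hab; have hdiv : a / t <= b / t by apply: Z.div_le_mono.
    have [] := bt (a / t) (b / t + 1) a; [lia|lia|move=> b1 e1].
    have [] := bt (a / t) (b / t + 1) b; [lia|lia|move=> b2 e2].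
    by rewrite (between_dist b1 b2) e1 e2; lia.
  move=> a b; case: (Z_le_gt_dec a b) => hab; first exact: hle.
  by rewrite distC hle; lia.
move=> a; rewrite /al (_ : a + t = a + 1 * t); last by lia.
by rewrite Z.div_add ?Z.mod_add ?zexpS ?actM //; lia.
Qed.

Section OneAxis.
Variables (g : G) (al : Z -> P) (t : Z).
Hypothesis ax : is_axis A g al t.

Lemma axis_pos : 0 < t. Proof. by case: ax. Qed.
Lemma axis_dist a b : d (al a) (al b) = Z.abs (a - b). Proof. by case: ax => _ []. Qed.
Lemma axis_act a : g ∙ al a = al (a + t). Proof. by case: ax => _ [] _. Qed.

Lemma axis_inj a b : al a = al b -> a = b.
Proof. by move/dist_eq0; rewrite axis_dist; lia. Qed.

Lemma axis_between a b c : a <= b <= c -> between (al a) (al b) (al c).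
Proof. by rewrite /between !axis_dist; lia. Qed.

Lemma axis_zexp k a : zexp g k ∙ al a = al (a + k * t).
Proof.
move: k; apply: Z.bi_induction => [|k]; first by rewrite act1; congr al; lia.
rewrite -Z.add_1_r zexpS actM; split=> [->|].
  by rewrite axis_act; congr al; lia.
by rewrite (_ : a + (k + 1) * t = (a + k * t) + t) -?axis_act; [move/act_inj|lia].
Qed.

Lemma axis_exp n a : (g ^+ n)%g ∙ al a = al (a + Z.of_nat n * t).
Proof. by rewrite -zexp_nat axis_zexp. Qed.

Lemma axis_expV n a : (g ^- n)%g ∙ al a = al (a - Z.of_nat n * t).
Proof. by rewrite -zexp_opp_nat axis_zexp; congr al; lia. Qed.

Lemma axis_inv : is_axis A g^-1%g (fun a => al (- a)) t.
Proof.
split; first exact: axis_pos.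
split=> [a b|a]; first by rewrite axis_dist; lia.
by apply: (@act_inj _ _ A g); rewrite actKV axis_act; congr al; lia.
Qed.

(** [al a0] is a nearest point of the axis to y. The median of y, [al a0] and [al a] lies on the
    axis and is no farther from y than it has to be, so it equals [al a0]. *)
Lemma axis_proj y : exists a0 D, 0 <= D /\ forall a, d y (al a) = D + Z.abs (a - a0).
Proof.
have [a0 ha0] : exists a0, forall a, d y (al a0) <= d y (al a).
  suff : forall n a, d y (al a) <= Z.of_nat n -> exists a0, forall a, d y (al a0) <= d y (al a).
    by move=> /(_ (Z.to_nat (d y (al 0))) 0); apply; have := dist_ge0 y (al 0); lia.
  elim=> [|n IH] a ha; first by exists a => b; have := dist_ge0 y (al b); lia.
  have [[b hb]|hn] := pselect (exists b, d y (al b) <= Z.of_nat n); first exact: IH hb.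
  exists a => b; case: (Z_le_gt_dec (d y (al b)) (Z.of_nat n)) => hb; last by lia.
  by case: hn; exists b.
exists a0, (d y (al a0)); split; first exact: dist_ge0.
move=> a.
have [m [h1 [h2 h3]]] := median y (al a0) (al a).
(* The parameter of the median, counted from [a0] towards a. *)
pose a1 := if Z_le_gt_dec a0 a then a0 + d (al a0) m else a0 - d (al a0) m.
have hdm := dist_ge0 (al a0) m; have hdm' := dist_ge0 m (al a).
have e1 : m = al a1.
  have b1 : between (al a0) (al a1) (al a).
    move: h2; rewrite /between !axis_dist /a1.
    by case: Z_le_gt_dec => /= h4 h5; lia.
  apply: (between_uniq h2 b1); rewrite axis_dist /a1.
  by case: Z_le_gt_dec => /= h4; lia.
have := ha0 a1; rewrite -e1; move: h1 h3; rewrite /between (distC m (al a0)) => h1 h3 h4.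
have e0 : d (al a0) m = 0 by lia.
by move/dist_eq0: e0 => e0; move: h2 h3; rewrite /between -e0 dist_refl !axis_dist; lia.
Qed.

Lemma proj_dist y z a D b E : 
  (forall c, d y (al c) = D + Z.abs (c - a)) -> (forall c, d z (al c) = E + Z.abs (c - b)) ->
  a <> b -> d y z = D + E + Z.abs (a - b).
Proof.
move=> hy hz hab.
have := dist4 y z (al a) (al b); have := dist4 y (al b) z (al a).
have := (hy a, hy b, hz a, hz b, axis_dist a b, axis_dist b a, distC (al a) z, distC (al b) z).
case=> [[[[[[[]]]]]]].
by lia.
Qed.

Lemma proj_dist_le y z a D b E : 
  (forall c, d y (al c) = D + Z.abs (c - a)) -> (forall c, d z (al c) = E + Z.abs (c - b)) ->
  d y z <= D + E + Z.abs (a - b).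
Proof.
move=> hy hz; have := dist_tri y z (al b); have := distC z (al b).
by have := hz b; have := hy b; lia.
Qed.

Lemma proj_zexp k y a D : (forall c, d y (al c) = D + Z.abs (c - a)) ->
  forall c, d (zexp g k ∙ y) (al c) = D + Z.abs (c - (a + k * t)).
Proof.
move=> hy c; rewrite (_ : c = (c - k * t) + k * t); last by lia.
by rewrite -axis_zexp act_dist hy; lia.
Qed.

Lemma axis_displacement y : exists D, 0 <= D /\
  forall n, (0 < n)%N -> d y ((g ^+ n)%g ∙ y) = 2 * D + Z.of_nat n * t.
Proof.
have [a [D [D0 hD]]] := axis_proj y; exists D; split=> // n n0.
have t0 := axis_pos.
have h := @proj_zexp (Z.of_nat n) _ _ _ hD; rewrite zexp_nat in h.
by rewrite (proj_dist hD h); nia.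
Qed.

Lemma axis_not_elliptic n : (0 < n)%N -> ~ elliptic A (g ^+ n)%g.
Proof.
move=> n0 [y hy]; have [D [D0 hD]] := axis_displacement y.
have := hD n n0; rewrite hy dist_refl; have := axis_pos; nia.
Qed.

(** This excludes reversals by powers of a loxodromic element: the square of a reversal moves far
    points of the axis less than the reversal itself does. *)
Lemma axis_displacement_mono n y :
  d y ((g ^+ n)%g ∙ y) <= d y ((g ^+ n)%g ∙ (g ^+ n)%g ∙ y).
Proof.
case: n => [|n]; first by rewrite !act1; lia.
rewrite -actM -expgnDr; have [D [D0 hD]] := axis_displacement y.
by have := axis_pos; rewrite !hD //; nia.
Qed.

(** The centre of the reflection is free, so the image may be disjoint from the segment itself. *)
Definition reverses r (u e : Z) := exists c, forall a, u <= a <= u + e -> r ∙ al a = al (c - a).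

(* If r and g^s r are both elliptic, the fixed points project to the axis of g at
   distance s t / 2, and r reflects the segment between the two projections. *)
Lemma elliptic_reverses s r : (0 < s)%N -> elliptic A r -> elliptic A (g ^+ s * r)%g ->
  exists u e, 2 * e = Z.of_nat s * t /\ reverses r u e.
Proof.
move=> s0 [c hc] [y hy]; have t0 := axis_pos.
have hry : r ∙ y = (g ^- s)%g ∙ y by apply: (@act_inj _ _ A (g ^+ s)%g); rewrite actKV -actM.
have [ac [Dc [Dc0 hDc]]] := axis_proj c.
have [ay [Dy [Dy0 hDy]]] := axis_proj y.
have hDy' := @proj_zexp (- Z.of_nat s) _ _ _ hDy.
rewrite zexp_opp_nat -hry in hDy'.
have e : d c y = d c (r ∙ y) by rewrite -{2}hc act_dist.
set T := Z.of_nat s * t in hDy' *; have T0 : 0 < T by rewrite /T; nia.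
have hT : - Z.of_nat s * t = - T by rewrite /T; lia.
rewrite {}hT in hDy'.
have l1 := proj_dist_le hDc hDy; have l2 := proj_dist_le hDc hDy'.
have p1 := proj_dist hDc hDy; have p2 := proj_dist hDc hDy'.
have hac : 2 * ac = 2 * ay - T by lia.
exists ac, (ay - ac); split; first by lia.
exists (2 * ac) => a ha.
have b1 : between c (al a) y.
  by rewrite /between (distC _ y) hDc hDy p1; lia.
have b2 : between c (al (2 * ac - a)) (r ∙ y).
  by rewrite /between (distC _ (r ∙ y)) hDy' hDc p2; lia.
have b3 := act_between A r b1; rewrite hc in b3.
apply: (between_uniq b3 b2).
by rewrite -{1}hc act_dist !hDc; lia.
Qed.

End OneAxis.
End Axes.

(** * Interaction of two axes *)

Section TwoAxes.
Open Scope Z_scope.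
Variables (G : groupType) (P : tree) (A : action G P).
Implicit Types (x y z m : P) (g h r f : G) (al be : Z -> P).
Local Notation d := (@dist P).
Local Notation "g ∙ x" := (act A g x) (at level 39, right associativity).

(** The foot on the axis of a point fixed by f would be moved by c, yet f preserves distances to
    that point. *)
Lemma axis_translation_elliptic h al t f c : is_axis A h al t ->
  (forall a, f ∙ al a = al (a + c)) -> elliptic A f -> c = 0.
Proof.
move=> ax hf [y hy]; have [a [D [D0 hD]]] := axis_proj ax y.
have := hD a; have := hD (a + c); rewrite -hf -{1}hy act_dist hD; lia.
Qed.

(* y lies off both axes; [y, y'] runs along the axis of h except for initial and final
   segments of length D. If r maps the start of [y, y'] (up to length D') onto its end
   reversed, then it reflects the part of the axis between D and D'. *)
Lemma partial_reversal h al t r y y' a0 D l D' q : is_axis A h al t ->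
  (forall a, d y (al a) = D + Z.abs (a - a0)) ->
  (forall a, d y' (al a) = D + Z.abs (a - (a0 - l))) -> 0 < l ->
  r ∙ y = y' -> D < D' -> 2 * D' <= l + 2 * D ->
  between y q y' -> d y q = D' -> between y (r ∙ q) y' -> 
  exists u, reverses A al r u (D' - D).
Proof.
move=> ax hy hy' l0 hr hD hl b1 e1 b2.
have hyy' : d y y' = l + 2 * D by rewrite (proj_dist ax hy hy'); lia.
have bal a : a0 - l <= a <= a0 -> between y (al a) y'.
  by move=> ha; rewrite /between (distC _ y') hy hy' hyy'; lia.
exists (a0 - (D' - D)), (2 * a0 - l) => a ha.
have b3 : between y (al a) q.
  have ba : between y (al a) y' by apply: bal; lia.
  have := between_dist ba b1; move: b1 ba; rewrite /between hy e1 distC; lia.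
have := act_between A r b3; rewrite hr => b4.
have b5 : between y' (r ∙ al a) y.
  by apply: between_trans b4; apply: between_sym.
have b6 : between y' (al (2 * a0 - l - a)) y by apply/between_sym/bal; lia.
by apply: (between_uniq b5 b6); rewrite -{1}hr act_dist hy hy'; lia.
Qed.

Variables (h g : G) (al be : Z -> P) (th tg : Z).
Hypotheses (axh : is_axis A h al th) (axg : is_axis A g be tg).

(** If y is fixed, then g^n y = h^(-s) y = y', and the single geodesic [y, y'] follows each axis
    except for end pieces of length [Dh], [Dg]. The element with longer end pieces carries the first
    onto the last reversed, hence reverses part of the other axis. In the middle the axes coincide
    with opposite orientations. *)
Lemma two_axes s n : (0 < s)%N -> (0 < n)%N -> elliptic A (h ^+ s * g ^+ n)%g ->
  exists Dh Dg, 0 <= Dh /\ 0 <= Dg /\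
    Z.of_nat s * th + 2 * Dh = Z.of_nat n * tg + 2 * Dg /\
    (Dh < Dg -> exists u, reverses A al (g ^+ n)%g u (Dg - Dh)) /\
    (Dg < Dh -> exists u, reverses A be (h ^- s)%g u (Dh - Dg)) /\
    exists c u, forall a, u <= a <= u + (Z.of_nat s * th + 2 * Dh - 2 * Z.max Dh Dg) ->
      al a = be (c - a).
Proof.
move=> s0 n0 [y hy]; have th0 := axis_pos axh; have tg0 := axis_pos axg.
have [ah [Dh [Dh0 hDh]]] := axis_proj axh y.
have [ag [Dg [Dg0 hDg]]] := axis_proj axg y.
set y' := (g ^+ n)%g ∙ y.
have hy' : y' = (h ^- s)%g ∙ y by apply: (@act_inj _ _ A (h ^+ s)%g); rewrite actKV -actM.
have hDg' := proj_zexp axg (Z.of_nat n) hDg; rewrite zexp_nat -/y' in hDg'.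
have hDh' := proj_zexp axh (- Z.of_nat s) hDh; rewrite zexp_opp_nat -hy' in hDh'.
have Lh : d y y' = Z.of_nat s * th + 2 * Dh by rewrite (proj_dist axh hDh hDh'); nia.
have Lg : d y y' = Z.of_nat n * tg + 2 * Dg by rewrite (proj_dist axg hDg hDg'); nia.
set S := Z.of_nat s * th in Lh *; set N := Z.of_nat n * tg in Lg hDg' *.
have S0 : 0 < S by rewrite /S; nia.
have N0 : 0 < N by rewrite /N; nia.
have {}hDh' a : d y' (al a) = Dh + Z.abs (a - (ah - S)) by rewrite hDh' /S; lia.
have bal a : ah - S <= a <= ah -> between y (al a) y'.
  by move=> ha; rewrite /between (distC _ y') hDh hDh' Lh; lia.
have bbe a : ag <= a <= ag + N -> between y (be a) y'.
  by move=> ha; rewrite /between (distC _ y') hDg hDg' Lg; lia.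
exists Dh, Dg; split=> //; split=> //; split; first by lia.
split; [|split].
- move=> hD.
  apply: (partial_reversal (q := be ag) axh hDh hDh') => //; first by lia.
  + by apply: bbe; lia.
  + by rewrite hDg; lia.
  + by rewrite (axis_exp axg); apply: bbe; lia.
- move=> hD.
  (* [partial_reversal] wants the foot to move downwards from y to y', so the axis of g is read
     backwards. *)
  have [|||||||||u [c hc]] := @partial_reversal _ _ _ (h ^- s)%g y y' (- ag) Dg N Dh (al ah) (axis_inv axg).
  + by move=> a; rewrite hDg; lia.
  + by move=> a; rewrite hDg'; lia.
  + by [].
  + by rewrite -hy'.
  + by [].
  + by lia.
  + by apply: bal; lia.
  + by rewrite hDh; lia.
  + by rewrite (axis_expV axh); apply: bal; lia.
  exists (- (u + (Dh - Dg))), (- c) => a ha.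
  have := hc (- a); rewrite Z.opp_involutive => ->; last by lia.
  by congr be; lia.
- exists (Dh + ah - Dg + ag), (ah - (S + 2 * Dh - Z.max Dh Dg - Dh)) => a ha.
  apply: (between_uniq (bal a _) (bbe _ _)); rewrite ?hDh ?hDg; lia.
Qed.

(* A fixed point of h^s g^n forces the two axes to overlap along most of a
   translation length, unless one of the elements reverses the axis of the other. *)
Lemma two_axes_cases (rho p : Z) s n : 1 <= rho -> 0 <= p ->
  2 * rho + 2 <= Z.of_nat n -> 2 * rho + 2 * (p + 2) <= Z.of_nat s ->
  elliptic A (h ^+ s * g ^+ n)%g ->
  (exists u e, rho * th <= e /\ reverses A al (g ^+ n)%g u e) \/
  (exists u e, rho * tg <= e /\ reverses A be (h ^- s)%g u e) \/
  exists (z : G) k, z ∙ al (k * th) = al (k * th) /\ z ∙ al ((k + p) * th) = al ((k + p) * th) /\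
    ((forall a, z ∙ al a = al a) -> forall a, (h ^+ s * g ^+ n)%g ∙ al a = al a).
Proof.
move=> rho0 p0 hn hs hell; have th0 := axis_pos axh; have tg0 := axis_pos axg.
have [||Dh [Dg [Dh0 [Dg0 [e [rh [rg [c [u ov]]]]]]]]] := @two_axes s n _ _ hell; [lia|lia|].
case: (Z_le_gt_dec (rho * th) (Dg - Dh)) => h1.
  by left; case: rh => [|v hv]; [nia|exists v, (Dg - Dh)].
case: (Z_le_gt_dec (rho * tg) (Dh - Dg)) => h2.
  by right; left; case: rg => [|v hv]; [nia|exists v, (Dh - Dg)].
right; right; set O := _ - 2 * Z.max Dh Dg in ov.
(* Once the reversals are short, the bounds on n and s make the overlap at least [2 * tg] and at
   least [2 * (p + 2) * th]; this is their average. *)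
have hO : tg + th + (p + 1) * th <= O.
  by rewrite /O; case: (Z_le_gt_dec Dh Dg) => h3; nia.
(* On the overlap both elements act as translations, so their commutator fixes it except for a
   margin of [tg] and one of [th]. *)
pose z := (g^-1 * (h^-1 * (g * h)))%g.
have hz : (h * g * z = g * h)%g by rewrite /z !mulgA mulgK mulgV mul1g.
have sh a : u + tg <= a <= u + O -> g ∙ al a = al (a - tg).
  move=> ha; rewrite ov ?(axis_act axg) ?ov; try lia.
  by congr be; lia.
have zf a : u + tg <= a <= u + O - th -> z ∙ al a = al a.
  move=> ha; apply: (@act_inj _ _ A (h * g)%g); rewrite -actM hz !actM.
  rewrite (axis_act axh) sh ?sh ?(axis_act axh); try lia.
  by congr al; lia.
(* A ceiling: [k * th] is the first multiple of [th] that is at least [u + tg]. *)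
pose k := - ((- (u + tg)) / th).
have hk : u + tg <= k * th < u + tg + th.
  have := Z.div_mod (- (u + tg)) th; have := Z.mod_pos_bound (- (u + tg)) th th0.
  by rewrite /k; nia.
exists z, k; split; first by apply: zf; nia.
split; first by apply: zf; nia.
move=> zfix.
(* If the commutator fixes the whole axis, g and h commute on it, so the translation by [- tg] seen
   on the overlap propagates along all of the axis of h. *)
have step a : g ∙ al a = al (a - tg) <-> g ∙ al (a + th) = al (a + th - tg).
  have e1 : g ∙ al (a + th) = h ∙ g ∙ al a.
    by rewrite -(axis_act axh) -actM -hz actM zfix actM.
  have e2 : al (a + th - tg) = h ∙ al (a - tg) by rewrite (axis_act axh); congr al; lia.
  by rewrite e1 e2; split=> [->|/act_inj].
have steps a j : g ∙ al a = al (a - tg) <-> g ∙ al (a + j * th) = al (a + j * th - tg).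
  move: j; apply: Z.bi_induction => [|j]; first by rewrite Z.add_0_r.
  rewrite (_ : a + Z.succ j * th = a + j * th + th); last by lia.
  by rewrite -step.
have ga a : g ∙ al a = al (a - tg).
  apply/(steps a (k - a / th))/sh.
  by have := Z.div_mod a th; have := Z.mod_pos_bound a th th0; nia.
have gn (j : nat) a : (g ^+ j)%g ∙ al a = al (a - Z.of_nat j * tg).
  elim: j => [|j IH]; first by rewrite act1; congr al; lia.
  by rewrite act_expS IH ga; congr al; lia.
have fa a : (h ^+ s * g ^+ n)%g ∙ al a = al (a + (Z.of_nat s * th - Z.of_nat n * tg)).
  by rewrite actM gn (axis_exp axh); congr al; lia.
have e0 := axis_translation_elliptic axh fa hell.
by move=> a; rewrite fa e0; congr al; lia.
Qed.

End TwoAxes.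

(** * Coarse reversals and Serre's lemma *)

Section CoarseReversal.
Open Scope Z_scope.
Variables (G : groupType) (P : tree) (A : action G P).
Implicit Types (x y z m : P) (g h r f : G) (al be : Z -> P).
Local Notation d := (@dist P).
Local Notation "g ∙ x" := (act A g x) (at level 39, right associativity).

(** On the reflected segment r h r^-1 translates by [- t] and cancels h. Of the length
    [(p + 2) * t], one t is lost to this translation and one to rounding to multiples of t. *)
Lemma reverses_fix h al t r u e p : is_axis A h al t -> reverses A al r u e ->
  0 <= p -> (p + 2) * t <= e ->
  exists k, (r * h * r^-1 * h)%g ∙ al (k * t) = al (k * t) /\
    (r * h * r^-1 * h)%g ∙ al ((k + p) * t) = al ((k + p) * t).
Proof.
move=> ax [c hr] p0 he; have t0 := axis_pos ax.
have hrV a : u <= c - a <= u + e -> r^-1%g ∙ al a = al (c - a).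
  by move=> ha; apply: (@act_inj _ _ A r); rewrite actKV hr //; congr al; lia.
have zf a : u <= c - a - t -> c - a <= u + e -> (r * h * r^-1 * h)%g ∙ al a = al a.
  move=> h1 h2; rewrite !actM (axis_act ax) hrV ?(axis_act ax) ?hr; try lia.
  by congr al; lia.
pose k := - ((- (c - u - e)) / t).
have hk : c - u - e <= k * t < c - u - e + t.
  have := Z.div_mod (- (c - u - e)) t; have := Z.mod_pos_bound (- (c - u - e)) t t0.
  by rewrite /k; nia.
by exists k; split; apply: zf; nia.
Qed.

(** A power of h shifts the centre of the reflection until two distinct points of the segment are
    exchanged; [i] and [l] are ceilings that place these points in consecutive windows of length
    t. *)
Lemma reverses_swap h al t r u e : is_axis A h al t -> reverses A al r u e ->
  2 * t <= e ->
  exists j i b, (zexp h j * r)%g ∙ al (i * t) = al b /\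
    (zexp h j * r)%g ∙ al b = al (i * t) /\ b <> i * t.
Proof.
move=> ax [c hr] he; have t0 := axis_pos ax.
have hx j a : u <= a <= u + e -> (zexp h j * r)%g ∙ al a = al (c - a + j * t).
  by move=> ha; rewrite actM hr // (axis_zexp ax).
pose i := - ((- u) / t); pose l := - ((- (u + t - c)) / t).
have hi : u <= i * t < u + t.
  have := Z.div_mod (- u) t; have := Z.mod_pos_bound (- u) t t0; rewrite /i; nia.
have hl : u + t <= c + l * t < u + 2 * t.
  have := Z.div_mod (- (u + t - c)) t; have := Z.mod_pos_bound (- (u + t - c)) t t0.
  by rewrite /l; nia.
exists (l + i), i, (c + l * t).
by split; [|split]; [rewrite hx; [congr al|]|rewrite hx; [congr al|]|]; lia.
Qed.

(** Stated on an orbit with an error term, exchanging the ends of the axis needs no axis, is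
    independent of the base point and passes to products. *)
Definition coarse_reversal r h :=
  exists x C, forall k, d (r ∙ zexp h k ∙ x) (zexp h (- k) ∙ x) <= C.

Definition coarse_fixing r h :=
  exists x C, forall k, d (r ∙ zexp h k ∙ x) (zexp h k ∙ x) <= C.

Lemma coarse_reversal_at r h y : coarse_reversal r h ->
  exists C, forall k, d (r ∙ zexp h k ∙ y) (zexp h (- k) ∙ y) <= C.
Proof.
case=> x [C hC]; exists (C + 2 * d x y) => k; have := hC k.
have := dist_tri (r ∙ zexp h k ∙ y) (zexp h (- k) ∙ y) (r ∙ zexp h k ∙ x).
have := dist_tri (r ∙ zexp h k ∙ x) (zexp h (- k) ∙ y) (zexp h (- k) ∙ x).
by rewrite !act_dist (distC y x); lia.
Qed.

Lemma coarse_fixing_at r h y : coarse_fixing r h ->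
  exists C, forall k, d (r ∙ zexp h k ∙ y) (zexp h k ∙ y) <= C.
Proof.
case=> x [C hC]; exists (C + 2 * d x y) => k; have := hC k.
have := dist_tri (r ∙ zexp h k ∙ y) (zexp h k ∙ y) (r ∙ zexp h k ∙ x).
have := dist_tri (r ∙ zexp h k ∙ x) (zexp h k ∙ y) (zexp h k ∙ x).
by rewrite !act_dist (distC y x); lia.
Qed.

(** The hypothesis says that r^-1 conjugates h to h^-1 along the orbit, so r^-1 h^k x = h^(-k) r^-1
    x, and the error is the constant distance from r^-1 x to x. *)
Lemma coarse_reversal_fix h r x :
  (forall k, (r * h * r^-1 * h)%g ∙ zexp h k ∙ x = zexp h k ∙ x) -> coarse_reversal r h.
Proof.
move=> hz.
have ga k : r^-1%g ∙ zexp h k ∙ x = zexp h (- k) ∙ r^-1%g ∙ x.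
  move: k; apply: Z.bi_induction => [|k]; first by rewrite !act1.
  have e1 : r^-1%g ∙ zexp h k ∙ x = h ∙ r^-1%g ∙ zexp h (Z.succ k) ∙ x.
    by apply: (@act_inj _ _ A r); rewrite actKV -Z.add_1_r zexpS actM -[LHS]hz !actM.
  have e2 y : zexp h (- k) ∙ y = h ∙ zexp h (- Z.succ k) ∙ y.
    by rewrite -actM -zexpS; congr (zexp h _ ∙ _); lia.
  by rewrite e1 e2; split=> [/act_inj|->].
exists x, (d (r^-1%g ∙ x) x) => k.
rewrite act_distV ga Z.opp_involutive act_dist distC; exact: Z.le_refl.
Qed.

Lemma coarse_reversalM r f h : coarse_reversal r h -> coarse_reversal f h ->
  coarse_fixing (r * f)%g h.
Proof.
move=> [x [C hC]] /(coarse_reversal_at x) [D hD]; exists x, (C + D) => k.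
have := dist_tri (r ∙ f ∙ zexp h k ∙ x) (zexp h k ∙ x) (r ∙ zexp h (- k) ∙ x).
have := hC (- k); rewrite Z.opp_involutive act_dist actM; have := hD k; lia.
Qed.

Lemma coarse_reversal_fixingM r f h : coarse_reversal r h -> coarse_fixing f h ->
  coarse_reversal (r * f)%g h.
Proof.
move=> [x [C hC]] /(coarse_fixing_at x) [D hD]; exists x, (C + D) => k.
have := dist_tri (r ∙ f ∙ zexp h k ∙ x) (zexp h (- k) ∙ x) (r ∙ zexp h k ∙ x).
have := hC k; rewrite act_dist actM; have := hD k; lia.
Qed.

Lemma coarse_reversal_exp r h n : coarse_reversal r h ->
  if odd n then coarse_reversal (r ^+ n)%g h else coarse_fixing (r ^+ n)%g h.
Proof.
move=> hr; elim: n => [|n IH] /=.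
  by case: hr => x _; exists x, 0 => k; rewrite act1 dist_refl; lia.
rewrite expgS; case: (odd n) IH => /= IH; first exact: coarse_reversalM.
exact: coarse_reversal_fixingM.
Qed.

Lemma coarse_reversal_not_fixing r h al t : is_axis A h al t ->
  coarse_reversal r h -> ~ coarse_fixing r h.
Proof.
move=> ax /(coarse_reversal_at (al 0)) [C hC] /(coarse_fixing_at (al 0)) [D hD].
have t0 := axis_pos ax; have C0 := dist_ge0 (r ∙ al 0) (al 0).
have := hC 0; have := hD 0; rewrite !act1 => D1 C1.
have := hC (C + D + 1); have := hD (C + D + 1); rewrite !(axis_zexp ax).
have := dist_tri (al (0 + (C + D + 1) * t)) (al (0 + - (C + D + 1) * t)) (r ∙ al (0 + (C + D + 1) * t)).
rewrite (axis_dist ax) (distC (r ∙ _) (al (0 + (C + D + 1) * t))); nia.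
Qed.

(** A reversal moves [al (k * t)] by about [2 * k * t], while its square moves it by at most
    [2 * C]. This contradicts [axis_displacement_mono]. *)
Lemma coarse_reversal_not_power g h n al t be tg : is_axis A h al t -> is_axis A g be tg ->
  ~ coarse_reversal (g ^+ n)%g h.
Proof.
move=> ax ag /(coarse_reversal_at (al 0)) [C hC].
have t0 := axis_pos ax; have C0 := dist_ge0 ((g ^+ n)%g ∙ al 0) (al 0).
have := hC 0; rewrite !act1 => C1.
set k := 3 * C + 1; set r := (g ^+ n)%g in hC C0 C1 *.
have := @axis_displacement_mono _ _ _ _ _ _ ag n (al (k * t)); rewrite -/r.
have := hC k; have := hC (- k); rewrite !(axis_zexp ax) Z.opp_involutive !Z.add_0_l => h1 h2.
have := dist_tri (al (k * t)) (al (- k * t)) (r ∙ al (k * t)).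
have := dist_tri (al (k * t)) (r ∙ r ∙ al (k * t)) (r ∙ al (- k * t)).
rewrite act_dist (distC (al (- k * t))) (distC (al (k * t)) (r ∙ al (- k * t))) (axis_dist ax).
by rewrite /k in h1 h2 *; nia.
Qed.

(** With different valuations, some power of g is both an even power of one reversal and an odd
    power of the other; it would keep and exchange the ends of the axis. *)
Lemma coarse_reversal_val g h (n m : nat) al t : is_axis A h al t -> (0 < n)%N -> (0 < m)%N ->
  coarse_reversal (g ^+ n)%g h -> coarse_reversal (g ^+ m)%g h -> logn 2 n = logn 2 m.
Proof.
move=> ax.
wlog hlt : n m / (logn 2 n < logn 2 m)%N.
  move=> H n0 m0 hn hm; case: (ltngtP (logn 2 n) (logn 2 m)) => // hl; first exact: H.
  by apply/esym/H.
move=> n0 m0 hn hm; exfalso.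
have [//|a ca ea] := @pfactor_coprime 2 n _ n0.
have [//|b cb eb] := @pfactor_coprime 2 m _ m0.
have e : (n * (2 ^ (logn 2 m - logn 2 n) * b) = m * a)%N.
  have e2 : (2 ^ logn 2 m = 2 ^ logn 2 n * 2 ^ (logn 2 m - logn 2 n))%N.
    by rewrite -expnD subnKC // ltnW.
  move: (logn 2 n) (logn 2 m) ea eb e2 => i j -> -> ->.
  by rewrite -!mulnA mulnCA (mulnC a) !mulnA (mulnC b) -!mulnA (mulnCA b) (mulnC b).
have := coarse_reversal_exp (2 ^ (logn 2 m - logn 2 n) * b) hn.
have := coarse_reversal_exp a hm.
rewrite -!expgnA e oddM oddX subn_eq0 leqNgt hlt /=.
by rewrite -coprime2n ca; apply: coarse_reversal_not_fixing ax.
Qed.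

(** Helly property of subtrees. [C] is the convex intersection of the fixed sets treated so far; a
    median provides the point that keeps the next fixed set compatible with it. *)
Lemma common_fixed_point (s : seq G) (C : P -> Prop) :
  (forall x m y, C x -> C y -> between x m y -> C m) -> (exists x, C x) ->
  (forall g, g \in s -> exists x, C x /\ g ∙ x = x) ->
  (forall g h, g \in s -> h \in s -> exists x, g ∙ x = x /\ h ∙ x = x) ->
  exists x, C x /\ forall g, g \in s -> g ∙ x = x.
Proof.
elim: s C => [|g s IH] C conv [x0 hx0] hC hs; first by exists x0.
have [||||x [[x1 x2] x3]] := IH (fun x => C x /\ g ∙ x = x).
- move=> x m y [cx gx] [cy gy] b; split; first exact: conv b.
  exact: fix_between gx gy b.
- by have [x hx] := hC g (mem_head _ _); exists x.
- move=> h hh.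
  have hh' : h \in g :: s by rewrite inE hh orbT.
  have [a [a1 a2]] := hC g (mem_head _ _).
  have [b [b1 b2]] := hC h hh'.
  have [c [c1 c2]] := hs g h (mem_head _ _) hh'.
  have [m [m1 [m2 m3]]] := median a b c; exists m.
  split; last by apply: fix_between m2.
  by split; [apply: conv m1|apply: fix_between m3].
- by move=> a b ha hb; apply: hs; rewrite inE ?ha ?hb orbT.
by exists x; split=> // h; rewrite inE => /predU1P[->|/x3].
Qed.

(** Serre's lemma: [elliptic_prod] makes the fixed sets meet in pairs, and Helly does the rest. *)
Lemma elliptic_generators (s : seq G) (x0 : P) :
  (forall g, g \in s -> elliptic A g) ->
  (forall g h, g \in s -> h \in s -> elliptic A (g * h)%g) ->
  exists x, forall g, g \in s -> g ∙ x = x.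
Proof.
move=> h1 h2.
have [||||x [_ hx]] := @common_fixed_point s (fun=> True).
- by [].
- by exists x0.
- by move=> g /h1 [x hx]; exists x.
- move=> g h hg hh; have [q hq] := h2 g h hg hh.
  have [x hx] := h1 g hg; have [y hy] := h1 h hh.
  by have [m [m1 m2]] := elliptic_prod hy hx hq; exists m.
by exists x.
Qed.

End CoarseReversal.

(** * The group of a graph product and its retractions *)

Section GrpTheory.
Variable G : grp.
Implicit Types x y z : G.

Lemma gmul_idem x : gmul x x = x -> x = gone G.
Proof. by move=> h; rewrite -{1}(gmul1 x) -(gmulV x) -gmulA h gmulV. Qed.

Lemma gmulrV x : gmul x (ginv x) = gone G.
Proof.
by apply: gmul_idem; rewrite gmulA -(gmulA x) gmulV -gmulA gmul1.
Qed.

Lemma gmulr1 x : gmul x (gone G) = x.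
Proof. by rewrite -(gmulV x) gmulA gmulrV gmul1. Qed.

Lemma gmul_eqr x y : gmul (ginv x) y = gone G -> x = y.
Proof. by move=> h; rewrite -(gmulr1 x) -h gmulA gmulrV gmul1. Qed.

End GrpTheory.

Section WordClasses.
Variables (V : finType) (e : rel V) (G : V -> grp).
Local Notation word := (word G).
Local Notation weq := (@weq V e G).
Local Notation lt v a := (existT (fun v => G v) v a : letter G).
Implicit Types (w : word) (L M : {set V}).

Lemma weq_catl p w w' : weq w w' -> weq (p ++ w) (p ++ w').
Proof.
elim=> [p' q s t h|w0|w1 w2 _ h|w1 w2 w3 _ h1 _ h2].
- by rewrite !(catA p); apply: weq_step.
- exact: weq_refl.
- exact: weq_sym.
- exact: weq_trans h1 h2.
Qed.

Lemma weq_catr q w w' : weq w w' -> weq (w ++ q) (w' ++ q).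
Proof.
elim=> [p' q' s t h|w0|w1 w2 _ h|w1 w2 w3 _ h1 _ h2].
- by rewrite -!catA; apply: weq_step.
- exact: weq_refl.
- exact: weq_sym.
- exact: weq_trans h1 h2.
Qed.

Lemma weq_cat w1 w2 w1' w2' : weq w1 w1' -> weq w2 w2' -> weq (w1 ++ w2) (w1' ++ w2').
Proof. by move=> h1 h2; apply: (weq_trans (weq_catr _ h1)); apply: weq_catl. Qed.

Lemma step_weq s t : step e s t -> weq s t.
Proof. by move=> h; have := weq_step [::] [::] h; rewrite /= !cats0. Qed.

Lemma winv_cons x w : winv (x :: w) = winv w ++ winv [:: x].
Proof. by rewrite /winv /= rev_cons -cats1. Qed.

Lemma weq_VK w : weq (winv w ++ w) [::].
Proof.
elim: w => [|[v a] w IH]; first exact: weq_refl.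
rewrite winv_cons.
have -> : (winv w ++ winv [:: lt v a]) ++ lt v a :: w =
  winv w ++ (winv [:: lt v a] ++ [:: lt v a]) ++ w by rewrite -!catA.
apply: weq_trans IH; apply: weq_catl.
have : weq ([:: lt v (ginv a)] ++ [:: lt v a]) [::].
  apply: (@weq_trans _ _ _ _ [:: lt v (gone (G v))]).
    by rewrite -(gmulV a); apply/step_weq/st_mul.
  exact/step_weq/st_one.
by move=> /(weq_catr w).
Qed.

Lemma weq_KV w : weq (w ++ winv w) [::].
Proof.
elim: w => [|[v a] w IH]; first exact: weq_refl.
rewrite winv_cons.
have -> : (lt v a :: w) ++ winv w ++ winv [:: lt v a] =
  [:: lt v a] ++ (w ++ winv w) ++ winv [:: lt v a] by rewrite -!catA.
have h : weq ([:: lt v a] ++ [:: lt v (ginv a)]) [::].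
  apply: (@weq_trans _ _ _ _ [:: lt v (gone (G v))]).
    by rewrite -(gmulrV a); apply/step_weq/st_mul.
  exact/step_weq/st_one.
by apply: weq_trans h; apply: weq_catl; apply: (weq_catr _ IH).
Qed.

(** An element is a class of words as a predicate, so that [weq] becomes equality by extensionality
    and the group structure can be declared. *)
Record gprod := GProd { cls : word -> Prop; clsP : exists w, cls = weq w }.

Lemma gprod_eq (q r : gprod) : cls q = cls r -> q = r.
Proof. by case: q r => c p [c' p'] /= h; subst c'; congr GProd; apply: Prop_irrelevance. Qed.

Definition pi w : gprod := GProd (ex_intro _ w erefl).
Definition repr (q : gprod) : word := projT1 (cid (clsP q)).

Lemma reprK q : pi (repr q) = q.
Proof. by apply: gprod_eq; rewrite /= -(projT2 (cid (clsP q))). Qed.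

Lemma piP w w' : pi w = pi w' <-> weq w w'.
Proof.
split=> [[h]|h]; first by rewrite h; apply: weq_refl.
apply: gprod_eq => /=; apply: funext => u; apply: propext; split=> hu.
  by apply: weq_trans hu; apply: weq_sym.
exact: weq_trans hu.
Qed.

Definition gp_mul q r := pi (repr q ++ repr r).
Definition gp_inv q := pi (winv (repr q)).

Lemma pi_mul w w' : gp_mul (pi w) (pi w') = pi (w ++ w').
Proof. by apply/piP; apply: weq_cat; apply/piP; rewrite reprK. Qed.

Lemma gp_mulA : associative gp_mul.
Proof. by move=> x y z; rewrite -(reprK x) -(reprK y) -(reprK z) !pi_mul catA. Qed.

Lemma gp_mul1 : left_id (pi [::]) gp_mul.
Proof. by move=> x; rewrite -(reprK x) pi_mul. Qed.

Lemma gp_mulr1 : right_id (pi [::]) gp_mul.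
Proof. by move=> x; rewrite -(reprK x) pi_mul cats0. Qed.

Lemma gp_mulV : left_inverse (pi [::]) gp_inv gp_mul.
Proof. by move=> x; rewrite -{2}(reprK x) pi_mul; apply/piP/weq_VK. Qed.

Lemma gp_mulrV : right_inverse (pi [::]) gp_inv gp_mul.
Proof. by move=> x; rewrite -{1}(reprK x) pi_mul; apply/piP/weq_KV. Qed.

HB.instance Definition _ := gen_eqMixin gprod.
HB.instance Definition _ := gen_choiceMixin gprod.
HB.instance Definition _ := isGroup.Build gprod gp_mulA gp_mul1 gp_mulr1 gp_mulV gp_mulrV.

End WordClasses.

Section GraphProductGroup.
Local Open Scope group_scope.
Variables (V : finType) (e : rel V) (G : V -> grp).
Hypothesis e_sym : symmetric e.
Local Notation word := (word G).
Local Notation weq := (@weq V e G).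
Local Notation lt v a := (existT (fun v => G v) v a : letter G).
Local Notation Q := (gprod e G).
Local Notation pi := (@pi V e G).
Implicit Types (w : word) (L M : {set V}) (q r x y z : Q).

Lemma piM w w' : pi (w ++ w') = pi w * pi w'.
Proof. by rewrite -pi_mul. Qed.

Lemma pi_nil : pi [::] = 1. Proof. by []. Qed.

Lemma pi_cons a w : pi (a :: w) = pi [:: a] * pi w.
Proof. by rewrite -cat1s piM. Qed.

Lemma piV w : pi (winv w) = (pi w)^-1.
Proof. by apply/(mulgI (pi w)); rewrite mulgV -piM; apply/piP/weq_KV. Qed.

Lemma pi_pow w n : pi (wpow w n) = pi w ^+ n.
Proof. by elim: n => [|n IH] //=; rewrite /wpow /= piM expgS -IH. Qed.

Lemma pi_one v : pi [:: lt v (gone (G v))] = 1.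
Proof. by apply/piP/step_weq/st_one. Qed.

Lemma pi_letterM v (a b : G v) : pi [:: lt v (gmul a b)] = pi [:: lt v a] * pi [:: lt v b].
Proof. by rewrite -piM; apply/esym/piP/step_weq/st_mul. Qed.

Definition par L q := exists w, supported L w /\ pi w = q.

Lemma supported_cat L w w' : supported L (w ++ w') = supported L w && supported L w'.
Proof. exact: all_cat. Qed.

Lemma supported_winv L w : supported L (winv w) = supported L w.
Proof. by rewrite /supported /winv all_rev all_map. Qed.

Lemma supportedS L M w : L \subset M -> supported L w -> supported M w.
Proof. by move=> /subsetP h; apply: sub_all => x; apply: h. Qed.

Lemma par1 L : par L 1. Proof. by exists [::]. Qed.

Lemma parM L q r : par L q -> par L r -> par L (q * r).
Proof.
move=> [w [hw <-]] [w' [hw' <-]]; exists (w ++ w').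
by rewrite supported_cat hw hw' piM.
Qed.

Lemma parV L q : par L q -> par L q^-1.
Proof. by move=> [w [hw <-]]; exists (winv w); rewrite supported_winv hw piV. Qed.

Lemma parX L q n : par L q -> par L (q ^+ n).
Proof. by move=> hq; elim: n => [|n IH]; [exact: par1|rewrite expgS; apply: parM]. Qed.

Lemma parS L M q : L \subset M -> par L q -> par M q.
Proof. by move=> h [w [hw <-]]; exists w; rewrite (supportedS h hw). Qed.

Lemma par_letter L v (a : G v) : v \in L -> par L (pi [:: lt v a]).
Proof. by move=> h; exists [:: lt v a]; rewrite /supported /= h. Qed.

Lemma parT q : par setT q.
Proof.
exists (repr q); rewrite reprK /supported; split=> //.
by elim: (repr q) => //= x w ->; rewrite inE.
Qed.

Lemma par0 q : par set0 q -> q = 1.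
Proof. by case=> -[|x w] [] /= => [_ <-//|]; rewrite inE. Qed.

Definition restr L w : word := filter (fun x : letter G => projT1 x \in L) w.

(** Deleting the letters outside L leaves each relation either intact or trivial; this is why the
    retraction [rho] exists. *)
Lemma restr_weq L w w' : weq w w' -> weq (restr L w) (restr L w').
Proof.
elim=> [p q s t h|w0|w1 w2 _ h|w1 w2 w3 _ h1 _ h2].
- rewrite /restr !filter_cat; case: h => [v|v a b|u v a b huv] /=.
  + by case: ifP => _; [exact: (weq_step _ _ (st_one e G v))|apply: weq_refl].
  + by case: ifP => h1; rewrite h1; [exact: (weq_step _ _ (st_mul e a b))|apply: weq_refl].
  + case: ifP => h1; case: ifP => h2; rewrite ?h1 ?h2; try exact: weq_refl.
    exact: (weq_step _ _ (st_comm a b huv)).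
- exact: weq_refl.
- exact: weq_sym.
- exact: weq_trans h1 h2.
Qed.

Definition rho L q : Q := pi (restr L (repr q)).

Lemma rho_pi L w : rho L (pi w) = pi (restr L w).
Proof. by apply/piP/restr_weq/piP; rewrite reprK. Qed.

Lemma rhoM L q r : rho L (q * r) = rho L q * rho L r.
Proof. by rewrite -(reprK q) -(reprK r) -piM !rho_pi /restr filter_cat piM. Qed.

Lemma rho1 L : rho L 1 = 1. Proof. by rewrite -pi_nil rho_pi. Qed.

Lemma rhoV L q : rho L q^-1 = (rho L q)^-1.
Proof. by apply: (mulgI (rho L q)); rewrite -rhoM !mulgV rho1. Qed.

Lemma supported_restr L M w : supported L w -> supported (L :&: M) (restr M w).
Proof.
rewrite /supported /restr all_filter; apply: sub_all => x hx.
by apply/implyP => hm; rewrite inE hx.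
Qed.

Lemma rho_par L M q : par L q -> par (L :&: M) (rho M q).
Proof. by move=> [w [hw <-]]; rewrite rho_pi; exists (restr M w); split=> //; apply: supported_restr. Qed.

Lemma rho_id L q : par L q -> rho L q = q.
Proof.
move=> [w [hw <-]]; rewrite rho_pi; congr pi.
by apply/all_filterP.
Qed.

Lemma parI L M q : par L q -> par M q -> par (L :&: M) q.
Proof. by move=> h1 /rho_id <-; apply: rho_par. Qed.

Lemma rho_kill L M q : par L q -> [disjoint L & M] -> rho M q = 1.
Proof. by move=> hq; rewrite -setI_eq0 => /eqP h; apply: par0; rewrite -h; apply: rho_par. Qed.

Lemma par_comm L M q r : par L q -> par M r -> (forall u v, u \in L -> v \in M -> e u v) ->
  q * r = r * q.
Proof.
move=> [w [hw <-]] [w' [hw' <-]] he.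
elim: w hw => [|[u a] w IH] /=; first by rewrite mulg1 mul1g.
case/andP=> hu hw; rewrite (pi_cons _ w) -mulgA IH // !mulgA; congr (_ * _).
elim: w' hw' {IH} => [|[v b] w' IH] /=; first by rewrite mulg1 mul1g.
case/andP=> hv hw'; rewrite (pi_cons _ w') mulgA -[RHS]mulgA -IH // !mulgA; congr (_ * _).
by rewrite -!piM; apply/piP/step_weq/st_comm/he.
Qed.

Definition letter_at v (x : letter G) : G v :=
  if projT1 x =P v is ReflectT h then ecast u (G u) h (projT2 x) else gone (G v).

Lemma letter_at_same v (a : G v) : letter_at v (lt v a) = a.
Proof. by rewrite /letter_at; case: eqP => //= h; rewrite eq_axiomK. Qed.

(** The retraction to one vertex group, valued in [G v] itself; its invariance shows that vertex
    groups embed in the quotient. *)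
Definition eval_at v w : G v := foldr (fun (l : letter G) b => gmul (letter_at v l) b) (gone (G v)) w.

Lemma eval_at_cat v w w' : eval_at v (w ++ w') = gmul (eval_at v w) (eval_at v w').
Proof. by elim: w => [|x w IH] /=; rewrite ?gmul1 // IH gmulA. Qed.

Hypothesis e_irr : irreflexive e.

Lemma eval_at_weq v w w' : weq w w' -> eval_at v w = eval_at v w'.
Proof.
elim=> [p q s t h|//|w1 w2 _ -> //|w1 w2 w3 _ -> _ -> //].
rewrite !eval_at_cat; congr gmul; congr gmul.
case: h => [u|u a b|u u' a b huv] /=; rewrite /letter_at /=.
- by case: eqP => [h|_]; [case: _ / h|]; rewrite gmul1.
- by case: eqP => [h|_]; [case: _ / h|]; rewrite /= ?gmulr1 ?gmul1.
- case: eqP => [h|_]; case: eqP => [h'|_]; rewrite ?gmul1 ?gmulr1 //.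
  by exfalso; move: huv; rewrite h h' e_irr.
Qed.

Lemma pi_letter_inj v (a b : G v) : pi [:: lt v a] = pi [:: lt v b] -> a = b.
Proof.
move/piP/(eval_at_weq v); rewrite /eval_at /= !letter_at_same !gmulr1.
by [].
Qed.

Lemma par_letter_notin v (a : G v) : par (~: [set v]) (pi [:: lt v a]) -> a = gone (G v).
Proof.
move=> h; apply: pi_letter_inj; rewrite pi_one.
rewrite -(@rho_id [set v] (pi [:: lt v a])); last by apply: par_letter; rewrite inE.
by apply: (rho_kill h); rewrite -setI_eq0 setIC setICr.
Qed.

End GraphProductGroup.

(** * Bass-Serre trees *)

Section ListTree.
Variable Y : eqType.
Implicit Types (a b x y : Y) (s t u : seq Y).

Fixpoint lcp s t : nat :=
  if s is x :: s' then if t is y :: t' then if x == y then (lcp s' t').+1 else 0 else 0 else 0.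

Lemma lcpC s t : lcp s t = lcp t s.
Proof. by elim: s t => [|x s IH] [|y t] //=; rewrite eq_sym IH. Qed.

Lemma lcp_size s t : lcp s t <= size s.
Proof. by elim: s t => [|x s IH] [|y t] //=; case: eqP => // _; apply: IH. Qed.

Lemma lcp_ultra s t u : minn (lcp s t) (lcp t u) <= lcp s u.
Proof.
elim: s t u => [|x s IH] [|y t] [|z u] //=; rewrite ?minn0 ?min0n //.
have [->|] := eqVneq x y; last by rewrite min0n.
have [_|] := eqVneq y z; last by rewrite minn0.
by rewrite minnSS ltnS.
Qed.

Lemma lcp_refl s : lcp s s = size s.
Proof. by elim: s => //= x s ->; rewrite eqxx. Qed.

Lemma lcp_full s t : lcp s t = size s -> lcp s t = size t -> s = t.
Proof.
elim: s t => [|x s IH] [|y t] //=; have [->|//] := eqVneq x y.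
by move=> [h1] [h2]; rewrite (IH t).
Qed.

Lemma lcp_take n s t : lcp (take n s) t = minn n (lcp s t).
Proof.
elim: s n t => [|x s IH] [|n] [|y t] //=; rewrite ?minn0 ?min0n //.
by have [_|] := eqVneq x y; rewrite ?IH ?minnSS ?minn0.
Qed.

Lemma lcp_map (f : Y -> Y) s t : injective f -> lcp (map f s) (map f t) = lcp s t.
Proof. by move=> fI; elim: s t => [|x s IH] [|y t] //=; rewrite (inj_eq fI) IH. Qed.

Fixpoint reduced s : bool :=
  if s is x :: s' then (if s' is _ :: z :: _ then x != z else true) && reduced s' else true.

Lemma reduced_map (f : Y -> Y) s : injective f -> reduced (map f s) = reduced s.
Proof.
move=> fI; elim: s => //= x s ->; congr (_ && _).
by case: s => // y [|z s] //=; rewrite (inj_eq fI).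
Qed.

Lemma reduced_take n s : reduced s -> reduced (take n s).
Proof.
elim: s n => [|x s IH] [|n] //= /andP[h1 h2]; rewrite IH // andbT.
by case: s n h1 {IH h2} => [|y [|z s]] [|[|n]].
Qed.

(** [lcp] is the Gromov product at the empty path, and its ultrametric inequality [lcp_ultra] is
    what yields the four-point condition. *)
Definition path_dist s t : Z := (Z.of_nat (size s + size t) - 2 * Z.of_nat (lcp s t))%Z.

Lemma path_dist_cons x s t : path_dist (x :: s) (x :: t) = path_dist s t.
Proof.
rewrite /path_dist; have -> : lcp (x :: s) (x :: t) = (lcp s t).+1 by rewrite /= eqxx.
have -> : size (x :: s) = (size s).+1 by []; have -> : size (x :: t) = (size t).+1 by [].
by lia.
Qed.

Lemma path_dist_take n s t : lcp s t <= n <= size s ->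
  path_dist s (take n s) = (Z.of_nat (size s) - Z.of_nat n)%Z /\
  path_dist (take n s) t = (path_dist s t - (Z.of_nat (size s) - Z.of_nat n))%Z.
Proof.
case/andP=> h1 h2; rewrite /path_dist (lcpC s (take n s)) !lcp_take lcp_refl size_take_min.
by rewrite (minn_idPl h2) (minn_idPr h1); lia.
Qed.

Variable a0 : Y.
Definition rpath := {s : seq Y | reduced (a0 :: s)}.
Implicit Types p q r : rpath.
Definition rdist p q := path_dist (val p) (val q).

Lemma rdist_ge0 p q : (0 <= rdist p q)%Z.
Proof.
have := lcp_size (val p) (val q); have := lcp_size (val q) (val p).
by rewrite lcpC /rdist /path_dist; lia.
Qed.

Lemma rdist_eq0 p q : rdist p q = 0%Z <-> p = q.
Proof.
have h1 := lcp_size (val p) (val q); have := lcp_size (val q) (val p); rewrite lcpC => h2.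
rewrite /rdist /path_dist; split=> [h|->]; last by rewrite lcp_refl; lia.
by apply: val_inj; apply: lcp_full; lia.
Qed.

Lemma rdistC p q : rdist p q = rdist q p.
Proof. by rewrite /rdist /path_dist lcpC addnC. Qed.

Lemma rdist4 p q r o : (rdist p q + rdist r o <= rdist p r + rdist q o)%Z \/
  (rdist p q + rdist r o <= rdist p o + rdist q r)%Z.
Proof.
have U p1 p2 p3 := lcp_ultra (val p1) (val p2) (val p3).
have := (U p q r, U p r q, U q p r).
have := (U p q o, U p o q, U q p o).
have := (U p r o, U p o r, U r p o).
have := (U q r o, U q o r, U r q o).
have C p1 p2 := lcpC (val p1) (val p2).
have := (C q p, C r p, C r q); have := (C o p, C o q, C o r).
case=> [[c1 c2] c3] [[c4 c5] c6].
case=> [[a1 a2] a3] [[a4 a5] a6] [[a7 a8] a9] [[b1 b2] b3].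
by rewrite /rdist /path_dist; lia.
Qed.

Lemma rdist_even p q r : Z.Even (rdist p q + rdist q r + rdist p r).
Proof.
exists (Z.of_nat (size (val p) + size (val q) + size (val r)) - Z.of_nat (lcp (val p) (val q)) -
  Z.of_nat (lcp (val q) (val r)) - Z.of_nat (lcp (val p) (val r)))%Z.
by rewrite /rdist /path_dist; lia.
Qed.

Lemma rdist_geo p q k : (0 <= k <= rdist p q)%Z ->
  exists r, rdist p r = k /\ rdist r q = (rdist p q - k)%Z.
Proof.
have tk n (p1 : rpath) : reduced (a0 :: take n (val p1)).
  by have := reduced_take n.+1 (valP p1).
move: p q k; have H p q k : (0 <= k <= Z.of_nat (size (val p)) - Z.of_nat (lcp (val p) (val q)))%Z ->
  exists r, rdist p r = k /\ rdist r q = (rdist p q - k)%Z.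
  move=> hk; pose n := size (val p) - Z.to_nat k.
  exists (exist (fun s => reduced (a0 :: s)) _ (tk n p)).
  have [|h1 h2] := @path_dist_take n (val p) (val q); first by rewrite /n; lia.
  by rewrite /rdist h1 h2 /n; lia.
move=> p q k hk.
have [h|h] := Z_le_gt_dec k (Z.of_nat (size (val p)) - Z.of_nat (lcp (val p) (val q))).
  by apply: H; lia.
have [|r [r1 r2]] := H q p (rdist p q - k)%Z.
  by rewrite lcpC; move: hk h; rewrite /rdist /path_dist; lia.
exists r; have := (rdistC p r, rdistC r q, rdistC q p); case=> [[]]; lia.
Qed.

Definition path_tree := Tree rdist_ge0 rdist_eq0 rdistC rdist4 rdist_even rdist_geo.

End ListTree.

Section Reroot.
Variable Y : eqType.
Implicit Types (a b x y : Y) (s t u : seq Y).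

(* The reduced path from b with the same endpoint as the reduced path s from a. *)
Definition reroot a b s := if s is x :: s' then if x == b then s' else a :: s else [:: a].

Lemma rerootK a b s : reduced (a :: s) -> reroot b a (reroot a b s) = s.
Proof.
case: s => [|x s] /=; first by rewrite eqxx.
have [->|_] := eqVneq x b; last by rewrite /= eqxx.
by case: s => [|y s] //=; rewrite eq_sym => /andP[/negbTE ->].
Qed.

Lemma reroot_reduced a b s : reduced (a :: s) -> reduced (b :: reroot a b s).
Proof.
case: s => [|x s] //=; have [->|h] := eqVneq x b; first by case/andP.
by move=> h2 /=; rewrite eq_sym h.
Qed.

Lemma reroot_map (f : Y -> Y) a b s : injective f ->
  reroot (f a) (f b) (map f s) = map f (reroot a b s).
Proof. by move=> fI; case: s => //= x s; rewrite (inj_eq fI); case: eqP. Qed.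

Lemma last_reroot a b s : last b (reroot a b s) = last a s.
Proof. by case: s => //= x s; case: eqP => //= ->. Qed.

Lemma reroot_dist a b s t : reduced (a :: s) -> reduced (a :: t) ->
  path_dist (reroot a b s) (reroot a b t) = path_dist s t.
Proof.
have H s1 t1 : reduced [:: a, b & s1] -> (if t1 is y :: _ then y != b else true) ->
    path_dist s1 (a :: t1) = path_dist (b :: s1) t1.
  move=> h1 h2; rewrite /path_dist.
  have -> : lcp s1 (a :: t1) = 0.
    by case: s1 h1 => //= x s1 /andP[]; rewrite eq_sym => /negbTE ->.
  have -> : lcp (b :: s1) t1 = 0.
    by case: t1 h2 => //= y t1; rewrite eq_sym => /negbTE ->.
  by rewrite /=; lia.
have C u1 u2 : path_dist u1 u2 = path_dist u2 u1 by rewrite /path_dist lcpC addnC.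
case: s => [|x s]; case: t => [|y t] hs ht; rewrite /reroot ?path_dist_cons //.
- have [ey|ny] := eqVneq y b; last by rewrite path_dist_cons.
  by rewrite C H -?ey // C.
- have [ex|nx] := eqVneq x b; last by rewrite path_dist_cons.
  by rewrite H -?ex.
- have [ex|nx] := eqVneq x b; have [ey|ny] := eqVneq y b.
  + by rewrite ex ey path_dist_cons.
  + by rewrite H ?ex // -ex.
  + by rewrite C H ?ey // -?ey // C.
  + by rewrite path_dist_cons.
Qed.

End Reroot.

Section BassSerre.
Local Open Scope group_scope.
Variables (V : finType) (e : rel V) (G : V -> grp).
Hypotheses (e_sym : symmetric e) (e_irr : irreflexive e).
Local Notation word := (word G).
Local Notation weq := (@weq V e G).
Local Notation lt v a := (existT (fun v => G v) v a : letter G).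
Local Notation Q := (gprod e G).
Local Notation pi := (@pi V e G).
Implicit Types (w : word) (L M : {set V}) (q r y z : Q).

Definition star (v : V) : {set V} := [set u | (u == v) || e v u].
Definition link (v : V) : {set V} := [set u | e v u].

Definition translate q (S : Q -> Prop) : Q -> Prop := fun x => S (q^-1 * x).

Lemma translate1 S : translate 1 S = S.
Proof. by apply: funext => x; rewrite /translate invg1 mul1g. Qed.

Lemma translateM q r S : translate (q * r) S = translate q (translate r S).
Proof. by apply: funext => x; rewrite /translate invgM mulgA. Qed.

Lemma translate_inj q : injective (translate q).
Proof. by move=> S T h; rewrite -(translate1 S) -(mulVg q) translateM h -translateM mulVg translate1. Qed.

Lemma translate_par L q : translate q (par L) = par L <-> par L q.
Proof.
split=> [h|h].
  have : translate q (par L) 1 by rewrite h; apply: par1.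
  by rewrite /translate mulg1 => /parV; rewrite invgK.
apply: funext => x; apply: propext; rewrite /translate; split=> hx.
  by rewrite -(mulKg q^-1 x) invgK; apply: parM.
by apply: parM => //; apply: parV.
Qed.

Variable v : V.
Local Notation A0 := (par (~: [set v]) : Q -> Prop).
Local Notation B0 := (par (star v) : Q -> Prop).

(* A vertex of the tree T_v is stored as the reduced path to it from the coset
   G_(V \ v), as the list of cosets met after that one; act_star conjugates the
   translation by an element of G_(star v) to paths based at the coset G_(star v). *)
Definition act_star q (s : seq (Q -> Prop)) :=
  reroot B0 A0 (map (translate q) (reroot A0 B0 s)).

Definition act_letter (x : letter G) (s : seq (Q -> Prop)) :=
  if projT1 x == v then act_star (pi [:: x]) s else map (translate (pi [:: x])) s.

Definition act_word w s := foldr act_letter s w.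

Lemma act_star_reduced q s : par (star v) q ->
  reduced (A0 :: s) -> reduced (A0 :: act_star q s).
Proof.
move=> /translate_par hq hs; apply: reroot_reduced.
rewrite -{1}hq -map_cons reduced_map; first exact: reroot_reduced.
exact: translate_inj.
Qed.

Lemma map_translate_reduced q s : par (~: [set v]) q ->
  reduced (A0 :: s) -> reduced (A0 :: map (translate q) s).
Proof.
move=> /translate_par hq hs; rewrite -{1}hq -map_cons reduced_map //.
exact: translate_inj.
Qed.

Lemma par_star_letter (x : letter G) : projT1 x == v -> par (star v) (pi [:: x]).
Proof. by case: x => u a /= h; apply: par_letter; rewrite inE h. Qed.

Lemma par_rest_letter (x : letter G) : (projT1 x == v) = false -> par (~: [set v]) (pi [:: x]).
Proof. by case: x => u a /= h; apply: par_letter; rewrite !inE h. Qed.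

Lemma act_letter_reduced x s : reduced (A0 :: s) -> reduced (A0 :: act_letter x s).
Proof.
rewrite /act_letter; case: ifP => h; first exact/act_star_reduced/par_star_letter.
exact/map_translate_reduced/par_rest_letter.
Qed.

Lemma act_word_reduced w s : reduced (A0 :: s) -> reduced (A0 :: act_word w s).
Proof. by move=> h; elim: w => //= x w; apply: act_letter_reduced. Qed.

Lemma act_star_dist q s t : par (star v) q -> reduced (A0 :: s) -> reduced (A0 :: t) ->
  path_dist (act_star q s) (act_star q t) = path_dist s t.
Proof.
move=> /translate_par hq hs ht.
have h u : reduced (A0 :: u) -> reduced (B0 :: map (translate q) (reroot A0 B0 u)).
  move=> hu; rewrite -{1}hq -map_cons reduced_map; first exact: reroot_reduced.
  exact: translate_inj.
rewrite /act_star reroot_dist; try exact: h.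
rewrite /path_dist !size_map lcp_map; last exact: translate_inj.
exact: reroot_dist.
Qed.

Lemma act_letter_dist x s t : reduced (A0 :: s) -> reduced (A0 :: t) ->
  path_dist (act_letter x s) (act_letter x t) = path_dist s t.
Proof.
move=> hs ht; rewrite /act_letter; case: ifP => h.
  by apply: act_star_dist => //; apply: par_star_letter.
by rewrite /path_dist !size_map lcp_map //; apply: translate_inj.
Qed.

Lemma act_word_dist w s t : reduced (A0 :: s) -> reduced (A0 :: t) ->
  path_dist (act_word w s) (act_word w t) = path_dist s t.
Proof.
move=> hs ht; elim: w => //= x w <-.
by apply: act_letter_dist; apply: act_word_reduced.
Qed.

Lemma act_starM q r s : par (star v) q -> par (star v) r -> reduced (A0 :: s) ->
  act_star (q * r) s = act_star q (act_star r s).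
Proof.
move=> hq /translate_par hr hs; rewrite /act_star rerootK; last first.
  rewrite -{1}hr -map_cons reduced_map; first exact: reroot_reduced.
  exact: translate_inj.
by rewrite -map_comp; congr reroot; apply: eq_map => S; rewrite /= translateM.
Qed.

Lemma act_star1 s : reduced (A0 :: s) -> act_star 1 s = s.
Proof.
move=> hs; rewrite /act_star (eq_map translate1) map_id; exact: rerootK.
Qed.

(** The two recipes for the action agree on the edge group of the amalgam. *)
Lemma act_star_map q s : par (~: [set v]) q -> par (star v) q -> reduced (A0 :: s) ->
  act_star q s = map (translate q) s.
Proof.
move=> /translate_par ha /translate_par hb hs; rewrite /act_star.
rewrite -reroot_map; last exact: translate_inj.
rewrite ha hb rerootK // -{1}ha -map_cons reduced_map //; exact: translate_inj.
Qed.

Lemma act_word_cat w w' s : act_word (w ++ w') s = act_word w (act_word w' s).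
Proof. by rewrite /act_word foldr_cat. Qed.

Lemma map_translateM q r s :
  map (translate q) (map (translate r) s) = map (translate (q * r)) s.
Proof. by rewrite -map_comp; apply: eq_map => S; rewrite /= translateM. Qed.

(** The only mixed relation commutes a letter at v with a letter of the link. The latter lies in
    both factors, so by [act_star_map] both letters act through [act_star], which is
    multiplicative. *)
Lemma act_word_step t t' s : step e t t' -> reduced (A0 :: s) ->
  act_word t s = act_word t' s.
Proof.
move=> ht hs; case: ht => [u|u a b|u u' a b huv]; rewrite /act_word /= /act_letter /=.
- rewrite pi_one; case: ifP => _; first exact: act_star1.
  by rewrite (eq_map translate1) map_id.
- rewrite pi_letterM; case: ifP => h; rewrite ?h; last by rewrite map_translateM.
  by rewrite act_starM //; apply: par_star_letter.
- have hc : pi [:: lt u a] * pi [:: lt u' b] = pi [:: lt u' b] * pi [:: lt u a].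
    by rewrite -!piM; apply/piP/step_weq/st_comm.
  have key (k c : V) (a' : G k) (c' : G c) : k = v -> e k c -> 
      pi [:: lt k a'] * pi [:: lt c c'] = pi [:: lt c c'] * pi [:: lt k a'] ->
      act_star (pi [:: lt k a']) (map (translate (pi [:: lt c c'])) s) =
      map (translate (pi [:: lt c c'])) (act_star (pi [:: lt k a']) s).
    move=> hw hwc hcomm.
    have cv : (c == v) = false by apply/eqP => h; rewrite hw h e_irr in hwc.
    have c1 : par (star v) (pi [:: lt c c']) by apply: par_letter; rewrite inE -hw hwc orbT.
    have c2 : par (~: [set v]) (pi [:: lt c c']) by apply: par_rest_letter.
    have w1 : par (star v) (pi [:: lt k a']) by apply: par_star_letter; rewrite /= hw.
    rewrite -!act_star_map //; last exact: act_star_reduced.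
    by rewrite -!act_starM // hcomm.
  case: (u =P v) => hu; case: (u' =P v) => hu'.
  + by exfalso; move: huv; rewrite hu hu' e_irr.
  + exact: key.
  + by apply/esym/(key _ _ b a hu') => //; rewrite ?hc // e_sym.
  + by rewrite !map_translateM hc.
Qed.

Lemma act_word_weq w w' s : weq w w' -> reduced (A0 :: s) -> act_word w s = act_word w' s.
Proof.
move=> h; elim: h s => [p p' t t' ht|//|w1 w2 _ IH|w1 w2 w3 _ IH1 _ IH2] s hs.
- rewrite !act_word_cat (act_word_step ht) //; exact: act_word_reduced.
- by rewrite IH.
- by rewrite IH1 // IH2.
Qed.

(** A vertex is any list of subsets without backtracking, whether they are cosets or not. The
    Bass-Serre tree is the subtree spanned by the translates of [root] and [hub]; of these points
    the sequel uses only their stabilizers and their distance 1. *)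
Definition bs_tree := path_tree A0.

Lemma bs_tree_eq (p p' : rpath A0) : val p = val p' -> p = p' :> bs_tree.
Proof. exact: val_inj. Qed.

Definition bs_act q (p : bs_tree) : bs_tree :=
  exist (fun s => reduced (A0 :: s)) (act_word (repr q) (val p))
    (act_word_reduced (repr q) (valP p)).

Lemma bs_act_pi w p : val (bs_act (pi w) p) = act_word w (val p).
Proof.
have h : weq (repr (pi w)) w by apply/piP; rewrite reprK.
exact: (act_word_weq h (valP p)).
Qed.

Lemma bs_act1 p : bs_act 1 p = p.
Proof. by apply: bs_tree_eq; rewrite -pi_nil bs_act_pi. Qed.

Lemma bs_actM q r p : bs_act (q * r) p = bs_act q (bs_act r p).
Proof.
by apply: bs_tree_eq; rewrite -(reprK q) -(reprK r) -piM !bs_act_pi act_word_cat.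
Qed.

Lemma bs_act_dist q (p p' : bs_tree) : dist (bs_act q p) (bs_act q p') = dist p p'.
Proof. exact: (act_word_dist (repr q) (valP p) (valP p')). Qed.

Definition bs_action : action Q bs_tree := Action bs_act1 bs_actM bs_act_dist.

Definition root : bs_tree := exist (fun s => reduced (A0 :: s)) [::] isT.
Definition hub : bs_tree := exist (fun s => reduced (A0 :: s)) [:: B0] isT.

Lemma dist_root_hub : dist root hub = 1%Z. Proof. by []. Qed.

(** The end of a path records a coset that is moved by plain translation, so an element fixing
    [root] or [hub] must lie in the corresponding factor. *)
Lemma last_act_word w s : last A0 (act_word w s) = translate (pi w) (last A0 s).
Proof.
elim: w => [|x w IH]; first by rewrite pi_nil translate1.
rewrite (pi_cons _ _ w) translateM -IH /= /act_letter; case: ifP => h.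
  have /translate_par hq := par_star_letter h.
  rewrite last_reroot -{1}hq last_map; congr translate; exact: last_reroot.
have /translate_par hq := par_rest_letter h.
by rewrite -{1}hq last_map.
Qed.

Lemma stab_root q : act bs_action q root = root <-> par (~: [set v]) q.
Proof.
split=> [h|[w [hw <-]]].
  apply/translate_par; have := last_act_word (repr q) [::].
  by rewrite reprK /= => <-; move/(congr1 val): h => /= ->.
apply: bs_tree_eq; rewrite bs_act_pi /=.
elim: w hw => //= x w IH /andP[hx /IH ->].
by rewrite /act_letter; move: hx; rewrite !inE => /negbTE ->.
Qed.

Lemma stab_hub q : act bs_action q hub = hub <-> par (star v) q.
Proof.
split=> [h|[w [hw <-]]].
  apply/translate_par; have := last_act_word (repr q) [:: B0].
  by rewrite reprK /= => <-; move/(congr1 val): h => /= ->.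
apply: bs_tree_eq; rewrite bs_act_pi /=.
elim: w hw => //= x w IH /andP[hx /IH ->].
have {}hx : par (star v) (pi [:: x]) by case: x hx => u a; apply: par_letter.
rewrite /act_letter; case: ifP => h; first by rewrite /act_star /reroot eqxx.
by move/translate_par: hx => /= ->.
Qed.

End BassSerre.

Lemma nat_min (P : nat -> Prop) : (exists n, P n) -> exists n, P n /\ forall m, P m -> n <= m.
Proof.
move=> [n]; elim/ltn_ind: n => n IH hn.
have [[m [hm hlt]]|h] := pselect (exists m, P m /\ m < n); first exact: IH hm.
by exists n; split=> // m hm; rewrite leqNgt; apply/negP => hlt; apply: h; exists m.
Qed.

Arguments act : simpl never.
Arguments Z.mul : simpl never.
Arguments dist : simpl never.

(** * Cyclic reduction *)

Section CyclicReduction.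
Local Open Scope group_scope.
Variables (V : finType) (e : rel V) (G : V -> grp).
Hypotheses (e_sym : symmetric e) (e_irr : irreflexive e).
Local Notation word := (word G).
Local Notation lt v a := (existT (fun v => G v) v a : letter G).
Local Notation Q := (gprod e G).
Local Notation pi := (@pi V e G).
Local Notation A u := (bs_action G e_sym e_irr u).
Local Notation "q '∙[' u ']' p" := (act (A u) q p) (at level 45, right associativity).
Local Notation rt u := (root e G u).
Local Notation hb u := (hub e G u).
Implicit Types (w : word) (L M : {set V}) (x y z o : Q) (u v : V).

Definition cnt u w := count (fun l : letter G => projT1 l == u) w.

Lemma cnt_cat u w w' : cnt u (w ++ w') = cnt u w + cnt u w'.
Proof. exact: count_cat. Qed.

Lemma cnt_cons u u' (a : G u') w : cnt u (lt u' a :: w) = (u' == u) + cnt u w.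
Proof. by []. Qed.

Lemma cnt_winv u w : cnt u (winv w) = cnt u w.
Proof. by rewrite /cnt /winv count_rev count_map. Qed.

Lemma cnt0_supported u w : cnt u w = 0 -> supported (~: [set u]) w.
Proof.
rewrite /supported /cnt; elim: w => //= l w IH; rewrite !inE.
by case: eqP => //= _ /IH.
Qed.

Lemma supported_cnt0 L u w : supported L w -> u \notin L -> cnt u w = 0.
Proof.
move=> hw hu; elim: w hw => //= l w IH /andP[hl /IH ->]; rewrite addn0.
by case: eqP => // h; rewrite -h hl in hu.
Qed.

Lemma cnt_supported L w : (forall u, u \notin L -> cnt u w = 0) -> supported L w.
Proof.
elim: w => //= l w IH h; apply/andP; split.
  by apply/negPn/negP => hl; have := h _ hl; rewrite /= eqxx.
by apply: IH => u hu; have := h u hu; rewrite /=; lia.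
Qed.

Lemma split_first u w : 0 < cnt u w ->
  exists p (b : G u) q, w = p ++ lt u b :: q /\ cnt u p = 0.
Proof.
elim: w => //= -[u' a] w IH; have [h|h] := eqVneq u' u.
  by subst u' => _; exists [::], a, w.
rewrite /= => /IH [p [b [q [-> hp]]]].
by exists (lt u' a :: p), b, q; rewrite /= (negbTE h).
Qed.

Lemma split_last u w : 0 < cnt u w ->
  exists p (b : G u) q, w = p ++ lt u b :: q /\ cnt u q = 0.
Proof.
elim: w => //= -[u' a] w IH; case: (posnP (cnt u w)) => hw.
  rewrite hw /=; case: (u' =P u) => //= h _; subst u'.
  by exists [::], a, w.
have [p [b [q [ew hq]]]] := IH hw.
by exists (lt u' a :: p), b, q; rewrite ew.
Qed.

Lemma star_rest u : star e u :&: ~: [set u] = link e u.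
Proof.
apply/setP => v; rewrite !inE.
by case: (v =P u) => [->|]; rewrite ?e_irr ?andbF ?andbT //= andbT.
Qed.

Lemma par_link u (q : Q) : par (star e u) q -> par (~: [set u]) q -> par (link e u) q.
Proof. by rewrite -star_rest; apply: parI. Qed.

Lemma par_link_comm u (a : G u) (q : Q) : par (link e u) q -> q * pi [:: lt u a] = pi [:: lt u a] * q.
Proof.
move=> hq; apply: (@par_comm _ _ _ (link e u) [set u]) => //.
  by apply: par_letter; rewrite inE.
by move=> v v'; rewrite !inE => hv /eqP ->; rewrite e_sym.
Qed.

Lemma cnt0_root u w : cnt u w = 0 -> pi w ∙[u] rt u = rt u.
Proof. by move=> h; apply/stab_root; exists w; split=> //; apply: cnt0_supported. Qed.

Lemma letter_hub u (a : G u) : pi [:: lt u a] ∙[u] hb u = hb u.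
Proof. by apply/stab_hub; apply: par_letter; rewrite inE eqxx. Qed.

(** A letter at u rotates about the hub at distance 1, and every other letter fixes the base
    point. *)
Lemma dist_word u w : (dist (rt u) (pi w ∙[u] rt u) <= 2 * Z.of_nat (cnt u w))%Z.
Proof.
elim: w => [|[u' a] w IH]; first by rewrite pi_nil act1 dist_refl.
rewrite (pi_cons _ _ w) actM cnt_cons.
have := dist_tri (rt u) (pi [:: lt u' a] ∙[u] pi w ∙[u] rt u) (pi [:: lt u' a] ∙[u] rt u).
rewrite act_dist; have [h|h] := eqVneq u' u; last first.
  rewrite [pi [:: lt u' a] ∙[u] rt u]cnt0_root ?dist_refl ?cnt_cons ?(negbTE h) //.
  by move=> h1; lia.
subst u'; have := dist_tri (rt u) (pi [:: lt u a] ∙[u] rt u) (hb u).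
have -> : dist (hb u) (pi [:: lt u a] ∙[u] rt u) = dist (rt u) (hb u).
  by rewrite -{1}(letter_hub a) act_dist distC.
by rewrite dist_root_hub => h1 h2; lia.
Qed.

Arguments dist_word : clear implicits.

Lemma dist_word_hub u w : (dist (rt u) (pi w ∙[u] hb u) <= 2 * Z.of_nat (cnt u w) + 1)%Z.
Proof.
have := dist_tri (rt u) (pi w ∙[u] hb u) (pi w ∙[u] rt u); rewrite act_dist dist_root_hub.
by have := dist_word u w; lia.
Qed.

Lemma first_hub u p : cnt u p = 0 -> dist (rt u) (pi p ∙[u] hb u) = 1%Z.
Proof. by move=> hp; rewrite -{1}(cnt0_root hp) act_dist. Qed.

Arguments dist_word_hub : clear implicits.

(* The first edge of a geodesic starting at the base point is read off the first letter at u. *)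
Lemma first_hub_between u p (b : G u) q y : cnt u p = 0 ->
  dist (rt u) (pi (p ++ lt u b :: q) * y ∙[u] rt u) =
    (2 + dist (rt u) (pi q * y ∙[u] rt u))%Z ->
  between (rt u) (pi p ∙[u] hb u) (pi (p ++ lt u b :: q) * y ∙[u] rt u).
Proof.
move=> hp h; have h1 := first_hub hp; rewrite /between h h1.
have h2 : dist (pi p ∙[u] hb u) (pi (p ++ lt u b :: q) * y ∙[u] rt u) =
    dist (hb u) (pi q * y ∙[u] rt u).
  by rewrite piM (pi_cons _ _ q) -!mulgA !(actM, act_dist) -{1}(letter_hub b) act_dist.
have := dist_tri (rt u) (pi (p ++ lt u b :: q) * y ∙[u] rt u) (pi p ∙[u] hb u).
have := dist_tri (hb u) (pi q * y ∙[u] rt u) (rt u).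
by rewrite h h1 h2 (distC (hb u) (rt u)) dist_root_hub; lia.
Qed.

Definition shortest w := forall w', pi w' = pi w -> size w <= size w'.

Lemma shortest_infix p w q : shortest (p ++ w ++ q) -> shortest w.
Proof.
move=> h w' hw'; have := h (p ++ w' ++ q); rewrite !piM hw' !size_cat => /(_ erefl).
by lia.
Qed.

Lemma shortest_exists (q : Q) : exists w, pi w = q /\ shortest w.
Proof.
have [|n [[w [<- <-]] hmin]] := @nat_min (fun n => exists w, pi w = q /\ size w = n).
  by exists (size (repr q)), (repr q); rewrite reprK.
by exists w; split=> // w' hw'; apply: hmin; exists w'.
Qed.

(** Geometric form of the normal form theorem. A new first letter at u adds 2 unless the geodesic
    from the base point to its image under w starts through the hub; then the letter would merge
    with the first letter of w at u and shorten the word. *)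
Lemma dist_shortest u w : shortest w ->
  dist (rt u) (pi w ∙[u] rt u) = (2 * Z.of_nat (cnt u w))%Z.
Proof.
elim: w => [|[u' a] w IH] hs; first by rewrite pi_nil act1 dist_refl.
have {}IH := IH (@shortest_infix [:: lt u' a] w [::] _).
rewrite cats0 /= in IH; have {}IH := IH hs.
rewrite (pi_cons _ _ w) actM cnt_cons; have [h|h] := eqVneq u' u; last first.
  rewrite -{1}(@cnt0_root u [:: lt u' a]) ?act_dist ?IH ?cnt_cons ?(negbTE h) //.
subst u'; rewrite act_distVr; set g := pi [:: lt u a].
have hg : g^-1 ∙[u] hb u = hb u by apply/act_fixV/letter_hub.
have hgr : g^-1 ∙[u] rt u <> rt u.
  move=> /act_fixV; rewrite invgK => /stab_root /(par_letter_notin e_irr) ha.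
  by have := hs w; rewrite (pi_cons _ _ w) ha pi_one mul1g /= => /(_ erefl); rewrite ltnn.
have d1 : dist (g^-1 ∙[u] rt u) (hb u) = 1%Z by rewrite -hg act_dist.
have d2 : dist (hb u) (rt u) = 1%Z by rewrite distC.
have b1 : between (g^-1 ∙[u] rt u) (hb u) (rt u).
  rewrite /between d1 d2; have [c hc] := dist_even (g^-1 ∙[u] rt u) (hb u) (rt u).
  have hn : dist (g^-1 ∙[u] rt u) (rt u) <> 0%Z by move/dist_eq0.
  have := dist_ge0 (g^-1 ∙[u] rt u) (rt u).
  by have := dist_tri (g^-1 ∙[u] rt u) (rt u) (hb u); lia.
have b2 : between (hb u) (rt u) (pi w ∙[u] rt u).
  rewrite /between d2; have [c hc] := dist_even (hb u) (rt u) (pi w ∙[u] rt u).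
  have t1 := dist_tri (hb u) (pi w ∙[u] rt u) (rt u).
  have t2 := dist_tri (rt u) (pi w ∙[u] rt u) (hb u).
  rewrite dist_root_hub in t2.
  suff : dist (hb u) (pi w ∙[u] rt u) <> (dist (rt u) (pi w ∙[u] rt u) - 1)%Z by lia.
  move=> hd; have hw : 0 < cnt u w by have := dist_ge0 (hb u) (pi w ∙[u] rt u); lia.
  have [p [b [q [ew hp]]]] := split_first hw.
  have hq : dist (rt u) (pi q ∙[u] rt u) = (2 * Z.of_nat (cnt u q))%Z.
    have e1 : dist (pi (p ++ [:: lt u b]) ∙[u] rt u) (pi w ∙[u] rt u) =
        dist (rt u) (pi q ∙[u] rt u).
      have -> : w = (p ++ [:: lt u b]) ++ q by rewrite ew -catA.
      by rewrite [pi (_ ++ q)]piM actM act_dist.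
    have := dist_tri (rt u) (pi w ∙[u] rt u) (pi (p ++ [:: lt u b]) ∙[u] rt u).
    have := dist_word u q; have := dist_word u (p ++ [:: lt u b]).
    by rewrite e1 IH ew !cnt_cat !cnt_cons eqxx hp [cnt u [::]]/=; lia.
  have bp : between (rt u) (pi p ∙[u] hb u) (pi w ∙[u] rt u).
    have := @first_hub_between u p b q 1 hp; rewrite -ew !mulg1 IH hq; apply.
    by rewrite ew cnt_cat cnt_cons eqxx hp; lia.
  have bh : between (rt u) (hb u) (pi w ∙[u] rt u).
    by rewrite /between hd dist_root_hub; lia.
  have eh := between_uniq bp bh (first_hub hp).
  (* The prefix before the first letter at u fixes both the hub and the base point, so it commutes
     with [G u] and lets the two letters meet. *)
  have hpl : par (link e u) (pi p).
    by apply: par_link; [apply/stab_hub; exact: eh|exists p; rewrite cnt0_supported].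
  have ep : pi (p ++ lt u (gmul a b) :: q) = pi (lt u a :: w).
    rewrite (pi_cons _ _ w) ew !piM !(pi_cons _ _ q) pi_letterM !mulgA.
    by rewrite (par_link_comm a hpl).
  by have := hs _ ep; rewrite ew /= !size_cat /=; lia.
have hr : hb u <> rt u by move/dist_eq0; rewrite d2.
have [b3 b4] := between_cat b1 b2 hr.
by move: b1 b4; rewrite /between d1 d2 IH => <- <-; lia.
Qed.

Lemma shortest_supported L w : shortest w -> par L (pi w) -> supported L w.
Proof.
move=> hs hw; apply: cnt_supported => u hu.
have : dist (rt u) (pi w ∙[u] rt u) = 0%Z.
  apply/dist_eq0/esym/stab_root; apply: parS hw.
  by apply/subsetP => v hv; rewrite !inE; apply: contraNneq hu => <-.
by rewrite dist_shortest //; lia.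
Qed.

Lemma shortest_in L (q : Q) : par L q -> exists w, [/\ pi w = q, shortest w & supported L w].
Proof.
move=> hq; have [w [hw hs]] := shortest_exists q.
by exists w; split=> //; apply: shortest_supported => //; rewrite hw.
Qed.

Definition cyc_reduced x o w := x = o * pi w * o^-1 /\
  forall o' w', x = o' * pi w' * o'^-1 -> size w <= size w'.

Lemma cyc_reduced_exists x : exists o w, cyc_reduced x o w.
Proof.
have [|n [[o [w [hw <-]]] hmin]] :=
  @nat_min (fun n => exists o w, x = o * pi w * o^-1 /\ size w = n).
  by exists (size (repr x)), 1, (repr x); rewrite reprK mul1g invg1 mulg1.
by exists o, w; split=> // o' w' h; apply: hmin; exists o', w'.
Qed.

Lemma cyc_reduced_shortest x o w : cyc_reduced x o w -> shortest w.
Proof. by move=> [hx hmin] w' hw'; apply: (hmin o); rewrite hw'. Qed.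

(** By [translation_powers] it suffices that the geodesics to w^-1 and w times the base point leave
    it through different hubs; these are read off the last and the first letter of w at u. *)
Lemma cyc_reduced_translation x o w u : cyc_reduced x o w -> 0 < cnt u w ->
  ~~ supported (star e u) w ->
  forall n, dist (rt u) (pi w ^+ n ∙[u] rt u) = (Z.of_nat n * (2 * Z.of_nat (cnt u w)))%Z.
Proof.
move=> hc hu hstar; have hs := cyc_reduced_shortest hc.
set g := pi w; have d1 : dist (rt u) (g ∙[u] rt u) = (2 * Z.of_nat (cnt u w))%Z.
  exact: dist_shortest.
apply: translation_powers; [lia|exact: d1|].
have [p [a [q1 [ew hp]]]] := split_first hu.
have [q2 [b [p' [ew' [hp' hq1]]]]] : exists q2 (b : G u) p', w = q2 ++ lt u b :: p' /\ cnt u p' = 0 /\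
    (q1 = p' \/ exists m, q1 = m ++ lt u b :: p').
  case: (posnP (cnt u q1)) => [h0|/split_last [m [b [p' [eq1 h0]]]]].
    by exists p, a, q1; split=> //; split=> //; left.
  exists (p ++ lt u a :: m), b, p'; rewrite ew eq1 -catA.
  by split=> //; split=> //; right; exists m.
have eg : g = pi q2 * pi [:: lt u b] * pi p' by rewrite /g ew' piM (pi_cons _ _ p') mulgA.
have r1 : dist (rt u) ((pi p')^-1 ∙[u] hb u) = 1%Z.
  by rewrite act_distVr invgK cnt0_root.
have c2 : cnt u w = (cnt u q2).+1 by rewrite ew' cnt_cat cnt_cons eqxx hp'; lia.
have b1 : between (g^-1 ∙[u] rt u) ((pi p')^-1 ∙[u] hb u) (rt u).
  apply: between_sym; rewrite /between r1 [dist (rt u) (g^-1 ∙[u] _)]act_distVr invgK.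
  rewrite (distC (g ∙[u] _)) d1.
  have e1 : dist ((pi p')^-1 ∙[u] hb u) (g^-1 ∙[u] rt u) = dist (rt u) (pi q2 ∙[u] hb u).
    rewrite act_distVr invgK -actM eg mulgK actM letter_hub distC //.
  have := dist_word_hub u q2; have := dist_tri (rt u) (g^-1 ∙[u] rt u) ((pi p')^-1 ∙[u] hb u).
  by rewrite r1 e1 [dist (rt u) (g^-1 ∙[u] _)]act_distVr invgK (distC (g ∙[u] _)) d1; lia.
have b2 : between (rt u) (pi p ∙[u] hb u) (g ∙[u] rt u).
  have hs1 : shortest q1.
    by apply: (@shortest_infix (p ++ [:: lt u a]) q1 [::]); rewrite cats0 -catA -ew.
  have := @first_hub_between u p a q1 1 hp; rewrite !mulg1 -ew d1 dist_shortest //; apply.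
  by rewrite ew cnt_cat cnt_cons eqxx hp; lia.
have h1 := first_hub hp.
(* Equal hubs would put [p' ++ p] in the link of u. *)
have [eh|nh] := pselect (pi p ∙[u] hb u = (pi p')^-1 ∙[u] hb u); last first.
  have b0 : between ((pi p')^-1 ∙[u] hb u) (rt u) (pi p ∙[u] hb u).
    rewrite /between distC r1 h1.
    have [k hk] := dist_even ((pi p')^-1 ∙[u] hb u) (rt u) (pi p ∙[u] hb u).
    have hn : dist ((pi p')^-1 ∙[u] hb u) (pi p ∙[u] hb u) <> 0%Z by move/dist_eq0 => h; apply: nh.
    have := dist_ge0 ((pi p')^-1 ∙[u] hb u) (pi p ∙[u] hb u); rewrite distC r1 h1 in hk.
    have := dist_tri ((pi p')^-1 ∙[u] hb u) (pi p ∙[u] hb u) (rt u).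
    by rewrite (distC _ (rt u)) r1 h1; lia.
  have n1 : (pi p')^-1 ∙[u] hb u <> rt u by move=> h; rewrite h dist_refl in r1.
  have n2 : rt u <> pi p ∙[u] hb u by move=> h; rewrite -h dist_refl in h1.
  have [_ b3] := between_cat b1 b0 n1; have [b4 _] := between_cat b3 b2 n2.
  move: b4; rewrite /between act_distV invgK d1 [dist (g^-1 ∙[u] _) (g ∙[u] _)]act_distV invgK.
  by move=> <-; lia.
exfalso.
have hc' : par (link e u) (pi (p' ++ p)).
  apply: par_link; last by exists (p' ++ p); rewrite cnt0_supported // cnt_cat hp hp'.
  by apply/stab_hub; rewrite piM actM eh actKV.
case: hq1 => [eq1|[m em]].
(* With a single letter at u, the rotated word is still shortest, so [q1 ++ p] is spelled in the
   link and w in the star of u. *)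
- subst p'; set w2 := q1 ++ p ++ [:: lt u a].
  have h2 : cyc_reduced x (o * (pi q1)^-1) w2.
    split=> [|o' w' hw'].
      rewrite (proj1 hc) ew /w2 !piM (pi_cons _ _ q1) invgM invgK !mulgA.
      by rewrite mulgVK.
    by have := (proj2 hc) o' w' hw'; rewrite ew /w2 !size_cat /=; lia.
  have h3 : shortest (q1 ++ p).
    apply: (@shortest_infix [::] _ [:: lt u a]); rewrite -catA.
    exact: (cyc_reduced_shortest h2).
  have := shortest_supported h3 hc'; rewrite supported_cat => /andP[s1 s2].
  have hls : link e u \subset star e u by apply/subsetP => v; rewrite !inE => ->; rewrite orbT.
  case/negP: hstar; rewrite ew supported_cat (supportedS hls s2) /=.
  by rewrite inE eqxx; apply: supportedS hls s1.
(* With two letters at u, rotating the end of w to the front makes b pass [p' ++ p] and merge with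
   a, a shorter conjugate. *)
- have h2 : x = (o * (pi p')^-1 * (pi [:: lt u b])^-1) * pi ((p' ++ p) ++ lt u (gmul b a) :: m) *
      (o * (pi p')^-1 * (pi [:: lt u b])^-1)^-1.
    have hb := par_link_comm b hc'; rewrite piM in hb.
    rewrite (proj1 hc) ew em !piM (pi_cons _ _ (m ++ _)) (pi_cons _ _ m) !piM.
    rewrite (pi_cons _ _ p') pi_letterM !invgM !invgK.
    move: (pi p) (pi p') (pi [:: lt u a]) (pi [:: lt u b]) (pi m) hb => x1 x2 y1 y2 z1 hb.
    by rewrite [x2 * x1 * _]mulgA [x2 * x1 * (_ * _)]mulgA hb !mulgA !mulgVK.
  by have := (proj2 hc) _ _ h2; rewrite ew em !size_cat /= size_cat /=; lia.
Qed.

Lemma cyc_reduced_elliptic x o w u : cyc_reduced x o w ->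
  cnt u w = 0 \/ supported (star e u) w -> elliptic (A u) x.
Proof.
move=> [-> _] h; exists (o ∙[u] (if cnt u w == 0 then rt u else hb u)).
rewrite -actM -mulgA mulVg mulg1 actM; congr (act _ _ _).
case: eqP h => [h _|h [//|hw]]; first exact: cnt0_root.
by apply/stab_hub; exists w.
Qed.

Lemma cyc_reduced_not_elliptic x o w u : cyc_reduced x o w -> 0 < cnt u w ->
  ~~ supported (star e u) w -> ~ elliptic (A u) x.
Proof.
move=> hc hu hstar; have hd := cyc_reduced_translation hc hu hstar.
rewrite (proj1 hc) => /elliptic_conj.
have [|||al [ax _]] := @axis_exists _ _ (A u) (pi w) (rt u) (2 * Z.of_nat (cnt u w))%Z.
- by lia.
- by have := hd 1%N; rewrite expg1 => ->; lia.
- by have := hd 2%N; rewrite expg2 actM => ->; lia.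
by move=> he; apply: (axis_not_elliptic ax (n := 1%N)) => //; rewrite expg1.
Qed.

Definition lox x : {set V} := [set u | `[< ~ elliptic (A u) x >]].

Lemma loxP x u : reflect (~ elliptic (A u) x) (u \in lox x).
Proof. by rewrite inE; apply: asboolP. Qed.

Lemma loxPn x u : u \notin lox x -> elliptic (A u) x.
Proof. by move=> h; apply: contrapT => h1; case/negP: h; apply/loxP. Qed.

(* The orbit of the base point under w lies on a geodesic of T_u. *)
Definition translating u w := 0 < cnt u w /\ forall n : nat,
  dist (rt u) (pi w ^+ n ∙[u] rt u) = (Z.of_nat n * (2 * Z.of_nat (cnt u w)))%Z.

(** One conjugator serves all trees at once: o carries the base point of T_u onto the axis of x for
    every u in [lox x]. *)
Definition lox_base x o w : Prop := x = o * pi w * o^-1 /\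
  forall u, u \in lox x -> translating u w.

Lemma cyc_reduced_lox x o w u : cyc_reduced x o w ->
  u \in lox x = (0 < cnt u w) && ~~ supported (star e u) w.
Proof.
move=> hc; apply/loxP/andP => [h|[h1 h2]]; last exact: cyc_reduced_not_elliptic hc h1 h2.
split; first by rewrite lt0n; apply/eqP => h0; apply: h; apply: cyc_reduced_elliptic hc _; left.
by apply/negP => h0; apply: h; apply: cyc_reduced_elliptic hc _; right.
Qed.

Lemma cyc_reduced_base x o w : cyc_reduced x o w -> lox_base x o w.
Proof.
move=> hc; split=> [|u]; first exact: (proj1 hc).
rewrite (cyc_reduced_lox u hc) => /andP[h1 h2]; split=> //.
exact: cyc_reduced_translation hc h1 h2.
Qed.

Lemma lox_base_axis x o w u : lox_base x o w -> u \in lox x ->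
  exists al, is_axis (A u) x al (2 * Z.of_nat (cnt u w)) /\
    forall k, al (k * (2 * Z.of_nat (cnt u w)))%Z = zexp x k * o ∙[u] rt u.
Proof.
move=> [ex hx] /hx [h0 hd].
have ex1 p : x ∙[u] o ∙[u] p = o ∙[u] pi w ∙[u] p by rewrite -!actM {1}ex mulgVK.
have [|||al [ax hal]] := @axis_exists _ _ (A u) x (o ∙[u] rt u) (2 * Z.of_nat (cnt u w))%Z.
- by lia.
- by have := hd 1%N; rewrite ex1 act_dist expg1 => ->; lia.
- by have := hd 2%N; rewrite !ex1 act_dist -actM -expg2 => ->; lia.
by exists al; split=> // k; rewrite hal actM.
Qed.

Lemma lox_exp x n u : 0 < n -> u \in lox x -> u \in lox (x ^+ n).
Proof.
move=> n0 hu; have [o [w hc]] := cyc_reduced_exists x.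
have [al [ax _]] := lox_base_axis (cyc_reduced_base hc) hu.
by apply/loxP; apply: axis_not_elliptic ax _ n0.
Qed.

End CyclicReduction.
Arguments dist_word [V e G] e_sym e_irr u w.

(** * Acylindricity *)

Section Layers.
Variables (V : finType) (e : rel V) (T : {set V}) (v : V).
Hypotheses (e_sym : symmetric e) (e_irr : irreflexive e) (vT : v \in T).

Definition nonadj (S : {set V}) : rel V :=
  fun a b => [&& a \in S, b \in S, a != b & ~~ e a b].

Fixpoint layer n : {set V} :=
  if n is n'.+1 then layer n' :|: [set u | [exists a in layer n', nonadj T a u]] else [set v].

Lemma layerS n u : u \in layer n -> u \in layer n.+1.
Proof. by rewrite /= in_setU => ->. Qed.

Lemma layer_step n a u : a \in layer n -> nonadj T a u -> u \in layer n.+1.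
Proof. by move=> ha hu; rewrite /= !inE; apply/orP; right; apply/existsP; exists a; rewrite ha. Qed.

Lemma layer_inv n u : u \in layer n.+1 -> u \notin layer n ->
  exists2 a, a \in layer n & nonadj T a u.
Proof. by rewrite /= !inE => /orP[->//|/existsP[a /andP[h1 h2]] _]; exists a. Qed.

Lemma layer_sub n u : u \in layer n -> u \in T.
Proof.
elim: n u => [|n IH] u /=; first by rewrite inE => /eqP ->.
by rewrite !inE => /orP[/IH //|/existsP[a /andP[_ /and4P[]]]].
Qed.

(* Vertices two layers apart are adjacent: picking one vertex in every other layer gives a clique. *)
Lemma layer_clique n u : u \in layer n -> (0 < n -> u \notin layer n.-1) ->
  exists K : {set V}, [/\ u \in K, cliqueb e K, #|K| = n./2.+1 & K \subset layer n].
Proof.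
have base m a : a \in layer m -> m./2 = 0 ->
    exists K : {set V}, [/\ a \in K, cliqueb e K, #|K| = m./2.+1 & K \subset layer m].
  move=> ha hm; exists [set a]; rewrite set11 cards1 hm sub1set ha; split=> //.
  apply/forall_inP => b /set1P ->; apply/forall_inP => c /set1P ->.
  by rewrite eqxx.
elim/ltn_ind: n u => -[|[|n]] IH u hu hn; [exact: base|exact: base|].
have [a ha hau] := layer_inv hu (hn isT).
have ha' : a \notin layer n by apply: contra (hn isT) => h; apply: layer_step hau.
have [b hb hba] := layer_inv ha ha'.
have [||K [bK cK sK KL]] := IH n _ b hb; first by lia.
  move=> n0; apply: contra ha' => h; rewrite -(prednK n0); exact: layer_step hba.
have uT : u \in T by case/and4P: hau.
have uK : u \notin K.
  by apply: contra (hn isT) => /(subsetP KL) h; apply: layerS.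
have adj c : c \in K -> e u c.
  move=> hc; have hcL := subsetP KL _ hc; apply: contraT => hne.
  case/negP: (hn isT); apply: (layer_step hcL).
  apply/and4P; split=> //; first exact: layer_sub hcL.
    by apply: contraNneq uK => <-.
  by rewrite e_sym.
exists (u |: K); rewrite setU11 cardsU1 uK sK; split=> //.
  apply/forall_inP => c /setU1P[->|hc]; apply/forall_inP => c' /setU1P[->|hc']; apply/implyP.
  - by rewrite eqxx.
  - by move=> _; apply: adj.
  - by move=> _; rewrite e_sym; apply: adj.
  - by move=> hne; have /forall_inP/(_ c hc)/forall_inP/(_ c' hc')/implyP := cK; apply.
by rewrite subUset sub1set hu /=; apply: subset_trans KL _; apply/subsetP => c /layerS/layerS.
Qed.

Lemma clique_dim (K : {set V}) : cliqueb e K -> #|K| <= dimG e.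
Proof. by move=> hK; rewrite /dimG; apply: (bigmax_sup K). Qed.

Lemma dim_gt0 : V -> 0 < dimG e.
Proof.
move=> a; apply: leq_trans (clique_dim (K := [set a]) _); first by rewrite cards1.
apply/forall_inP => b /set1P ->; apply/forall_inP => c /set1P ->.
by rewrite eqxx.
Qed.

(** A vertex first reached in layer 2d would give, by [layer_clique], a clique with d + 1
    vertices. *)
Lemma layer_stable u : u \in layer (2 * dimG e) -> u \in layer (2 * dimG e).-1.
Proof.
move=> hu; apply: contraT => hn.
have [K [_ cK sK _]] := layer_clique hu (fun=> hn).
by have := clique_dim cK; lia.
Qed.

Lemma connect_layer u : connect (nonadj T) v u -> u \in layer (2 * dimG e).-1.
Proof.
have d0 := dim_gt0 u.
have inj k b : b \in layer 0 -> b \in layer k by elim: k => // k IH /IH /layerS.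
case/connectP=> p; elim/last_ind: p u => [|p b IH] u.
  by move=> _ ->; apply: inj; rewrite inE.
rewrite rcons_path last_rcons => /andP[hp hb] ->.
have h := layer_step (IH _ hp erefl) hb.
apply: layer_stable; have e2 : (2 * dimG e).-1.+1 = 2 * dimG e by lia.
by rewrite -e2.
Qed.

End Layers.

Section Acylindricity.
Local Open Scope group_scope.
Variables (V : finType) (e : rel V) (G : V -> grp).
Hypotheses (e_sym : symmetric e) (e_irr : irreflexive e).
Local Notation word := (word G).
Local Notation lt v a := (existT (fun v => G v) v a : letter G).
Local Notation Q := (gprod e G).
Local Notation pi := (@pi V e G).
Local Notation A u := (bs_action G e_sym e_irr u).
Local Notation "q '∙[' u ']' p" := (act (A u) q p) (at level 45, right associativity).
Local Notation rt u := (root e G u).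
Local Notation hb u := (hub e G u).
Implicit Types (w : word) (L M : {set V}) (x y z o : Q) (u v : V).

Local Notation translating := (translating e_sym e_irr).

Lemma translating_inv u w : translating u w -> translating u (winv w).
Proof.
move=> [h1 h2]; split=> [|n]; first by rewrite cnt_winv.
by rewrite cnt_winv piV expVgn act_distVr invgK distC h2.
Qed.

(** The upper bounds of [dist_word] on the pieces add up to the exact length of the orbit segment,
    so the path traced by the word is geodesic. *)
Lemma prefix_between u w p q k : translating u w -> w = p ++ q -> 0 < k ->
  between (rt u) (pi p ∙[u] rt u) (pi w ^+ k ∙[u] rt u).
Proof.
move=> [_ h2] ew k0; rewrite /between h2.
have := dist_word e_sym e_irr u p; have := dist_word e_sym e_irr u q.
have := dist_tri (rt u) (pi w ^+ k ∙[u] rt u) (pi p ∙[u] rt u).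
have := dist_tri (rt u) (pi q * pi w ^+ k.-1 ∙[u] rt u) (pi q ∙[u] rt u).
have -> : dist (pi p ∙[u] rt u) (pi w ^+ k ∙[u] rt u) =
    dist (rt u) (pi q * pi w ^+ k.-1 ∙[u] rt u).
  by rewrite -(prednK k0) expgS {1}ew piM -!mulgA actM act_dist.
rewrite [pi q * _ ∙[u] _]actM act_dist !h2 ew cnt_cat; nia.
Qed.

Lemma orbit_between u w i j k : translating u w -> i <= j <= k ->
  between (pi w ^+ i ∙[u] rt u) (pi w ^+ j ∙[u] rt u) (pi w ^+ k ∙[u] rt u).
Proof.
move=> [_ h2] /andP[hij hjk].
have hd a b : a <= b -> dist (pi w ^+ a ∙[u] rt u) (pi w ^+ b ∙[u] rt u) =
    (Z.of_nat (b - a) * (2 * Z.of_nat (cnt u w)))%Z.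
  by move=> hab; rewrite -{1}(subnKC hab) expgnDr actM act_dist h2.
by rewrite /between !hd //; [nia|lia].
Qed.

(** The passage from T_v to T_u: z fixes an edge of T_v at the prefix p, so its conjugate by p lies
    in the link group of v. That link misses u when u is not adjacent to v, so the conjugate fixes
    the base point of T_u. *)
Lemma fixed_prefix u v w z m : translating v w -> u != v -> ~~ e v u -> 0 < m ->
  z ∙[v] rt v = rt v -> z ∙[v] pi w ^+ m ∙[v] rt v = pi w ^+ m ∙[v] rt v ->
  exists p q, w = p ++ q /\ z ∙[u] pi p ∙[u] rt u = pi p ∙[u] rt u.
Proof.
move=> [h1 h2] huv hne m0 f1 f2.
have [p [a [q [ew hp]]]] := split_first h1.
exists p, (lt v a :: q); split=> //.
have em : pi (p ++ lt v a :: q) * pi w ^+ m.-1 = pi w ^+ m by rewrite -ew -expgS prednK.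
have hb1 : between (rt v) (pi p ∙[v] hb v) (pi w ^+ m ∙[v] rt v).
  rewrite -em; apply: first_hub_between => //; rewrite em h2.
  have := dist_word e_sym e_irr v q.
  have := dist_tri (rt v) (pi q * pi w ^+ m.-1 ∙[v] rt v) (pi q ∙[v] rt v).
  have := dist_tri (rt v) (pi w ^+ m ∙[v] rt v) (pi (p ++ [:: lt v a]) ∙[v] rt v).
  have := dist_word e_sym e_irr v (p ++ [:: lt v a]).
  have -> : dist (pi (p ++ [:: lt v a]) ∙[v] rt v) (pi w ^+ m ∙[v] rt v) =
      dist (rt v) (pi q * pi w ^+ m.-1 ∙[v] rt v).
    rewrite -em (_ : p ++ lt v a :: q = (p ++ [:: lt v a]) ++ q); last by rewrite -catA.
    by rewrite [pi (_ ++ q)]piM -mulgA actM act_dist.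
  rewrite [dist (pi q ∙[v] _) _](_ : _ = dist (rt v) (pi w ^+ m.-1 ∙[v] rt v)); last first.
    by rewrite actM act_dist.
  by rewrite !h2 ew !cnt_cat !cnt_cons eqxx hp [cnt v [::]]/=; nia.
have hz : par (link e v) ((pi p)^-1 * (z * pi p)).
  apply: par_link => //.
    by apply/stab_hub; rewrite !actM (fix_between f1 f2 hb1) actK.
  by apply/stab_root; rewrite !actM cnt0_root // f1 -{1}(cnt0_root e_sym e_irr hp) actK.
have {hz} : (pi p)^-1 * (z * pi p) ∙[u] rt u = rt u.
  apply/stab_root; apply: parS hz; apply/subsetP => c; rewrite !inE => hc.
  by apply: contraNneq hne => <-.
by rewrite !actM => /(congr1 (act (A u) (pi p))); rewrite actKV.
Qed.

(** [fixed_prefix] is used from both ends, for w and for its inverse; the fixed points found in T_u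
    enclose all orbit points except the two outermost. *)
Lemma fixed_orbit u v w z m k : translating v w -> translating u w -> u != v -> ~~ e v u ->
  z ∙[v] rt v = rt v -> z ∙[v] pi w ^+ m ∙[v] rt v = pi w ^+ m ∙[v] rt v ->
  0 < k < m -> z ∙[u] pi w ^+ k ∙[u] rt u = pi w ^+ k ∙[u] rt u.
Proof.
move=> tv tu huv hne f1 f2 /andP[k0 km].
have m0 : 0 < m by lia.
have [p [q [ew hp]]] := fixed_prefix tv huv hne m0 f1 f2.
have [||p' [q' [ew' hp']]] := @fixed_prefix u v (winv w) ((pi w ^+ m)^-1 * (z * pi w ^+ m)) m
  (translating_inv tv) huv hne m0.
- by rewrite !actM f2 actK.
- by rewrite piV expVgn !actM actKV f1.
move: hp'; rewrite !actM => /(congr1 (act (A u) (pi w ^+ m))); rewrite actKV => hp'.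
apply: (fix_between hp' hp).
have b1 := prefix_between tu ew k0.
have b2 := orbit_between (i := 0) (j := k) (k := m) tu (ltnW km).
have mk : 0 < m - k by rewrite subn_gt0.
have b3 := prefix_between (translating_inv tu) ew' mk.
have {}b3 := act_between (A u) (pi w ^+ m) b3.
rewrite -[in X in between _ _ X]actM piV expVgn in b3.
have ek : pi w ^+ m * pi w ^- (m - k) = pi w ^+ k.
  by rewrite -{1}(subnKC (ltnW km)) expgnDr mulgK.
rewrite ek in b3; rewrite act1 in b2.
have b4 := between_sym (between_mid b2 b1).
exact: (between_mid b4 b3).
Qed.

Lemma par_bigI L (q : Q) : (forall u, u \in L -> par (~: [set u]) q) -> par (~: L) q.
Proof.
move=> h; have [w [ew hs]] := shortest_exists q; exists w; split=> //.
apply: cnt_supported => u; rewrite inE negbK => /h; rewrite -ew => hq.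
by apply: (@supported_cnt0 _ _ (~: [set u])); [exact: (shortest_supported e_sym e_irr)|rewrite !inE eqxx].
Qed.

Lemma supported_filter L M w : supported M w -> supported (L :&: M) (restr L w).
Proof. by rewrite setIC; apply: supported_restr. Qed.

Lemma restr_split L w :
  (forall a b, a \in L -> b \notin L -> 0 < cnt a w -> 0 < cnt b w -> e a b) ->
  pi w = pi (restr L w) * pi (restr (~: L) w) /\
  pi (restr L w) * pi (restr (~: L) w) = pi (restr (~: L) w) * pi (restr L w).
Proof.
move=> h.
have supp L' w' : (forall a, 0 < cnt a w' -> 0 < cnt a w) ->
    supported (L' :&: [set a | 0 < cnt a w]) (restr L' w').
  move=> hw'; apply: supported_filter; apply: cnt_supported => a; rewrite inE => ha.
  by apply/eqP; rewrite -leqn0 leqNgt; apply: contra ha => /hw'.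
have comm w1 w2 : (forall a, 0 < cnt a w1 -> 0 < cnt a w) -> (forall a, 0 < cnt a w2 -> 0 < cnt a w) ->
    pi (restr L w1) * pi (restr (~: L) w2) = pi (restr (~: L) w2) * pi (restr L w1).
  move=> h1 h2; have s1 := supp L w1 h1; have s2 := supp (~: L) w2 h2.
  apply: (par_comm (L := L :&: [set a | 0 < cnt a w]) (M := ~: L :&: [set a | 0 < cnt a w])).
  - by exists (restr L w1).
  - by exists (restr (~: L) w2).
  - by move=> a b; rewrite !inE => /andP[a1 a2] /andP[b1 b2]; apply: h.
split; last exact: comm.
have: forall a, 0 < cnt a w -> 0 < cnt a w by [].
elim: {-2}w => [|[c x] w' IH] hw'; first by rewrite mul1g.
have hw2 a : 0 < cnt a w' -> 0 < cnt a w.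
  by move=> ha; apply: hw'; rewrite cnt_cons ltn_addl.
have hw3 a : 0 < cnt a [:: lt c x] -> 0 < cnt a w.
  by move=> ha; apply: hw'; move: ha; rewrite !cnt_cons addn0 => ha; rewrite ltn_addr.
rewrite (pi_cons _ _ w') IH //.
case hc: (c \in L).
  have -> : restr L (lt c x :: w') = lt c x :: restr L w' by rewrite /restr /= hc.
  have -> : restr (~: L) (lt c x :: w') = restr (~: L) w' by rewrite /restr /= inE hc.
  by rewrite (pi_cons _ _ (restr _ _)) mulgA.
have -> : restr L (lt c x :: w') = restr L w' by rewrite /restr /= hc.
have -> : restr (~: L) (lt c x :: w') = lt c x :: restr (~: L) w' by rewrite /restr /= inE hc.
rewrite (pi_cons _ _ (restr (~: L) w')) !mulgA; congr (_ * _).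
have := comm w' [:: lt c x] hw2 hw3.
by have -> : restr (~: L) [:: lt c x] = [:: lt c x] by rewrite /restr /= inE hc.
Qed.

(** Each step to the next layer loses one translation at either end of the fixed segment. *)
Lemma layer_fixed (T : {set V}) v w z l m u : (forall u, u \in T -> translating u w) -> v \in T ->
  z ∙[v] rt v = rt v -> z ∙[v] pi w ^+ m ∙[v] rt v = pi w ^+ m ∙[v] rt v ->
  u \in layer e T v l -> forall k, l <= k <= m - l ->
  z ∙[u] pi w ^+ k ∙[u] rt u = pi w ^+ k ∙[u] rt u.
Proof.
move=> tr vT f1 f2; elim: l u => [|l IH] u.
  rewrite inE => /eqP -> k /andP[_ hk]; rewrite subn0 in hk.
  apply: (fix_between f1 f2).
  by have := @orbit_between v w 0 k m (tr v vT); rewrite act1; apply.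
move=> hu k /andP[hk1 hk2].
have [hul|hul] := boolP (u \in layer e T v l); first by apply: IH => //; lia.
have [a ha /and4P[aT uT nau ne]] := layer_inv hu hul.
have g1 : z ∙[a] pi w ^+ l ∙[a] rt a = pi w ^+ l ∙[a] rt a by apply: IH => //; lia.
have g2 : z ∙[a] pi w ^+ (m - l) ∙[a] rt a = pi w ^+ (m - l) ∙[a] rt a by apply: IH => //; lia.
have em : pi w ^+ (m - l) = pi w ^+ l * pi w ^+ (m - l - l).
  by rewrite -expgnDr subnKC //; lia.
have ek : pi w ^+ k = pi w ^+ l * pi w ^+ (k - l) by rewrite -expgnDr subnKC //; lia.
have h : (pi w ^+ l)^-1 * (z * pi w ^+ l) ∙[u] pi w ^+ (k - l) ∙[u] rt u = pi w ^+ (k - l) ∙[u] rt u.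
  apply: (@fixed_orbit u a w _ (m - l - l)); rewrite 1?eq_sym //; try exact: tr.
  - by rewrite !actM g1 actK.
  - by move: g2; rewrite em !actM => ->; rewrite actK.
  - by lia.
by move/(congr1 (act (A u) (pi w ^+ l))): h; rewrite ek !actM actKV.
Qed.

(** The component is exhausted after 2d - 1 layers, and 4d - 1 - 2 (2d - 1) = 1, so two consecutive
    orbit points stay fixed in every tree of the component. These suffice, because w splits into
    commuting parts inside and outside S. *)
Lemma comp_fixed (T : {set V}) v w z (S := [set u | connect (nonadj e T) v u]) (m := 4 * dimG e - 1) :
  (forall u, u \in T -> translating u w) ->
  (forall b, 0 < cnt b w -> b \notin T -> supported (star e b) w) -> v \in T ->
  z ∙[v] rt v = rt v -> z ∙[v] pi w ^+ m ∙[v] rt v = pi w ^+ m ∙[v] rt v ->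
  forall u k, u \in S -> z ∙[u] zexp (pi w) k ∙[u] rt u = zexp (pi w) k ∙[u] rt u.
Proof.
move=> tr hst vT f1 f2.
have d0 : 0 < dimG e by apply: dim_gt0 v.
pose l := (2 * dimG e).-1.
have fixed u k : u \in S -> l <= k <= m - l -> z ∙[u] pi w ^+ k ∙[u] rt u = pi w ^+ k ∙[u] rt u.
  rewrite inE => /(connect_layer e_sym vT) hu; exact: (layer_fixed tr vT f1 f2 hu).
have ST u : u \in S -> u \in T.
  by rewrite inE => /(connect_layer e_sym vT); apply: layer_sub.
have [es ec] : pi w = pi (restr S w) * pi (restr (~: S) w) /\
    pi (restr S w) * pi (restr (~: S) w) = pi (restr (~: S) w) * pi (restr S w).
  apply: restr_split => a b aS bS ha hb'.
  have hab : a != b by apply: contraNneq bS => <-.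
  have [bT|bT] := boolP (b \in T).
    apply: contraT => hne; case/negP: bS; rewrite inE.
    apply: (connect_trans (y := a)); first by rewrite inE in aS.
    by apply: connect1; rewrite /nonadj (ST a aS) bT hab.
  have := hst b hb' bT => hs; have : a \in star e b.
    by apply: contraTT ha => /(supported_cnt0 hs) ->.
  by rewrite inE (negbTE hab) /= e_sym.
set y1 := pi (restr S w) in es ec; set y2 := pi (restr (~: S) w) in es ec.
have [zl ezl] : exists zl, zl = (pi w ^+ l)^-1 * (z * pi w ^+ l) by eexists.
have zl1 : par (~: S) zl.
  apply: par_bigI => u uS; apply/stab_root; rewrite ezl !actM fixed ?actK //.
  by rewrite /m /l; lia.
have zl2 : par (~: S) ((y1 * y2)^-1 * (zl * (y1 * y2))).
  apply: par_bigI => u uS; apply/stab_root; rewrite -es ezl !actM.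
  have := fixed u l.+1 uS; rewrite expgSr !actM => ->; last by rewrite /m /l; lia.
  by rewrite !actK.
have p2 : par (~: S) y2.
  by exists (restr (~: S) w); split=> //; apply: supportedS (subsetIl _ setT) (supported_filter _ _); apply: cnt_supported => u; rewrite inE.
have p1 : par S y1.
  by exists (restr S w); split=> //; apply: supportedS (subsetIl _ setT) (supported_filter _ _); apply: cnt_supported => u; rewrite inE.
have r1 : rho (~: S) y1 = 1 by apply: rho_kill p1 _; rewrite -setI_eq0 setICr.
(* [zl] and its conjugate by w both lie in the subgroup over the complement of S. The retraction
   onto it turns conjugation by [y1 * y2] into conjugation by [y2]. *)
have comm : zl * y1 = y1 * zl.
  have := rho_id zl2; rewrite !rhoM !rhoV rhoM r1 !mul1g (rho_id zl1) (rho_id p2).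
  rewrite invgM -mulgA => /mulgI h.
  move/(congr1 ( *%g y1)): h; rewrite mulVKg !mulgA => h.
  exact/esym/(mulIg y2).
have zfix u k : u \in S -> zl ∙[u] zexp (pi w) k ∙[u] rt u = zexp (pi w) k ∙[u] rt u.
  move=> uS; have hr (q : Q) : par (~: S) q -> q ∙[u] rt u = rt u.
    move=> hq; apply/stab_root; apply: parS hq; rewrite setCS sub1set //.
  rewrite es zexpM // !actM [zexp y2 k ∙[u] _]hr; last first.
    case: k => [|k|k]; [exact: par1|exact: parX|by apply/parV/parX].
  by rewrite -actM zexp_comm // actM hr.
move=> u k uS; have := zfix u (k - Z.of_nat l)%Z uS.
move/(congr1 (act (A u) (pi w ^+ l))); rewrite ezl !actM actKV -!actM -!zexp_nat -!mulgA -zexpD.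
by rewrite (_ : (Z.of_nat l + (k - Z.of_nat l))%Z = k); last by lia.
Qed.

End Acylindricity.

(** * Square roots in parabolic subgroups without 2-torsion *)

Section SquareRoots.
Local Open Scope group_scope.
Variables (V : finType) (e : rel V) (G : V -> grp).
Hypotheses (e_sym : symmetric e) (e_irr : irreflexive e).
Local Notation word := (word G).
Local Notation lt v a := (existT (fun v => G v) v a : letter G).
Local Notation Q := (gprod e G).
Local Notation pi := (@pi V e G).
Local Notation A u := (bs_action G e_sym e_irr u).
Local Notation "q '∙[' u ']' p" := (act (A u) q p) (at level 45, right associativity).
Local Notation rt u := (root e G u).
Local Notation hb u := (hub e G u).
Implicit Types (w : word) (L M : {set V}) (x y z o : Q) (u v : V).

Lemma par_star_split u (q : Q) : par (star e u) q ->
  exists (b : G u) l, q = pi [:: lt u b] * l /\ par (link e u) l.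
Proof.
case=> w [hw <-]; elim: w hw => [|[c a] w IH] hw.
  by exists (gone (G u)), 1; rewrite pi_one mulg1; split=> //; apply: par1.
move: hw => /= /andP[hc /IH [b [l [el hl]]]].
rewrite (pi_cons _ _ w) el.
case: (c =P u) => hcu.
  subst c; exists (gmul a b), l; rewrite pi_letterM mulgA; by split.
have pc : par (link e u) (pi [:: lt c a]).
  by apply: par_letter; move: hc; rewrite !inE; case: eqP.
exists b, (pi [:: lt c a] * l); split; last exact: parM.
by rewrite !mulgA par_link_comm.
Qed.

Lemma split_at u w k : k < cnt u w -> exists p (b : G u) q, w = p ++ lt u b :: q /\ cnt u p = k.
Proof.
elim: w k => // -[c a] w IH k; rewrite cnt_cons.
case: (c =P u) => hc; last first.
  by rewrite add0n => /IH [p [b [q [-> hp]]]]; exists (lt c a :: p), b, q; rewrite cnt_cons (introF eqP hc).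
subst c; case: k => [|k] hk; first by exists [::], a, w.
have [|p [b [q [-> hp]]]] := IH k; first by lia.
by exists (lt u a :: p), b, q; rewrite cnt_cons eqxx hp.
Qed.

Lemma swap_between (P : tree) (B : action Q P) x (r m : P) : act B x (act B x r) = r ->
  between r m (act B x r) ->
  between r (act B x m) (act B x r) /\
  dist r (act B x m) = (dist r (act B x r) - dist r m)%Z.
Proof.
move=> hr hbt; have := act_between B x hbt; rewrite hr => /between_sym h; split=> //.
by move: h; rewrite /between [dist (act B x m) _]distC act_dist; lia.
Qed.

Hypothesis no2 : ~ has_order2 G.

(* If x moves the base point of T_u but x^2 does not, then x flips the midpoint of
   [root, x root]: around a coset of star u this is an involution in G_u, around a
   coset of V \ u it is excluded by induction on the support. *)
Lemma par_sqrt n (W L : {set V}) x : #|W| <= n -> par W x -> par L (x * x) -> par L x.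
Proof.
elim: n W L x => [|n IH] W L x hW hx hxx.
  move: hW; rewrite leqn0 cards_eq0 => /eqP hW; rewrite hW in hx.
  by rewrite (par0 hx); apply: par1.
rewrite -[L]setCK; apply: (par_bigI e_sym e_irr) => u; rewrite inE => uL.
apply/(stab_root e_sym e_irr); apply: contrapT => hmove.
have h2 : x ∙[u] x ∙[u] rt u = rt u.
  rewrite -actM; apply/stab_root; apply: parS hxx.
  by apply/subsetP => a aL; rewrite !inE; apply: contraNneq uL => <-.
have [w [ew hs hw]] := shortest_in e_sym e_irr hx.
have hd := dist_shortest e_sym e_irr u hs; rewrite ew in hd.
have c0 : 0 < cnt u w.
  by rewrite lt0n; apply/eqP => c0; apply: hmove; rewrite -ew cnt0_root.
have h3 m : between (rt u) m (x ∙[u] rt u) -> x ∙[u] x ∙[u] m = m.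
  rewrite -actM => hbt; apply: (fix_between _ _ hbt); rewrite actM ?h2 //.
have uniq m m' : between (rt u) m (x ∙[u] rt u) -> between (rt u) m' (x ∙[u] rt u) ->
    dist (rt u) m = (2 * Z.of_nat (cnt u w) - dist (rt u) m')%Z -> x ∙[u] m = m'.
  move=> b1 b2 h; have [b3 e3] := swap_between h2 b1.
  by apply: (between_uniq b3 b2); rewrite e3 hd h; lia.
have broot p q : w = p ++ q -> between (rt u) (pi p ∙[u] rt u) (x ∙[u] rt u) /\
    dist (rt u) (pi p ∙[u] rt u) = (2 * Z.of_nat (cnt u p))%Z.
  move=> epq; rewrite /between hd -ew epq piM [pi p * _ ∙[u] _]actM act_dist cnt_cat.
  have := dist_word e_sym e_irr u p; have := dist_word e_sym e_irr u q.
  have := dist_tri (rt u) (pi w ∙[u] rt u) (pi p ∙[u] rt u).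
  by rewrite {2}epq piM [pi p * _ ∙[u] _]actM act_dist ew hd epq cnt_cat; lia.
have bhub p (b : G u) q : w = p ++ lt u b :: q -> between (rt u) (pi p ∙[u] hb u) (x ∙[u] rt u) /\
    dist (rt u) (pi p ∙[u] hb u) = (2 * Z.of_nat (cnt u p) + 1)%Z.
  move=> epq; have [b1 e1] := broot _ _ epq.
  have epq' : w = (p ++ [:: lt u b]) ++ q by rewrite -catA.
  have [b2 e2] := broot _ _ epq'.
  have hh : dist (pi p ∙[u] hb u) (pi (p ++ [:: lt u b]) ∙[u] rt u) = 1%Z.
    by rewrite piM [pi p * _ ∙[u] _]actM act_dist -{1}(letter_hub e_sym e_irr b) act_dist distC.
  have hp : dist (pi p ∙[u] rt u) (pi p ∙[u] hb u) = 1%Z by rewrite act_dist.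
  have := dist_tri (rt u) (pi p ∙[u] hb u) (pi p ∙[u] rt u).
  have := dist_tri (rt u) (pi (p ++ [:: lt u b]) ∙[u] rt u) (pi p ∙[u] hb u).
  have := dist_tri (pi p ∙[u] hb u) (x ∙[u] rt u) (pi (p ++ [:: lt u b]) ∙[u] rt u).
  have := dist_tri (rt u) (x ∙[u] rt u) (pi p ∙[u] hb u).
  move: b2; rewrite /between e1 e2 hp hh cnt_cat cnt_cons eqxx [cnt u [::]]/=.
  by lia.
(* The midpoint is at distance [cnt u w] from the root, hence a translate of the hub exactly when
   this is odd. Then x exchanges two of its neighbours, and the middle letter a at u has order 2. *)
case hodd: (odd (cnt u w)).
  have [|p [a [q [epq hp]]]] := @split_at u w (cnt u w)./2; first by lia.
  have [bh eh] := bhub _ _ _ epq; have [bp ep] := broot _ _ epq.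
  have epq' : w = (p ++ [:: lt u a]) ++ q by rewrite -catA.
  have [ba ea] := broot _ _ epq'.
  rewrite cnt_cat cnt_cons eqxx [cnt u [::]]/= in ea.
  have xh : x ∙[u] pi p ∙[u] hb u = pi p ∙[u] hb u by apply: uniq => //; lia.
  have xp : x ∙[u] pi p ∙[u] rt u = pi (p ++ [:: lt u a]) ∙[u] rt u by apply: uniq => //; lia.
  have xa : x ∙[u] pi (p ++ [:: lt u a]) ∙[u] rt u = pi p ∙[u] rt u by apply: uniq => //; lia.
  pose x' := (pi p)^-1 * (x * pi p).
  have [b [l [eb hl]]] : exists (b : G u) l, x' = pi [:: lt u b] * l /\ par (link e u) l.
    apply: par_star_split; apply/stab_hub; rewrite !actM xh actK //.
  have hl' : par (~: [set u]) l.
    by apply: parS hl; apply/subsetP => c; rewrite !inE => hc; apply: contraTneq hc => ->; rewrite e_irr.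
  have lr : l ∙[u] rt u = rt u by apply/stab_root.
  have x1 : pi [:: lt u b] ∙[u] rt u = pi [:: lt u a] ∙[u] rt u.
    rewrite -{1}lr -actM -eb /x' !actM xp piM actM actK //.
  have eab : a = b.
    apply: gmul_eqr; apply: (par_letter_notin e_irr (e := e)); apply/(stab_root e_sym e_irr).
    rewrite pi_letterM actM x1 -actM -pi_letterM gmulV pi_one act1 //.
  have x2 : x' ∙[u] pi [:: lt u a] ∙[u] rt u = rt u.
    rewrite /x' !actM -[pi p ∙[u] pi _ ∙[u] _]actM -piM xa actK //.
  apply: no2; exists u, a; split.
    move=> ha; move: ea; rewrite ha piM pi_one mulg1 ep; lia.
  apply: (par_letter_notin e_irr (e := e)); apply/(stab_root e_sym e_irr).
  rewrite pi_letterM actM -[in X in _ = X]x2 eb -eab actM -[l ∙[u] _]actM.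
  by rewrite par_link_comm // actM lr.
(* The midpoint is now the translate of the root by [r1]. The conjugate [x'] fixes the root, so u
   leaves its support, and its square fixes the hub. Induction with target [star e u] makes [x'] fix
   the hub, although x exchanges two distinct hubs. *)
have [|p [a [r2 [epr hp]]]] := @split_at u w (cnt u w)./2.-1; first by lia.
have er2 : 0 < cnt u r2 by move: c0 hodd hp; rewrite epr cnt_cat cnt_cons eqxx; lia.
have [s [b [q [eq hs0]]]] := split_first er2.
have e1 : w = (p ++ [:: lt u a]) ++ r2 by rewrite -catA.
have e2 : w = ((p ++ [:: lt u a]) ++ s) ++ lt u b :: q by rewrite e1 eq catA.
set r1 := p ++ [:: lt u a] in e1 e2.
have cr1 : cnt u r1 = (cnt u p).+1 by rewrite cnt_cat cnt_cons eqxx [cnt u [::]]/=; lia.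
have hr1 : pi r1 ∙[u] hb u = pi p ∙[u] hb u by rewrite piM actM letter_hub.
have [bm em] := broot _ _ e1.
have [b1 d1] := bhub _ _ _ epr; rewrite -hr1 in b1 d1.
have [b2 d2] := bhub _ _ _ e2; rewrite cnt_cat hs0 in d2.
have xm : x ∙[u] pi r1 ∙[u] rt u = pi r1 ∙[u] rt u by apply: uniq => //; lia.
have xh : x ∙[u] pi r1 ∙[u] hb u = pi (r1 ++ s) ∙[u] hb u by apply: uniq => //; lia.
pose x' := (pi r1)^-1 * (x * pi r1).
have x'W : par (W :&: ~: [set u]) x'.
  apply: parI; last by apply/(stab_root e_sym e_irr); rewrite !actM xm actK.
  have pr1 : par W (pi r1).
    by exists r1; split=> //; move: hw; rewrite e1 supported_cat => /andP[].
  by apply: parM; [exact: parV|exact: parM].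
have x'2 : par (star e u) (x' * x').
  apply/(stab_hub e_sym e_irr); rewrite !actM actKV h3 // actK //.
have uW : u \in W.
  by apply: contraTT c0 => /(supported_cnt0 hw) ->.
have hlt : #|W :&: ~: [set u]| <= n by rewrite -setDE; have := cardsD1 u W; rewrite uW; lia.
have := IH _ _ _ hlt x'W x'2; move/(stab_hub e_sym e_irr); rewrite !actM xh => /(congr1 (act (A u) (pi r1))); rewrite actKV => h.
by move: d2; rewrite h d1; lia.
Qed.

End SquareRoots.

(** * Exponents that avoid obstructions *)

Definition at_most (n : nat) (P : nat -> Prop) :=
  forall s : seq nat, uniq s -> (forall j, j \in s -> P j) -> size s <= n.

(** If valuation 0 is allowed, a or a + 1 is odd. Otherwise only even numbers are searched; halving
    them halves the interval and leaves one forbidden valuation less. *)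
Lemma avoid_valuations m (J : nat -> Prop) a : at_most m J -> 0 < a ->
  exists n, a <= n < a + 2 ^ m /\ ~ J (logn 2 n).
Proof.
elim: m J a => [|m IH] J a hJ a0.
  exists a; rewrite expn0; split; first by lia.
  by move=> hj; have := hJ [:: logn 2 a]; rewrite /= => /(_ isT) /(_ _)/implyP; case=> // j /[!inE] /eqP ->.
have p0 : 0 < 2 ^ m by rewrite expn_gt0.
have [j0|j0] := pselect (J 0); last first.
  exists (a + ~~ odd a); rewrite expnS; split; first by case: (odd a); lia.
  by rewrite logn_coprime // coprime2n oddD; case: (odd a).
have [||n [hn1 hn2]] := IH (fun j => J j.+1) a.+1./2; [|by lia|].
  move=> s us hs; have := hJ (0 :: map S s).
  rewrite /= size_map (map_inj_uniq succn_inj) us ltnS; apply.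
    by rewrite andbT; apply/mapP => -[].
  by move=> j; rewrite inE => /orP[/eqP -> //|/mapP[i hi ->]]; apply: hs.
exists (2 * n); rewrite expnS; split; first by lia.
by rewrite lognM //; lia.
Qed.

(** Each of k + 1 consecutive blocks of length 2^m supplies a candidate, and B cannot contain all of
    these distinct numbers. *)
Lemma avoid_both m k (J B : nat -> Prop) a : at_most m J -> at_most k B -> 0 < a ->
  exists n, [/\ a <= n < a + 2 ^ m * k.+1, ~ J (logn 2 n) & ~ B n].
Proof.
move=> hJ hB a0; apply: contrapT => hno.
have hf i : exists n, a + 2 ^ m * i <= n < a + 2 ^ m * i.+1 /\ ~ J (logn 2 n).
  have [|n [h1 h2]] := @avoid_valuations m J (a + 2 ^ m * i) hJ; first by lia.
  by exists n; rewrite mulnS; split=> //; lia.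
have [f hf'] := choice hf.
have mono i j : i < j -> f i < f j.
  move=> hij; have [/andP[_ h1] _] := hf' i; have [/andP[h2 _] _] := hf' j.
  have h3 : 2 ^ m * i.+1 <= 2 ^ m * j by rewrite leq_mul2l hij orbT.
  by lia.
have : size (map f (iota 0 k.+1)) <= k.
  apply: hB.
    rewrite map_inj_uniq ?iota_uniq // => i j.
    by case: (ltngtP i j) => // /mono; lia.
  move=> n /mapP[i]; rewrite mem_iota => /andP[_ hi] ->.
  apply: contrapT => hn; apply: hno; exists (f i); have [/andP[h1 h2] h3] := hf' i; split=> //.
  have : 2 ^ m * i.+1 <= 2 ^ m * k.+1 by rewrite leq_mul2l; apply/orP; right; lia.
  by lia.
by rewrite size_map size_iota ltnn.
Qed.

(** Witnesses of different numbers are distinct and not joined in the complement graph, so they form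
    a clique. *)
Lemma independent_at_most (V : finType) (e : rel V) (T : {set V}) (P : nat -> Prop)
    (W : nat -> V -> Prop) : symmetric e ->
  (forall n, P n -> exists2 v, v \in T & W n v) ->
  (forall n m u v, W n u -> W m v -> connect (nonadj e T) u v -> n = m) ->
  at_most (dimG e) P.
Proof.
move=> e_sym hP hW s us hs.
have [->|[n0 hn0]] : s = [::] \/ exists n, n \in s.
- by case: s {us hs} => [|n s]; [left|right; exists n; rewrite mem_head].
- by [].
have [v0 _ _] := hP _ (hs _ hn0).
have hf n : exists v, n \in s -> v \in T /\ W n v.
  case: (boolP (n \in s)) => hn; last by exists v0.
  by have [v v1 v2] := hP _ (hs _ hn); exists v.
have [f {}hf] := choice hf.
have inj : {in s &, injective f}.
  move=> n m hn hm h; have [_ w1] := hf _ hn; have [_ w2] := hf _ hm.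
  by apply: hW w1 w2 _; rewrite h connect0.
have -> : size s = #|[set x in map f s]|.
  by rewrite cardsE -(size_map f) (card_uniqP _) // map_inj_in_uniq.
apply: clique_dim; apply/forall_inP => a; rewrite inE => /mapP[n hn ->].
apply/forall_inP => b; rewrite inE => /mapP[m hm ->]; apply/implyP => hne.
apply: contraT => hadj; have [t1 w1] := hf _ hn; have [t2 w2] := hf _ hm.
have : n = m by apply: hW w1 w2 _; apply: connect1; rewrite /nonadj t1 t2 hne.
by move=> h; rewrite h eqxx in hne.
Qed.

(** * Combining two elements *)

Section Combination.
Local Open Scope group_scope.
Variables (V : finType) (e : rel V) (G : V -> grp).
Hypotheses (e_sym : symmetric e) (e_irr : irreflexive e).
Local Notation word := (word G).
Local Notation Q := (gprod e G).
Local Notation pi := (@pi V e G).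
Local Notation A u := (bs_action G e_sym e_irr u).
Local Notation "q '∙[' u ']' p" := (act (A u) q p) (at level 45, right associativity).
Local Notation rt u := (root e G u).
Local Notation lox := (lox e_sym e_irr).
Local Notation linked x := (connect (nonadj e (lox x))).
Implicit Types (w : word) (L M : {set V}) (x y z o g h r : Q) (u v : V).

Lemma acylindrical x o w v z i : cyc_reduced x o w -> v \in lox x ->
  z ∙[v] zexp x i ∙[v] o ∙[v] rt v = zexp x i ∙[v] o ∙[v] rt v ->
  (let j := (i + Z.of_nat (4 * dimG e - 1))%Z in
   z ∙[v] zexp x j ∙[v] o ∙[v] rt v = zexp x j ∙[v] o ∙[v] rt v) ->
  forall u k, linked x v u -> z ∙[u] zexp x k ∙[u] o ∙[u] rt u = zexp x k ∙[u] o ∙[u] rt u.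
Proof.
move=> hc vx f1 f2.
have [ex hb] := cyc_reduced_base e_sym e_irr hc.
have hx k u p : zexp x k ∙[u] o ∙[u] p = o ∙[u] zexp (pi w) k ∙[u] p.
  by rewrite -!actM {1}ex zexp_conj mulgVK.
set c := o * zexp (pi w) i.
have hz k u : (c^-1 * (z * c)) ∙[u] zexp (pi w) k ∙[u] rt u = zexp (pi w) k ∙[u] rt u <->
    z ∙[u] zexp x (i + k)%Z ∙[u] o ∙[u] rt u = zexp x (i + k)%Z ∙[u] o ∙[u] rt u.
  rewrite hx zexpD !actM -[o ∙[u] zexp _ i ∙[u] _]actM -/c.
  split=> [h|->]; last by rewrite actK.
  by rewrite -[in RHS]h actKV.
move=> u k hu; have -> : k = (i + (k - i))%Z by lia.
apply/hz; apply: (@comp_fixed _ _ _ e_sym e_irr (lox x) v) => //.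
- by move=> b b1; rewrite (cyc_reduced_lox e_sym e_irr b hc) b1 /= negbK.
- by have := proj2 (hz 0%Z v); rewrite zexp0 !act1 Z.add_0_r; apply.
- by have := proj2 (hz (Z.of_nat (4 * dimG e - 1)) v) f2; rewrite zexp_nat.
- by rewrite inE.
Qed.

Definition cyc_axis h o w v (al : Z -> bs_tree e G v) : Prop :=
  [/\ cyc_reduced h o w, v \in lox h, is_axis (A v) h al (2 * Z.of_nat (cnt v w))%Z &
    forall k, al (k * (2 * Z.of_nat (cnt v w)))%Z = zexp h k ∙[v] o ∙[v] rt v].

Lemma cyc_axis_exists h o w v : cyc_reduced h o w -> v \in lox h ->
  exists al : Z -> bs_tree e G v, cyc_axis h o w al.
Proof.
move=> hc hv; have [al [h1 h2]] := lox_base_axis (cyc_reduced_base e_sym e_irr hc) hv.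
by exists al; split=> // k; rewrite h2 actM.
Qed.

(** Length is measured in translation lengths of h, on an axis whose lattice points are an orbit of
    the base point, as acylindricity requires. *)
Definition long_reversal (rho : Z) r h v :=
  exists o w (al : Z -> bs_tree e G v) (c l : Z), cyc_axis h o w al /\
    (rho * (2 * Z.of_nat (cnt v w)) <= l)%Z /\ reverses (A v) al r c l.

(** 4d + 1 is the acylindricity length 4d - 1 plus the 2 lost in [reverses_fix]. *)
Lemma long_reversal_coarse r h v u :
  long_reversal (4 * Z.of_nat (dimG e) + 1) r h v -> linked h v u ->
  coarse_reversal (A u) r h.
Proof.
move=> [o [w [al [a [l [[hc hv ax hal] [hl hr]]]]]]] hu.
have d0 : 0 < dimG e := dim_gt0 e v.
have [||k] := @reverses_fix _ _ _ h al _ r a l (Z.of_nat (4 * dimG e - 1)) ax hr.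
- by lia.
- by apply: Z.le_trans hl; lia.
rewrite !hal => -[f1 f2].
apply: (@coarse_reversal_fix _ _ _ _ _ (o ∙[u] rt u)) => j.
exact: (acylindrical hc hv f1 f2).
Qed.

(** An element exchanging two points of the axis, one of them a translate of the root, has a square
    that fixes this point. By [par_sqrt] it fixes the point itself. *)
Lemma no_long_reversal r h v : ~ has_order2 G -> ~ long_reversal 2 r h v.
Proof.
move=> no2 [o [w [al [a [l [[hc hv ax hal] [hl hr]]]]]]].
have [j [i [b [s1 [s2 s3]]]]] := reverses_swap ax hr hl.
rewrite hal -[zexp h i ∙[v] o ∙[v] _]actM in s1 s2.
have [x ex] : exists x, x = zexp h j * r by eexists.
have [c ec] : exists c, c = zexp h i * o by eexists.
rewrite -ex -ec in s1 s2.
have h1 : par (~: [set v]) (c^-1 * (x * c) * (c^-1 * (x * c))).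
  by apply/(stab_root e_sym e_irr); rewrite !actM actKV s1 s2 actK.
have := par_sqrt e_sym e_irr no2 (leqnn _) (parT _) h1.
move/(stab_root e_sym e_irr); rewrite !actM s1 => /(congr1 (act (A v) c)); rewrite actKV => s4.
apply: s3; apply: (axis_inj ax); rewrite hal -actM -ec; exact: s4.
Qed.

(** The two cases of the theorem differ only in how reversals are controlled: [rho] is the length
    from which they count as long, [delta] the number of valuations at which they can occur. The
    values are 4d + 1 and d in general, 2 and 0 without 2-torsion. *)
Variables (rho : Z) (delta : nat).
Hypotheses (rho1 : (1 <= rho)%Z)
  (rev_coarse : forall r h v u, long_reversal rho r h v -> linked h v u -> coarse_reversal (A u) r h)
  (rev_val : forall g h, at_most delta (fun j => exists n v, [/\ 0 < n, logn 2 n = j & long_reversal rho (g ^+ n) h v])).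

(** If only one factor is loxodromic, [elliptic_reverses] yields an excluded long reversal. If both
    are, [two_axes_cases] leaves a shared segment, with p = 4d - 1 giving 8d + 2 = 2 (p + 2).
    Acylindricity then acts twice: on the commutator z in T_v, and on h^s g^n over the whole
    component. *)
Lemma combine_at g h og wg oh wh v s n : cyc_reduced g og wg -> cyc_reduced h oh wh ->
  v \in lox g :|: lox h ->
  (2 * rho + 8 * Z.of_nat (dimG e) + 2 <= Z.of_nat s)%Z -> (2 * rho + 2 <= Z.of_nat n)%Z ->
  ~ long_reversal rho (h ^+ s) g v -> ~ long_reversal rho (g ^+ n) h v ->
  elliptic (A v) (h ^+ s * g ^+ n) ->
  v \in lox g :&: lox h /\ forall u k, linked h v u ->
    h ^+ s * g ^+ n ∙[u] zexp h k ∙[u] oh ∙[u] rt u = zexp h k ∙[u] oh ∙[u] rt u.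
Proof.
move=> hg hh hv hs hn nr1 nr2 hell.
have d0 : 0 < dimG e := dim_gt0 e v.
have [vg|vg] := boolP (v \in lox g); last first.
  have vh : v \in lox h by move: hv; rewrite inE (negbTE vg).
  have [al ca] := cyc_axis_exists hh vh; have [_ _ ax _] := ca.
  have [|a [l [hl hr]]] := elliptic_reverses ax _ (elliptic_exp n (loxPn vg)) hell; first by lia.
  by case: nr2; exists oh, wh, al, a, l; split=> //; split=> //; have := axis_pos ax; nia.
have [vh|vh] := boolP (v \in lox h); last first.
  have [al ca] := cyc_axis_exists hg vg; have [_ _ ax _] := ca.
  have hell' : elliptic (A v) (g ^+ n * h ^+ s).
    apply: (@elliptic_conj _ _ _ _ (h ^+ s)); by rewrite mulgA mulgK.
  have [|a [l [hl hr]]] := elliptic_reverses ax _ (elliptic_exp s (loxPn vh)) hell'; first by lia.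
  by case: nr1; exists og, wg, al, a, l; split=> //; split=> //; have := axis_pos ax; nia.
split; first by rewrite inE vg.
have [al ca] := cyc_axis_exists hh vh; have [_ _ axh halh] := ca.
have [be cb] := cyc_axis_exists hg vg; have [_ _ axg _] := cb.
have [|||||] := two_axes_cases (rho := rho) (p := Z.of_nat (4 * dimG e - 1)) axh axg _ _ _ _ hell.
- by [].
- by lia.
- by lia.
- by lia.
- move=> [a [l [hl hr]]]; case: nr2; by exists oh, wh, al, a, l.
- case=> [[a [l [hl hr]]]|].
    (* The excluded reversal concerns h^s, whereas h^(-s) appears here; it is ruled out as a power
       of the loxodromic h^-1. *)
    have hrev : coarse_reversal (A v) (h ^- s) g.
      by apply: (rev_coarse (v := v)); [exists og, wg, be, a, l|exact: connect0].
    rewrite -expVgn in hrev; case: (coarse_reversal_not_power axg (axis_inv axh) hrev).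
  move=> [z [k [f1 [f2 f3]]]] u j hu.
  rewrite !halh in f1 f2.
  have zf := acylindrical hh vh f1 f2 (u := v).
  have t0 := axis_pos axh.
  have zal a : z ∙[v] al a = al a.
    have zk i : z ∙[v] al (i * (2 * Z.of_nat (cnt v wh)))%Z = al (i * (2 * Z.of_nat (cnt v wh)))%Z.
      by rewrite halh zf // connect0.
    pose t := (2 * Z.of_nat (cnt v wh))%Z.
    apply: (fix_between (zk (a / t)%Z) (zk (a / t + 1)%Z)); apply: (axis_between axh).
    have := Z.div_mod a t; have := Z.mod_pos_bound a t t0; rewrite /t; nia.
  have ff := f3 zal.
  have fk i : h ^+ s * g ^+ n ∙[v] zexp h i ∙[v] oh ∙[v] rt v = zexp h i ∙[v] oh ∙[v] rt v.
    by rewrite -halh ff.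
  exact: (acylindrical hh vh (fk 0%Z) (fk _)).
Qed.

Lemma combine g h s0 n0 :
  (2 * rho + 8 * Z.of_nat (dimG e) + 2 <= Z.of_nat s0)%Z -> (2 * rho + 2 <= Z.of_nat n0)%Z ->
  exists s n, [/\ s0 <= s < s0 + 2 ^ delta, n0 <= n < n0 + 2 ^ delta * (dimG e).+1 &
    lox g :|: lox h \subset lox (h ^+ s * g ^+ n)].
Proof.
move=> hs0 hn0.
have [og [wg hg]] := cyc_reduced_exists g; have [oh [wh hh]] := cyc_reduced_exists h.
have [|s [hs sJ]] := @avoid_valuations _ _ s0 (@rev_val h g); first by lia.
pose W n v := v \in lox g :&: lox h /\ forall u k, linked h v u ->
    h ^+ s * g ^+ n ∙[u] zexp h k ∙[u] oh ∙[u] rt u = zexp h k ∙[u] oh ∙[u] rt u.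
have hB : at_most (dimG e) (fun n => exists v, W n v).
  apply: (@independent_at_most _ _ (lox h) _ W e_sym).
    by move=> n [v hv]; exists v => //; case: hv => /setIP[].
  (* Two bad values in one component make h^s g^n and h^s g^m fix the same point of T_v, so g^(m -
     n) is elliptic there although v is in [lox g]. *)
  have key n m u v : n < m -> W n u -> W m v -> linked h u v -> False.
    move=> hnm [_ h1] [/setIP[vg _] h2] huv.
    have f1 := h1 v 0%Z huv; have f2 := h2 v 0%Z (connect0 _ _).
    rewrite zexp0 !act1 !actM in f1 f2.
    have f3 : g ^+ (m - n) ∙[v] g ^+ n ∙[v] oh ∙[v] rt v = g ^+ n ∙[v] oh ∙[v] rt v.
      by apply: (@act_inj _ _ (A v) (h ^+ s)); rewrite -[g ^+ _ ∙[v] g ^+ _ ∙[v] _]actM -expgnDr subnK ?(ltnW hnm) // f2 f1.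
    have mn0 : 0 < m - n by rewrite subn_gt0.
    by have /loxP := lox_exp mn0 vg; apply; exists (g ^+ n ∙[v] oh ∙[v] rt v).
  move=> n m u v Wn Wm huv; case: (ltngtP n m) => // hnm; exfalso; first exact: key hnm Wn Wm huv.
  apply: (key _ _ _ _ hnm Wm Wn); rewrite sym_connect_sym // => a b.
  by rewrite /nonadj e_sym eq_sym; case: (a \in _); case: (b \in _).
have [|n [hn nJ nB]] := @avoid_both _ _ _ _ n0 (@rev_val g h) hB; first by lia.
exists s, n; split=> //; apply/subsetP => v hv; apply/loxP => hell.
apply: nB; exists v; apply: (combine_at hg hh hv _ _ _ _ hell); try by lia.
  by move=> hr; apply: sJ; exists s, v; split=> //; lia.
by move=> hr; apply: nJ; exists n, v; split=> //; lia.
Qed.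

End Combination.

Section TwoCases.
Local Open Scope group_scope.
Variables (V : finType) (e : rel V) (G : V -> grp).
Hypotheses (e_sym : symmetric e) (e_irr : irreflexive e).
Local Notation Q := (gprod e G).
Local Notation lox := (lox e_sym e_irr).
Implicit Types (g h : Q).

Lemma combine_general g h s0 n0 : 12 * dimG e + 4 + 4 * dimG e <= s0 -> 8 * dimG e + 4 <= n0 ->
  exists s n, [/\ s0 <= s < s0 + 2 ^ dimG e, n0 <= n < n0 + 2 ^ dimG e * (dimG e).+1 &
    lox g :|: lox h \subset lox (h ^+ s * g ^+ n)].
Proof.
move=> hs hn; apply: (@combine _ _ _ e_sym e_irr (4 * Z.of_nat (dimG e) + 1)%Z).
- by lia.
- by move=> r h' v u; apply: long_reversal_coarse.
- move=> {}g {}h.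
  (* Reversals with witnesses in one component coarsely reverse the same axis of h, so
     [coarse_reversal_val] equates their valuations. *)
  apply: (@independent_at_most _ _ (lox h) _ (fun j v => exists n, [/\ 0 < n, logn 2 n = j &
     v \in lox h /\ long_reversal e_sym e_irr (4 * Z.of_nat (dimG e) + 1) (g ^+ n) h v]) e_sym).
    move=> j [n [v [h1 h2 h3]]]; exists v.
      by case: h3 => [o [w [al [u [l [[]]]]]]].
    by exists n; split=> //; split=> //; case: h3 => [o [w [al [u [l [[]]]]]]].
  move=> j j' u v [n [n0' <- [hu h1]]] [n' [n0'' <- [hv h2]]] huv.
  have [o [w hc]] := cyc_reduced_exists h.
  have [al [ax _]] := lox_base_axis (cyc_reduced_base e_sym e_irr hc) hv.
  apply: (coarse_reversal_val ax) => //.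
    exact: long_reversal_coarse h1 huv.
  exact: long_reversal_coarse h2 (connect0 _ _).
- by lia.
- by lia.
Qed.

Lemma combine_no2 g h s0 n0 : ~ has_order2 G -> 8 * dimG e + 6 <= s0 -> 6 <= n0 ->
  exists s n, [/\ s0 <= s < s0 + 1, n0 <= n < n0 + (dimG e).+1 &
    lox g :|: lox h \subset lox (h ^+ s * g ^+ n)].
Proof.
move=> no2 hs hn.
have [|||||s [n [h1 h2 h3]]] := @combine _ _ _ e_sym e_irr 2%Z 0 _ _ _ g h s0 n0.
- by [].
- by move=> r h' v u /(no_long_reversal no2).
- move=> g' h' [|j s] // _ /(_ j); rewrite mem_head => /(_ isT) [n [v [_ _]]].
  by move/(no_long_reversal no2).
- by lia.
- by lia.
by exists s, n; rewrite expn0 mul1n in h1 h2.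
Qed.

End TwoCases.

(** * Strongly irreducible and regular elements *)

Section Criteria.
Local Open Scope group_scope.
Variables (V : finType) (e : rel V) (G : V -> grp).
Hypotheses (e_sym : symmetric e) (e_irr : irreflexive e).
Local Notation word := (word G).
Local Notation Q := (gprod e G).
Local Notation pi := (@pi V e G).
Local Notation lox := (lox e_sym e_irr).
Implicit Types (w f g : word) (L M : {set V}) (x y z o q : Q) (u v : V).

Definition conj_par L q := exists o, par L (o * q * o^-1).

Lemma conj_intoP L g : conj_into e L g <-> conj_par L (pi g).
Proof.
split=> [[h [w [hw heq]]]|[o [w [hw heq]]]].
  exists (pi h), w; split=> //; have /piP := heq.
  by rewrite !piM piV mulgA.
exists (repr o), w; split=> //; apply/piP.
by rewrite !piM piV reprK heq mulgA.
Qed.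

Lemma conj_parS L M q : L \subset M -> conj_par L q -> conj_par M q.
Proof. by move=> h [o ho]; exists o; apply: parS ho. Qed.

Lemma conj_expg o q n : o * q ^+ n * o^-1 = (o * q * o^-1) ^+ n.
Proof. by rewrite -!zexp_nat zexp_conj. Qed.

Lemma lox_conj_par L q n : 0 < n -> conj_par L (q ^+ n) -> lox q \subset L.
Proof.
move=> n0 [o ho]; apply/subsetP => v hv; apply: contraT => vL.
have /loxP := lox_exp n0 hv; case; apply: (@elliptic_conj _ _ _ _ o).
exists (root e G v); apply/stab_root; apply: parS ho.
by apply/subsetP => a aL; rewrite !inE; apply: contraNneq vL => <-.
Qed.

(** If a conjugate avoids u, the retraction that kills u fixes it, so erasing the letters at u from
    w still represents a conjugate of x; a letter at u would contradict minimality. *)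
Lemma cyc_reduced_support L x o w : cyc_reduced x o w -> conj_par L x -> supported L w.
Proof.
move=> [ex hmin] [o1 h1]; apply: cnt_supported => u uL.
apply/eqP; rewrite -leqn0 leqNgt; apply/negP => cu.
have h2 : par (~: [set u]) (o1 * x * o1^-1).
  by apply: parS h1; apply/subsetP => a aL; rewrite !inE; apply: contraNneq uL => <-.
have := rho_id h2; rewrite {1}ex !rhoM !rhoV rho_pi => h3.
set r := rho (~: [set u]) in h3.
have := hmin (o1^-1 * r o1 * r o) (restr (~: [set u]) w).
have -> : x = o1^-1 * r o1 * r o * pi (restr (~: [set u]) w) * (o1^-1 * r o1 * r o)^-1.
  apply: (mulgI o1); apply: (mulIg o1^-1); rewrite /= -h3 !invgM invgK !mulgA mulgV mul1g.
  by rewrite mulgK.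
move=> /(_ erefl); rewrite /restr size_filter leqNgt => /negP; apply.
rewrite -(count_predC (fun l : letter G => projT1 l \in ~: [set u]) w) -addn1 leq_add2l.
rewrite (eq_count (a2 := fun l : letter G => projT1 l == u)) //.
by move=> l; rewrite /= !inE negbK.
Qed.

(** By minimality a cyclically reduced word for q uses every vertex of L, so it does not lie in the
    star of v. *)
Lemma minimal_lox L q v : conj_par L q -> (forall M, conj_par M q -> #|L| <= #|M|) ->
  v \in L -> ~~ (L \subset star e v) -> v \in lox q.
Proof.
move=> hL hmin vL hst; have [o [w hc]] := cyc_reduced_exists q.
have hw := cyc_reduced_support hc hL.
pose S := [set u | 0 < cnt u w].
have wS : supported S w.
  by apply: cnt_supported => u; rewrite inE -leqNgt leqn0 => /eqP.
have SL : S \subset L.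
  by apply/subsetP => u; rewrite inE; apply: contraTT => /(supported_cnt0 hw) ->.
have eS : S = L.
  apply/eqP; rewrite eqEcard SL hmin //; exists o^-1.
  by rewrite (proj1 hc) !mulgA mulVg mul1g invgK mulgVK; exists w.
rewrite (cyc_reduced_lox e_sym e_irr v hc); move: vL; rewrite -eS inE => -> /=.
apply: contra hst => hs; rewrite -eS; apply/subsetP => u; rewrite inE.
by apply: contraTT => /(supported_cnt0 hs) ->.
Qed.

Lemma joined_link v L : L \subset link e v -> joined e [set v] L.
Proof.
move=> /subsetP h; apply/forall_inP => a /set1P ->; apply/forall_inP => b /h.
by rewrite inE.
Qed.

Lemma disjoint1_link v L : L \subset link e v -> [disjoint [set v] & L].
Proof.
move=> /subsetP h; rewrite disjoints1; apply/negP => /h.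
by rewrite inE e_irr.
Qed.

Lemma star_link v L : L \subset star e v -> L :\ v \subset link e v.
Proof.
move=> /subsetP h; apply/subsetP => a; rewrite !inE => /andP[h1 /h].
by rewrite inE (negbTE h1).
Qed.

Lemma minimal_card (P : {set V} -> Prop) : (exists L, P L) ->
  exists L, P L /\ forall M, P M -> #|L| <= #|M|.
Proof.
move=> [L hL]; have [|n [[M [hM <-]] hmin]] := @nat_min (fun n => exists M, P M /\ #|M| = n).
  by exists #|L|, L.
by exists M; split=> // K hK; apply: hmin; exists K.
Qed.

Lemma conj_parT q : conj_par setT q.
Proof. by exists 1; apply: parT. Qed.

(** In a smallest S supporting a conjugate, a vertex outside [lox] would cone off S, making S a
    single vertex or a join. With [lox_conj_par], this is the sense in which [lox] decides
    irreducibility. *)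
Lemma strongly_irreducible_lox g : strongly_irreducible e g ->
  forall L, lox (pi g) \subset L -> conj_into e L g.
Proof.
move=> [si1 si2] L hL.
have [|S [hS hmin]] := @minimal_card (fun M => conj_par M (pi g)).
  by exists setT; apply: conj_parT.
apply/conj_intoP; apply: (conj_parS _ hS); apply: subset_trans hL.
apply/subsetP => v vS; apply: (minimal_lox hS hmin vS); apply/negP => hst.
have hl := star_link hst.
have [h0|h0] := eqVneq (S :\ v) set0.
  apply: si1; exists v; apply/conj_intoP; apply: (conj_parS _ hS).
  by rewrite -setD_eq0; apply/eqP.
apply: si2; exists [set v], (S :\ v); rewrite joined_link // disjoint1_link // h0.
split; first by apply/set0Pn; exists v; rewrite inE.
by do 3!split=> //; apply/conj_intoP; rewrite setD1K.
Qed.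

Lemma infinite_order_par L q : par L q -> (forall m, 0 < m -> q ^+ m <> 1) -> infinite_par e G L.
Proof.
move=> hq hinf s; apply: contrapT => hno.
have inj : injective (fun i => q ^+ i).
  have key i j : i < j -> q ^+ i = q ^+ j -> False.
    move=> hij h; apply: (hinf (j - i)); first by rewrite subn_gt0.
    by apply: (mulgI (q ^+ i)); rewrite -expgnDr subnKC ?(ltnW hij) // mulg1.
  move=> i j /= h; case: (ltngtP i j) => // hij; exfalso; first exact: key hij h.
  exact: key hij (esym h).
have hin i : q ^+ i \in map pi s.
  have [w [hw ew]] := parX i hq.
  apply: contrapT => hn; apply: hno; exists w; split=> //.
  rewrite -ew in hn; elim: s hn => [|w' s IH] hn; first exact: List.Forall_nil.
  apply: List.Forall_cons; first by move/piP => h; apply: hn; rewrite /= h mem_head.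
  by apply: IH => h; apply: hn; rewrite /= inE h orbT.
have : size (map (fun i => q ^+ i) (iota 0 (size s).+1)) <= size (map pi s).
  apply: uniq_leq_size; first by rewrite map_inj_uniq // iota_uniq.
  by move=> x /mapP[i _ ->].
by rewrite !size_map size_iota ltnn.
Qed.

Lemma cone_split L v x : L \subset star e v -> v \in L -> par L x ->
  exists a y, [/\ x = a * y, a * y = y * a, par [set v] a & par (L :\ v) y].
Proof.
move=> hst vL [w [hw <-]].
have [|h1 h2] := @restr_split _ e G [set v] w.
  move=> a b; rewrite !inE => /eqP -> hb _ cb.
  have : b \in L by apply: contraTT cb => /(supported_cnt0 hw) ->.
  by move/(subsetP hst); rewrite inE (negbTE hb).
exists (pi (restr [set v] w)), (pi (restr (~: [set v]) w)); split=> //.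
  exists (restr [set v] w); split=> //.
  exact: supportedS (subsetIr _ _) (supported_restr _ hw).
exists (restr (~: [set v]) w); split=> //; rewrite setDE; exact: supported_restr.
Qed.

(** Here S is smallest over all powers. If v cones off S, the power is conjugate to a commuting
    product a y. When a has finite order, a further power has smaller support; when y does, a
    further power lies in a vertex group; otherwise both factors are infinite. Each case is
    excluded. *)
Lemma regular_lox g : regular e g ->
  forall L, lox (pi g) \subset L -> exists2 n, 0 < n & conj_into e L (wpow g n).
Proof.
move=> reg L hL.
have [|S [[n n0 hS] hmin]] := @minimal_card (fun M => exists2 n, 0 < n & conj_par M (pi g ^+ n)).
  by exists setT, 1%N => //; apply: conj_parT.
exists n => //; apply/conj_intoP; rewrite pi_pow; apply: (conj_parS _ hS); apply: subset_trans hL.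
have sub : S \subset lox (pi g ^+ n).
  apply/subsetP => v vS; apply: (minimal_lox hS) => //.
    by move=> M hM; apply: hmin; exists n.
  apply/negP => hst; have hl := star_link hst.
  have [o ho] := hS; have [a [y [exy cay pa py]]] := cone_split hst vS ho.
  have pw m : (o * (pi g ^+ n) * o^-1) ^+ m = a ^+ m * y ^+ m by rewrite exy expgMn.
  have cp m M : par M ((o * (pi g ^+ n) * o^-1) ^+ m) -> conj_par M (pi g ^+ (n * m)).
    by move=> h; exists o; rewrite expgnA conj_expg.
  have [[m [m0 am]]|ainf] := pselect (exists m, 0 < m /\ a ^+ m = 1).
    have h1 : conj_par (S :\ v) (pi g ^+ (n * m)).
      by apply: cp; rewrite pw am mul1g; apply: parX.
    have := hmin (S :\ v); rewrite (cardsD1 v S) vS add1n ltnn => /(_ _)/negP.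
    by case=> //; exists (n * m)%N => //; rewrite muln_gt0 n0.
  have [[m [m0 ym]]|yinf] := pselect (exists m, 0 < m /\ y ^+ m = 1).
    have [] := reg (n * m)%N; first by rewrite muln_gt0 n0.
    case; exists v; apply/conj_intoP; rewrite pi_pow; apply: cp.
    by rewrite pw ym mulg1; apply: parX.
  have [_] := reg n n0; apply; exists [set v], (S :\ v).
  split; first by apply/set0Pn; exists v; rewrite inE.
  split.
    apply/negP => /eqP h0; apply: yinf; exists 1%N; split=> //.
    by move: py; rewrite h0 expg1 => /par0.
  rewrite disjoint1_link // joined_link //; do 2!split=> //.
  split; first by apply: (infinite_order_par pa) => m m0 h; apply: ainf; exists m.
  split; first by apply: (infinite_order_par py) => m m0 h; apply: yinf; exists m.
  by apply/conj_intoP; rewrite pi_pow setD1K.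
apply: subset_trans sub _; apply/subsetP => v /loxP h; apply/loxP => h'; apply: h.
exact: elliptic_exp.
Qed.

Lemma strongly_irreducible_mono f g : lox (pi g) \subset lox (pi f) ->
  strongly_irreducible e g -> strongly_irreducible e f.
Proof.
move=> hsub si; have key L : conj_into e L f -> conj_into e L g.
  move=> /conj_intoP h; apply: (strongly_irreducible_lox si).
  apply: subset_trans hsub _; apply: (@lox_conj_par _ _ 1) => //.
case: si => si1 si2; split.
  by move=> [v /key hv]; apply: si1; exists v.
by move=> [L1 [L2 [h1 [h2 [h3 [h4 /key h5]]]]]]; apply: si2; exists L1, L2.
Qed.

Lemma regular_mono f g : lox (pi g) \subset lox (pi f) -> regular e g -> regular e f.
Proof.
move=> hsub reg n n0.
have key L : conj_into e L (wpow f n) -> exists2 m, 0 < m & conj_into e L (wpow g m).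
  move=> /conj_intoP h; apply: (regular_lox reg).
  apply: subset_trans hsub _; rewrite pi_pow in h; exact: lox_conj_par h.
split.
  by move=> [v /key [m m0 hv]]; case: (reg m m0) => h _; apply: h; exists v.
move=> [L1 [L2 [h1 [h2 [h3 [h4 [h5 [h6 /key [m m0 h7]]]]]]]]].
by case: (reg m m0) => _ h; apply: h; exists L1, L2.
Qed.

End Criteria.

(** * Short products *)

Section ShortElements.
Local Open Scope group_scope.
Variables (V : finType) (e : rel V) (G : V -> grp).
Hypotheses (e_sym : symmetric e) (e_irr : irreflexive e).
Local Notation word := (word G).
Local Notation Q := (gprod e G).
Local Notation pi := (@pi V e G).
Local Notation A u := (bs_action G e_sym e_irr u).
Local Notation lox := (lox e_sym e_irr).
Implicit Types (w f g : word) (L M : {set V}) (x y z o q : Q) (u v : V).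

Variable U : word -> Prop.

Definition pow_elt n q := exists w, in_pow e U n w /\ pi w = q.

Lemma pow_elt1 w : U w -> pow_elt 1 (pi w).
Proof.
move=> hw; exists w; split=> //; exists [:: w]; split=> //; split.
  by apply: List.Forall_cons => //; apply: List.Forall_nil.
by rewrite /= cats0; apply: weq_refl.
Qed.

Lemma pow_eltM n m x y : pow_elt n x -> pow_elt m y -> pow_elt (n + m) (x * y).
Proof.
move=> [w [[s [<- [hs hw]]] <-]] [w' [[s' [<- [hs' hw']]] <-]].
exists (w ++ w'); rewrite piM; split=> //; exists (s ++ s'); split; first by rewrite size_cat.
split; first by apply/List.Forall_app.
by rewrite flatten_cat; apply: weq_cat.
Qed.

Lemma pow_eltX n m x : pow_elt n x -> pow_elt (n * m.+1) (x ^+ m.+1).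
Proof.
move=> hx; elim: m => [|m IH]; first by rewrite muln1 expg1.
by rewrite mulnS expgS; apply: pow_eltM.
Qed.

(* Serre's lemma: if all products of two generators were elliptic, the subgroup would
   have a global fixed point. *)
Lemma lox_pair g v : in_gen e U g -> v \in lox (pi g) ->
  exists a b, [/\ U a, U b & v \in lox (pi a * pi b)].
Proof.
move=> [s [hs hg]] /loxP hv; apply: contrapT => hno; apply: hv.
have hpair a b : U a -> U b -> elliptic (A v) (pi a * pi b).
  by move=> ha hb; apply: loxPn; apply/negP => h; apply: hno; exists a, b.
have hsub q : q \in map (fun p : bool * word => pi p.2) s -> exists2 a, U a & q = pi a.
  elim: s hs {hg} => //= p s IH /List.Forall_cons_iff [hp hs].
  by rewrite inE => /orP[/eqP ->|/(IH hs)//]; exists p.2.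
have [||p hp] := @elliptic_generators _ _ (A v) (map (fun p : bool * word => pi p.2) s) (root e G v).
(* A generator is elliptic because its square, also a product of two elements of U, is. *)
- move=> q /hsub [a ha ->]; apply: loxPn; apply/negP => h.
  by have /loxP := @lox_exp _ _ _ e_sym e_irr _ 2 _ isT h; apply; rewrite expg2; apply: hpair.
- by move=> q q' /hsub [a ha ->] /hsub [b hb ->]; apply: hpair.
exists p; move/piP: hg => ->.
elim: s hp {hs hsub} => [|[b w] s IH] hp; first by rewrite act1.
rewrite /= piM actM IH; last by move=> q hq; apply: hp; rewrite inE hq orbT.
have hw : act (A v) (pi w) p = p by apply: hp; rewrite inE eqxx.
by case: (b) => /=; rewrite ?piV //; exact: (act_fixV hw).
Qed.

(** Either one pair is chosen for each vertex of [lox (pi g)], or all pairs of elements of U are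
    taken; k counts the cheaper option. *)
Lemma lox_cover g k : is_k e U k -> in_gen e U g ->
  exists hs : seq Q, [/\ size hs <= k, forall h, h \in hs -> pow_elt 2 h &
    forall v, v \in lox (pi g) -> exists2 h, h \in hs & v \in lox h].
Proof.
move=> hk hg.
have byV : exists hs : seq Q, [/\ size hs <= #|V|, forall h, h \in hs -> pow_elt 2 h &
    forall v, v \in lox (pi g) -> exists2 h, h \in hs & v \in lox h].
  have hf v : exists h, v \in lox (pi g) -> pow_elt 2 h /\ v \in lox h.
    case: (boolP (v \in lox (pi g))) => hv; last by exists 1.
    have [a [b [ha hb hab]]] := lox_pair hg hv; exists (pi a * pi b) => _; split=> //.
    by apply: (@pow_eltM 1 1); apply: pow_elt1.
  have [f {}hf] := choice hf.
  exists (map f (enum (lox (pi g)))); split.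
  - by rewrite size_map -cardE; apply: max_card.
  - by move=> h /mapP[v]; rewrite mem_enum => /hf [h1 _] ->.
  - by move=> v hv; exists (f v); [apply: map_f; rewrite mem_enum|case: (hf v hv)].
case: hk => [[m [[s [sm [hs [_ hcov]]]] ->]]|[_ ->]]; last exact: byV.
have [hm|hm] := leqP (m ^ 2) #|V|; last by [].
have hsub q : q \in map pi s -> exists2 a, U a & q = pi a.
  elim: s hs {hcov sm} => //= w s IH /List.Forall_cons_iff [hw hs].
  by rewrite inE => /orP[/eqP ->|/(IH hs)//]; exists w.
have hin w : U w -> pi w \in map pi s.
  move=> /hcov; elim: s {hs sm hcov hsub} => [|w' s IH]; first by move/List.Exists_nil.
  by case/List.Exists_cons => [/piP h|/IH h]; rewrite /= inE ?h ?eqxx ?orbT.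
exists [seq a * b | a <- map pi s, b <- map pi s]; split.
- by rewrite size_allpairs !size_map sm mulnn.
- move=> h /allpairsP[[a b] /= [/hsub [a' ha ->] /hsub [b' hb ->] ->]].
  by apply: (@pow_eltM 1 1); apply: pow_elt1.
- move=> v hv; have [a [b [ha hb hab]]] := lox_pair hg hv.
  by exists (pi a * pi b) => //; apply: allpairs_f; apply: hin.
Qed.

(** A new h costs [2 * s], while n multiplies the length so far. The slack [M - 2] carried through
    the induction pays for [2 * s]. *)
Lemma lox_collect (M b : nat) (hs : seq Q) : 1 < M -> b <= M + (M - 2) ^ 2 ->
  (forall g h : Q, exists s n, [/\ 0 < s, 2 * s <= b, 0 < n <= M.-1 &
    lox g :|: lox h \subset lox (h ^+ s * g ^+ n)]) ->
  (forall h, h \in hs -> pow_elt 2 h) -> 0 < size hs ->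
  exists n (f : Q), [/\ 0 < n, n + (M - 2) <= M ^ size hs, pow_elt n f &
    forall h, h \in hs -> lox h \subset lox f].
Proof.
move=> M1 hb hcomb; elim: hs => // h [|h' hs] IH hpow _.
  exists 2, h; split=> //; first by rewrite expn1; lia.
    by apply: hpow; rewrite mem_head.
  by move=> h'; rewrite inE => /eqP ->.
have [|//|l [f [l0 hl hf hsub]]] := IH.
  by move=> k hk; apply: hpow; rewrite inE hk orbT.
have [s [n [s0 hsb /andP[n0 hn] hlox]]] := hcomb f h.
exists (2 * s + l * n), (h ^+ s * f ^+ n); split.
- by lia.
- have : M <= M ^ size (h' :: hs) by rewrite -{1}(expn1 M) leq_pexp2l // ltnW.
  rewrite [size (h :: _)]/= expnS; move: (M ^ size (h' :: hs))%N hl => X hl hX.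
  (* From l <= X - (M - 2) and X >= M one gets b + l (M - 1) + (M - 2) <= M X - X + M <= M X; the
     bound on b is exactly what closes this. *)
  have h1 : l * n <= l * M.-1 by rewrite leq_mul2l hn orbT.
  move: h1 hb; rewrite -mulnn; case: M M1 hX hl {hcomb hn IH} => [|[|M]] // _ hX hl h1 hb.
  by nia.
- apply: pow_eltM.
    by rewrite -(prednK s0); apply/pow_eltX/hpow; rewrite mem_head.
  by rewrite -(prednK n0); apply: pow_eltX.
- move=> k; rewrite inE => /orP[/eqP ->|/hsub hk].
    by apply: subset_trans hlox; apply: subsetUr.
  by apply: subset_trans hlox; apply: subset_trans hk _; apply: subsetUl.
Qed.

Local Open Scope nat_scope.

(** In general s < 16d + 4 + 2^d and n < 8d + 4 + 2^d (d + 1), which is at most 2^(d+3) d with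
    equality at d = 1. Without 2-torsion s = 8d + 6 and n <= d + 6 <= 6d + 4. *)
Lemma combine_bound : 0 < dimG e -> exists b M : nat,
  [/\ 1 < M, b <= M + (M - 2) ^ 2,
     (~ has_order2 G -> M = 6 * dimG e + 5) /\ (has_order2 G -> M = 2 ^ (dimG e + 3) * dimG e) &
     forall g h : Q, exists s n, [/\ 0 < s, 2 * s <= b, 0 < n <= M.-1 &
       lox g :|: lox h \subset lox (h ^+ s * g ^+ n)%g]].
Proof.
set d := dimG e => d0; have [o2|no2] := pselect (has_order2 G).
  have hX : d.+1 <= 2 ^ d by rewrite ltn_expl.
  exists (2 * (16 * d + 4 + 2 ^ d)), (2 ^ (d + 3) * d).
  rewrite expnD; set X := 2 ^ d in hX *.
  have h8 : 16 * d <= X * 8 * d by rewrite leq_mul2r; apply/orP; right; lia.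
  have hXd : X <= X * d by rewrite leq_pmulr.
  split=> //.
  - by lia.
  - rewrite -mulnn (_ : 2 ^ 3 = 8) //; have : 14 * (X * 8 * d - 2) <= (X * 8 * d - 2) * (X * 8 * d - 2).
      by rewrite leq_mul2r; apply/orP; right; lia.
    by lia.
  move=> g h; have [||s [n [h1 h2 h3]]] := @combine_general _ _ _ e_sym e_irr g h (16 * d + 4) (8 * d + 4).
  - by rewrite -/d; lia.
  - by rewrite -/d.
  rewrite -/d -/X in h1 h2; exists s, n; split=> //; [by lia|by lia|].
  have : 2 * (7 * d - 1) <= X * (7 * d - 1) by rewrite leq_mul2r; apply/orP; right; lia.
  by rewrite (_ : 2 ^ 3 = 8) // mulnBr mulnS in h2 *; lia.
exists (2 * (8 * d + 6)), (6 * d + 5); split=> //; first by lia.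
  by rewrite -mulnn; nia.
move=> g h; have [|//|s [n [h1 h2 h3]]] := @combine_no2 _ _ _ e_sym e_irr g h (8 * d + 6) 6 no2.
  by [].
by rewrite -/d in h2; exists s, n; split=> //; lia.
Qed.

End ShortElements.

Theorem theoremA (V : finType) (e : rel V) (esym : symmetric e)
  (eirr : irreflexive e) (hV : 0 < #|V|)
  (G : V -> grp) (hnt : forall v, exists a : G v, a <> gone (G v))
  (U : word G -> Prop) (hU : saturated e U)
  (k : nat) (hk : is_k e U k) (N : nat)
  (hN : (~ has_order2 G -> N = (6 * dimG e + 5) ^ k) /\
        (has_order2 G -> N = (2 ^ (dimG e + 3) * dimG e) ^ k)) :
  ((exists g, in_gen e U g /\ regular e g) ->
     exists n, 1 <= n <= N /\ exists g, in_pow e U n g /\ regular e g) /\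
  ((exists g, in_gen e U g /\ strongly_irreducible e g) ->
     exists n, 1 <= n <= N /\ exists g, in_pow e U n g /\ strongly_irreducible e g).
Proof.
have [v0 _] := card_gt0P hV.
have [b [M [M1 hb hM hcomb]]] := combine_bound G esym eirr (dim_gt0 e v0).
have eN : N = M ^ k.
  have [o2|no2] := pselect (has_order2 G).
    by rewrite (proj2 hN o2) (proj2 hM o2).
  by rewrite (proj1 hN no2) (proj1 hM no2).
have main g : in_gen e U g -> lox esym eirr (pi e g) != set0 ->
    exists n, 1 <= n <= N /\ exists f, in_pow e U n f /\
      lox esym eirr (pi e g) \subset lox esym eirr (pi e f).
  move=> hg /set0Pn [v hv]; have [hs [hsz hpow hcov]] := lox_cover esym eirr hk hg.
  have s0 : 0 < size hs by case: hs hcov {hsz hpow} => // /(_ v hv) [].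
  have [n [f [n0 hn [w [hw ef]] hsub]]] := lox_collect M1 hb hcomb hpow s0.
  exists n; split.
    rewrite n0 /= eN; apply: leq_trans (leq_pexp2l (ltnW M1) hsz).
    by apply: leq_trans hn; apply: leq_addr.
  exists w; split=> //; rewrite ef; apply/subsetP => u /hcov [h hh hu].
  by apply: (subsetP (hsub h hh)).
split=> -[g [hg hP]].
  have [|n [hn [f [hf hsub]]]] := main g hg.
    (* With [lox] empty, a power of g would be conjugate into any vertex group, here that of
       [v0]. *)
    apply/eqP => h0; have [|n n0 hc] := @regular_lox _ _ _ esym eirr _ hP [set v0].
      by rewrite h0 sub0set.
    by case: (hP n n0) => h _; apply: h; exists v0.
  by exists n; split=> //; exists f; split=> //; apply: regular_mono hsub hP.
have [|n [hn [f [hf hsub]]]] := main g hg.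
  apply/eqP => h0; case: (hP) => h _; apply: h; exists v0.
  by apply: (@strongly_irreducible_lox _ _ _ esym eirr _ hP); rewrite h0 sub0set.
by exists n; split=> //; exists f; split=> //; apply: strongly_irreducible_mono hsub hP.
Qed.
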